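(* Let $d\ge1$ be an integer, $\lambda>0$, $\alpha\in(0,1)$, and let $p,q\ge0$ with $p+q=1$. For $\gamma>0$ let $$\mathbf{A}(t)=\mathbf{A}_\gamma(t)=\sum_{j=0}^{N(t)}\epsilon_j\,\mathbf{Y}_j,\qquad t>0,$$ where $N(t)$, $t>0$, is a Poisson process with rate $\lambda$; the $\epsilon_j$ ($j=0,1,2,\dots$) satisfy $P\{\epsilon_j=+1\}=p$, $P\{\epsilon_j=-1\}=q$; the $\mathbf{Y}_j$ are random vectors in $\mathbb{R}^d$ all distributed as the Gaussian vector $\mathbf{Y}\sim N(\mathbf{0},\sigma_\alpha^2)$ with random variance $\sigma^2_\alpha\sim\frac{\gamma}{2}E_\alpha$, where $E_\alpha$ is the reciprocal gamma random variable with $P\{E_\alpha\in dx\}=\frac{x^{-\alpha-1}}{\Gamma(\alpha)}e^{-1/x}\,dx$, $x>0$; and $N$, $(\epsilon_j)_{j\ge0}$, $(\mathbf{Y}_j)_{j\ge0}$ are all mutually independent. Let $\boldsymbol{\mathfrak{S}}^{2\alpha}(t)\in\mathbb{R}^d$ be the isotropic $2\alpha$-stable process, with $\mathbb{E}e^{i\boldsymbol{\xi}\cdot\boldsymbol{\mathfrak{S}}^{2\alpha}(t)}=e^{-t|\boldsymbol{\xi}|^{2\alpha}}$, $\boldsymbol{\xi}\in\mathbb{R}^d$. Put $$C=\int_{\mathbb{R}^d}\frac{1-\cos y_1}{|\mathbf{y}|^{2\alpha+d}}\,d\mathbf{y},\qquad t^*=\lambda\,\frac{\Gamma(\alpha+\frac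 d2)}{\pi^{d/2}\,\Gamma(\alpha)}\,C\,t .$$ Then, for every $t>0$, $$\mathbf{A}_\gamma(t/\gamma^\alpha)\ \longrightarrow\ \boldsymbol{\mathfrak{S}}^{2\alpha}(t^* )\qquad\text{in distribution as }\gamma\to0,$$ and the limit process $t\mapsto\boldsymbol{\mathfrak{S}}^{2\alpha}(t^* )$ has infinitesimal generator $$\mathcal{A}f(\mathbf{x})=-\lambda\,\frac{\Gamma(\alpha+\frac d2)}{\pi^{d/2}\,\Gamma(\alpha)}\,C\,(-\triangle)^\alpha f(\mathbf{x}),\qquad f\in\mathscr{S}(\mathbb{R}^d).$$
   Context: Conditionally on $\sigma_\alpha^2=s$, the vector $\mathbf{Y}$ is centred Gaussian in $\mathbb{R}^d$ with covariance matrix $s$ times the identity; explicitly, $\mathbf{Y}$ has density $$\nu_{\mathbf{Y}}(\mathbf{y})=\frac{\Gamma(\alpha+\frac d2)}{\pi^{d/2}\,\Gamma(\alpha)}\,\frac{\gamma^\alpha}{(|\mathbf{y}|^2+\gamma)^{\alpha+\frac d2}},\qquad \mathbf{y}\in\mathbb{R}^d.$$ Fractional Laplacian, for $\alpha\in(0,1)$ and $f\in\mathscr{S}(\mathbb{R}^d)$ (rapidly decaying $C^\infty$ functions): $$-(-\triangle)^\alpha f(\mathbf{x})=\frac{C_d(\alpha)}{2}\int_{\mathbb{R}^d}\frac{f(\mathbf{x}+\mathbf{y})+f(\mathbf{x}-\mathbf{y})-2f(\mathbf{x})}{|\mathbf{y}|^{2\alpha+d}}\,d\mathbf{y},\qquad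 C_d(\alpha)=\left(\int_{\mathbb{R}^d}\frac{1-\cos y_1}{|\mathbf{y}|^{2\alpha+d}}\,d\mathbf{y}\right)^{-1},$$ where $y_1$ is the first coordinate of $\mathbf{y}$. The constant $C_d(\alpha)$ is the normalization for which $(-\triangle)^\alpha$ has Fourier multiplier $|\boldsymbol{\xi}|^{2\alpha}$. Fourier transform: $\widehat f(\boldsymbol{\xi})=\int_{\mathbb{R}^d}e^{i\boldsymbol{\xi}\cdot\mathbf{x}}f(\mathbf{x})\,d\mathbf{x}$. Generator convention: for a Lévy process $\mathbf{F}_t$ on $\mathbb{R}^d$ started at $\mathbf{0}$, its Fourier symbol is $\Phi(\boldsymbol{\xi})=-\partial_t\,\mathbb{E}e^{i\boldsymbol{\xi}\cdot\mathbf{F}_t}\big|_{t=0}$ (so $\mathbb{E}e^{i\boldsymbol{\xi}\cdot\mathbf{F}_t}=e^{-t\Phi(\boldsymbol{\xi})}$), and its generator $\mathcal{A}$ is the operator $$(\mathcal{A}f)(\mathbf{x})=-\frac{1}{(2\pi)^d}\int_{\mathbb{R}^d}e^{-i\boldsymbol{\xi}\cdot\mathbf{x}}\,\Phi(\boldsymbol{\xi})\,\widehat f(\boldsymbol{\xi})\,d\boldsymbol{\xi},$$ i.e. $\widehat{\mathcal{A}f}(\boldsymbol{\xi})=-\Phi(\boldsymbol{\xi})\widehat f(\boldsymbol{\xi})$. *)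

(* Defs.v *)
From HB Require Import structures.
From mathcomp Require Import all_boot all_order all_algebra.
From mathcomp Require Import all_classical all_reals all_analysis.
From mathcomp Require Import complex.

Set Implicit Arguments.
Unset Strict Implicit.
Unset Printing Implicit Defensive.

Import Order.TTheory GRing.Theory Num.Theory.
Import numFieldNormedType.Exports.

Local Open Scope classical_set_scope.
Local Open Scope ring_scope.

(* The product sigma-algebra on matrices, generated by the entries; on 'rV[R]_n
   it is the Borel sigma-algebra of R^n. *)
Definition measure_matrix_display : measure_display -> measure_display.
Proof. exact. Qed.

Section measurable_matrix.
Context {d} {T : measurableType d} (m n : nat).

Definition entries_system : set_system 'M[T]_(m, n) :=
  \bigcup_(ij in [set: 'I_m * 'I_n])
    preimage_set_system setT (fun A : 'M[T]_(m, n) => A ij.1 ij.2) measurable.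

Let matrix_set0 : <<s entries_system >> set0.
Proof. exact: sigma_algebra0. Qed.

Let matrix_setC A : <<s entries_system >> A -> <<s entries_system >> (~` A).
Proof. exact: sigma_algebraC. Qed.

Let matrix_bigcup (F : (set 'M[T]_(m, n))^nat) :
  (forall i, <<s entries_system >> (F i)) ->
  <<s entries_system >> (\bigcup_i F i).
Proof. exact: sigma_algebra_bigcup. Qed.

HB.instance Definition _ := @isMeasurable.Build (measure_matrix_display d)
  'M[T]_(m, n) <<s entries_system >> matrix_set0 matrix_setC matrix_bigcup.

Lemma measurable_entry i j :
  measurable_fun [set: 'M[T]_(m, n)] (fun A : 'M[T]_(m, n) => A i j).
Proof.
move=> _ B mB; rewrite setTI; apply: sub_sigma_algebra.
by exists (i, j) => //; exists B => //; rewrite setTI.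
Qed.

Lemma measurable_fun_matrix d' (U : measurableType d') (f : U -> 'M[T]_(m, n)) :
  (forall i j, measurable_fun setT (fun x => f x i j)) ->
  measurable_fun setT f.
Proof.
move=> mf; apply: (@measurability _ _ _ _ setT f entries_system) => //.
move=> _ [_ [[i j] _ [B mB <-]] <-].
rewrite !setTI; have := mf i j measurableT B mB.
by rewrite setTI.
Qed.

End measurable_matrix.

Section lebesgue_measure_Rn.
Context {R : realType}.

Definition rV_cons n (xv : measurableTypeR R * 'rV[R]_n) : 'rV[R]_n.+1 :=
  \row_j oapp (xv.2 0) xv.1 (unlift 0 j).

Lemma measurable_rV_cons n : measurable_fun setT (@rV_cons n).
Proof.
apply: measurable_fun_matrix => i j.
case: (unliftP 0 j) => [k|] ->.
  apply: (eq_measurable_fun (fun x : measurableTypeR R * 'rV[R]_n => x.2 0 k)).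
    by move=> x _; rewrite mxE liftK.
  exact: (measurableT_comp (measurable_entry 0 k) measurable_snd).
apply: (eq_measurable_fun fst); last exact: measurable_fst.
by move=> x _; rewrite mxE unlift_none.
Qed.

Definition rV_uncons n (v : 'rV[R]_n.+1) : measurableTypeR R * 'rV[R]_n :=
  (v 0 0, \row_j v 0 (lift 0 j)).

Lemma measurable_rV_uncons n : measurable_fun setT (@rV_uncons n).
Proof.
apply: measurable_fun_pair => /=; first exact: measurable_entry.
apply: measurable_fun_matrix => i j.
apply: (eq_measurable_fun (fun v : 'rV[R]_n.+1 => v 0 (lift 0 j))).
  by move=> v _; rewrite mxE.
exact: measurable_entry.
Qed.

Lemma rV_consK n : cancel (@rV_cons n) (@rV_uncons n).
Proof.
case=> x v; rewrite /rV_uncons /rV_cons mxE unlift_none /=; congr pair.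
by apply/rowP => j; rewrite !mxE liftK.
Qed.

Section push.
Context n (mu : {sigma_finite_measure set 'rV[R]_n -> \bar R}).

Definition rV_push := pushforward (lebesgue_measure \x mu)%E (@rV_cons n).

Let mrV_cons A : measurable A -> measurable (@rV_cons n @^-1` A).
Proof.
by move=> mA; rewrite -[X in measurable X]setTI; exact: measurable_rV_cons.
Qed.

Let rV_push0 : rV_push set0 = 0%E.
Proof. by rewrite /rV_push /pushforward preimage_set0 measure0. Qed.

Let rV_push_ge0 A : (0 <= rV_push A)%E.
Proof. by rewrite /rV_push /pushforward measure_ge0. Qed.

Let rV_push_sigma_additive : semi_sigma_additive rV_push.
Proof.
move=> F mF tF mUF; rewrite /rV_push /pushforward preimage_bigcup.
apply: measure_semi_sigma_additive.
- by move=> k; exact: mrV_cons.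
- apply/trivIsetP => /= i j _ _ ij; rewrite -preimage_setI.
  by move/trivIsetP : tF => /(_ _ _ _ _ ij) ->//; rewrite preimage_set0.
- by rewrite -preimage_bigcup; exact: mrV_cons.
Qed.

HB.instance Definition _ := isMeasure.Build _ _ _
  rV_push rV_push0 rV_push_ge0 rV_push_sigma_additive.

Let rV_push_sigma_finite : sigma_finite setT rV_push.
Proof.
have /sigma_finiteP[F [TF ndF Foo]] := sigma_finiteT (@lebesgue_measure R).
have /sigma_finiteP[G [TG ndG Goo]] := sigma_finiteT mu.
exists (fun k => @rV_uncons n @^-1` (F k `*` G k)).
  rewrite -preimage_bigcup [X in _ @^-1` X](_ : _ = setT) ?preimage_setT//.
  rewrite -subTset => -[x v] _.
  have [k _ Fkx] : (\bigcup_i F i) x by rewrite -TF.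
  have [l _ Glv] : (\bigcup_i G i) v by rewrite -TG.
  exists (maxn k l) => //; split => /=.
    by move: x Fkx; exact/subsetPset/ndF/leq_maxl.
  by move: v Glv; exact/subsetPset/ndG/leq_maxr.
move=> k; have [mFk Fk] := Foo k; have [mGk Gk] := Goo k.
have mFG : measurable (F k `*` G k) by exact: measurableX.
split; first by rewrite -[X in measurable X]setTI; exact: measurable_rV_uncons.
rewrite /rV_push /pushforward -comp_preimage.
have -> : @rV_uncons n \o @rV_cons n = id by apply/funext => x; exact: rV_consK.
by rewrite preimage_id product_measure1E// lte_mul_pinfty// ge0_fin_numE.
Qed.

HB.instance Definition _ := Measure_isSigmaFinite.Build _ _ _
  rV_push rV_push_sigma_finite.

End push.

(* Lebesgue measure on R^n: the point mass for n = 0, and the product of the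
   one-dimensional measure with the one on R^n, transported along
   (x, v) |-> (x, v_1, .., v_n), for n.+1. *)
Fixpoint leb n : {sigma_finite_measure set 'rV[R]_n -> \bar R} :=
  match n with
  | 0%N => (dirac (0 : 'rV[R]_0) : {sigma_finite_measure set _ -> \bar R})
  | m.+1 => rV_push (leb m)
  end.

End lebesgue_measure_Rn.

Section euclidean.
Context {R : realType} {d : nat}.

Definition dot (u v : 'rV[R]_d) : R := \sum_(i < d) u 0 i * v 0 i.

(* The library norm `|v| on 'rV[R]_d is the sup norm. *)
Definition enorm (v : 'rV[R]_d) : R := Num.sqrt (dot v v).

End euclidean.

Section complex_integral.
Context {R : realType}.

Definition expi (t : R) : R[i] := Complex (cos t) (sin t).

Definition cintegral d (T : measurableType d)
    (mu : {measure set T -> \bar R}) (f : T -> R[i]) : R[i] :=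
  Complex (\int[mu]_x complex.Re (f x)) (\int[mu]_x complex.Im (f x)).

End complex_integral.

Section analysis_Rd.
Context {R : realType} {d : nat}.
Implicit Types f : 'rV[R]_d -> R[i].

(* Iterated partial derivative along the coordinate directions listed in s. *)
Definition partials (s : seq 'I_d) (f : 'rV[R]_d -> R) : 'rV[R]_d -> R :=
  foldr (fun i g => 'D_(delta_mx 0 i : 'rV[R]_d) g) f s.

Definition schwartz_real (f : 'rV[R]_d -> R) : Prop :=
  [/\ forall s i x, derivable (partials s f) x (delta_mx 0 i : 'rV[R]_d),
      forall s, continuous (partials s f) &
      forall s (k : nat), exists M : R,
        forall x, enorm x ^+ k * `|partials s f x| <= M].

Definition schwartz f : Prop :=
  schwartz_real (fun x => complex.Re (f x)) /\
  schwartz_real (fun x => complex.Im (f x)).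

Definition fourier f (xi : 'rV[R]_d) : R[i] :=
  cintegral (leb d) (fun x => expi (dot xi x) * f x).

(* The integral of (1 - cos y_1) / |y|^(2 alpha + d); i is the index of the
   coordinate y_1. *)
Definition cos_integral (alpha : R) (i : 'I_d) : R :=
  \int[leb d]_y ((1 - cos (y 0 i)) / enorm y `^ (2 * alpha + d%:R)).

Definition frac_laplacian (alpha : R) (i : 'I_d) f (x : 'rV[R]_d) : R[i] :=
  - (((cos_integral alpha i)^-1 / 2)%:C%C *
     cintegral (leb d) (fun y =>
       (f (x + y) + f (x - y) - 2 * f x) *
       ((enorm y `^ (2 * alpha + d%:R))^-1)%:C%C)).

End analysis_Rd.

Section densities.
Context {R : realType}.

Definition Gamma (a : R) : R :=
  \int[lebesgue_measure]_(x in `]0, +oo[) (x `^ (a - 1) * expR (- x)).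

Definition recip_gamma_pdf (alpha x : R) : R :=
  x `^ (- alpha - 1) / Gamma alpha * expR (- x^-1).

(* N(0, s Id) on R^d; normal_pdf takes the standard deviation. *)
Definition gauss_law d (s : R) (B : set 'rV[R]_d) : \bar R :=
  (\int[leb d]_(y in B) (\prod_(i < d) normal_pdf 0 (Num.sqrt s) (y 0 i))%:E)%E.

(* The law of a vector that is N(0, s Id) conditionally on sigma^2 = s, where
   sigma^2 is gamma / 2 times a reciprocal gamma variable. *)
Definition random_variance_gauss_law d (alpha gamma : R) (B : set 'rV[R]_d)
    : \bar R :=
  (\int[lebesgue_measure]_(x in `]0%R, +oo[)
    (gauss_law (gamma / 2 * x) B * (recip_gamma_pdf alpha x)%:E))%E.

End densities.

Section independence.
Context {R : realType} {d0} {Om : measurableType d0} (P : probability Om R).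

Definition mutually_independent (I : eqType) (F : I -> set_system Om) : Prop :=
  forall (s : seq I) (A : I -> set Om), uniq s ->
    (forall i, i \in s -> F i (A i)) ->
    P (\bigcap_(i in [set` s]) A i) = (\prod_(i <- s) fine (P (A i)))%:E.

Definition sigma_rv d' (V : measurableType d') (X : Om -> V) : set_system Om :=
  preimage_set_system setT X measurable.

(* Times are real numbers; only nonnegative ones are meaningful. *)
Definition sigma_process d' (V : measurableType d') (X : R -> Om -> V)
    : set_system Om :=
  <<s \bigcup_(t in [set t : R | 0 <= t]) sigma_rv (X t) >>.

Definition time_sequence (t : nat -> R) : Prop :=
  0 <= t 0%N /\ {homo t : i j / (i <= j)%N >-> i <= j}.

End independence.

Section processes.
Context {R : realType} {d0} {Om : measurableType d0} (P : probability Om R).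

Definition poisson_process (lambda : R) (N : R -> {RV P >-> nat}) : Prop :=
  [/\ {ae P, forall w, N 0 w = 0%N},
      forall s t : R, 0 <= s -> s < t -> forall k : nat,
        P [set w | N t w = (N s w + k)%N] =
        (poisson_pmf (lambda * (t - s)) k)%:E,
      forall t, time_sequence t ->
        mutually_independent P (fun i : nat =>
          sigma_rv (fun w => (N (t i.+1) w)%:R - (N (t i) w)%:R : R)) &
      {ae P, forall w,
        (forall s t : R, 0 <= s -> s <= t -> (N s w <= N t w)%N) /\
        (forall t : R, 0 <= t -> \forall s \near t^'+, N s w = N t w)}].

Definition levy_process d (F : R -> {RV P >-> 'rV[R]_d}) : Prop :=
  [/\ {ae P, forall w, F 0 w = 0},
      forall t, time_sequence t ->
        mutually_independent P (fun i : nat =>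
          sigma_rv (fun w => F (t i.+1) w - F (t i) w)),
      forall (s h : R) (B : set 'rV[R]_d), 0 <= s -> 0 <= h -> measurable B ->
        P [set w | B (F (s + h) w - F s w)] = P [set w | B (F h w)] &
      forall (t e : R), 0 <= t -> 0 < e ->
        P [set w | e < enorm (F s w - F t w)]
          @[s --> within [set s | 0 <= s] (nbhs t)] --> 0%E].

Definition char_fun d (X : Om -> 'rV[R]_d) (xi : 'rV[R]_d) : R[i] :=
  cintegral P (fun w => expi (dot xi (X w))).

Definition isotropic_stable d (alpha : R) (S : R -> {RV P >-> 'rV[R]_d})
    : Prop :=
  levy_process S /\
  forall (t : R) (xi : 'rV[R]_d), 0 <= t ->
    char_fun (S t) xi = (expR (- (t * enorm xi `^ (2 * alpha))))%:C%C.

(* Phi xi is minus the right derivative at t = 0 of E exp(i xi . F_t); the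
   convergence in R[i] is that of the real and imaginary parts. *)
Definition fourier_symbol d (F : R -> {RV P >-> 'rV[R]_d})
    (Phi : 'rV[R]_d -> R[i]) : Prop :=
  forall xi,
    complex.Re (char_fun (F t) xi - char_fun (F 0) xi) / t
      @[t --> 0^'+] --> - complex.Re (Phi xi) /\
    complex.Im (char_fun (F t) xi - char_fun (F 0) xi) / t
      @[t --> 0^'+] --> - complex.Im (Phi xi).

Definition has_generator d (F : R -> {RV P >-> 'rV[R]_d})
    (A : ('rV[R]_d -> R[i]) -> 'rV[R]_d -> R[i]) : Prop :=
  levy_process F /\
  exists2 Phi, fourier_symbol F Phi &
    forall f, schwartz f -> forall x,
      A f x = - (((2 * pi) ^- d)%:C%C *
        cintegral (leb d) (fun xi =>
          expi (- dot xi x) * Phi xi * fourier f xi)).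

Definition randomized_sum d (N : R -> {RV P >-> nat}) (eps : nat -> {RV P >-> R})
    (Y : nat -> {RV P >-> 'rV[R]_d}) (t : R) (w : Om) : 'rV[R]_d :=
  \sum_(j < (N t w).+1) eps j w *: Y j w.

(* The process N and all the variables eps_j, Y_j (j >= 0) form one mutually
   independent family. *)
Definition independent_inputs d (N : R -> {RV P >-> nat})
    (eps : nat -> {RV P >-> R}) (Y : nat -> {RV P >-> 'rV[R]_d}) : Prop :=
  mutually_independent P (fun i : option (nat + nat) =>
    match i with
    | None => sigma_process N
    | Some (inl j) => sigma_rv (eps j)
    | Some (inr j) => sigma_rv (Y j)
    end).

Definition randomized_sum_model d (lambda alpha p q gamma : R)
    (N : R -> {RV P >-> nat}) (eps : nat -> {RV P >-> R})
    (Y : nat -> {RV P >-> 'rV[R]_d}) : Prop :=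
  [/\ poisson_process lambda N,
      forall j, P [set w | eps j w = 1] = p%:E /\
                P [set w | eps j w = -1] = q%:E,
      forall j (B : set 'rV[R]_d), measurable B ->
        P (Y j @^-1` B) = random_variance_gauss_law alpha gamma B &
      independent_inputs N eps Y].

End processes.

(* Convergence in distribution, along a filter G, of variables that may live on
   different probability spaces. *)
Definition cvg_in_distribution {R : realType} (I : Type) (G : set_system I)
    (V : topologicalType)
    (disp : I -> measure_display) (Om : forall i, measurableType (disp i))
    (P : forall i, probability (Om i) R) (X : forall i, Om i -> V)
    (disp' : measure_display) (Om' : measurableType disp')
    (P' : probability Om' R) (Z : Om' -> V) : Prop :=
  forall f : V -> R, continuous f -> (exists M : R, forall v, `|f v| <= M) ->
    ('E_(P i)[f \o X i])%E @[i --> G] --> ('E_P'[f \o Z])%E.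

(* Main.v *)
Require Import Defs.
From mathcomp Require Import all_boot all_order all_algebra.
From mathcomp Require Import all_classical all_reals all_analysis.
From mathcomp Require Import measurable_realfun complex.
From mathcomp Require Import ring lra.
Set Implicit Arguments.
Unset Strict Implicit.
Unset Printing Implicit Defensive.
Import Order.TTheory GRing.Theory Num.Theory.
Import numFieldNormedType.Exports.
Local Open Scope classical_set_scope.
Local Open Scope ring_scope.

(** Convergence. Let phi be the transform of one vector Y; it is real and even, so
    the signs do not matter, and summing over the values of N(t) gives the
    transform phi exp(- lambda t (1 - phi)) for A(t), the extra factor phi coming
    from the summand of index 0 ([cos_transform_compound_sum]). At time
    t / gamma^alpha the exponent is lambda t gamma^(-alpha) (1 - phi). Since Y is a
    mixture of Gaussian vectors over a reciprocal gamma variance, 1 - phi is an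
    integral over the variance; the substitution that removes gamma from the
    exponential and dominated convergence ([cvg_jump_defect]) give the limit
    lambda t |xi|^(2 alpha) M / Gamma(alpha) with
    M = int_0^oo u^(-alpha-1) (1 - e^(-u/4)) du ([stable_mass]).
    Convergence of transforms implies convergence in distribution
    ([levy_continuity]): smoothing by a Gaussian turns it into pointwise
    convergence of densities, Fatou's lemma then bounds lower limits of
    expectations of nonnegative Lipschitz functions, and every bounded continuous
    function is squeezed between monotone limits of such functions.

    The constant. Writing |y|^(-2 alpha - d) as an integral of exp(- s |y|^2)
    against a power of s and integrating the Gaussians in y first gives
    int (1 - cos(xi.y)) |y|^(-2 alpha - d) dy Gamma(alpha + d/2)
    = pi^(d/2) |xi|^(2 alpha) M ([cosine_exponent_Gamma]). At a basis vector this
    says that C Gamma(alpha + d/2) = pi^(d/2) M, all factors being finite and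
    positive, which identifies the limit exponent with K t |xi|^(2 alpha); at a
    general xi it says that int (1 - cos(xi.y)) |y|^(-2 alpha - d) dy is
    C |xi|^(2 alpha) ([cosine_exponentE]).

    The generator. The process S(K t) has symbol K |xi|^(2 alpha), so the claim is
    that the singular integral has Fourier multiplier |xi|^(2 alpha). For a real
    rapidly decreasing u, Fourier inversion ([fourier_inversion]) writes
    u(x+y) + u(x-y) - 2 u(x) as (2 pi)^(-d) times the integral over xi of
    - 2 (1 - cos(xi.y)) e^(-i xi.x) times the transform of u. Dividing by
    |y|^(2 alpha + d), integrating over y and exchanging the integrals produces
    C |xi|^(2 alpha) under the integral over xi ([Rintegral_second_difference]).
    The exchange and the inversion rest on the decay of the transform of u, which
    comes from integration by parts ([fourier_amp_le]). *)

(** * Integrals of weighted test functions *)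

Section weighted_laws.
Local Open Scope ereal_scope.
Context {R : realType} {dV} {V : measurableType dV}.
Import HBNNSimple.

(** The right-hand side depends on the measure, w and Y only through the integrals
    of w over events of Y. *)
Lemma integral_weighted_limn d (T : measurableType d)
    (mu : {measure set T -> \bar R}) (w : T -> R) (Y : T -> V)
    (g : V -> \bar R) (mg : measurable_fun [set: V] g) :
  measurable_fun [set: T] w -> (forall x, 0 <= w x)%R ->
  measurable_fun [set: T] Y -> (forall v, 0 <= g v) ->
  \int[mu]_x ((w x)%:E * g (Y x)) =
  limn (fun n => let h := nnsfun_approx measurableT mg n in
    \sum_(r \in range h) (r%:E * \int[mu]_(x in Y @^-1` (h @^-1` [set r])) (w x)%:E)).
Proof.
move=> mw w0 mY g0.
pose h := nnsfun_approx measurableT mg.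
have mhY n : measurable_fun setT (h n \o Y) by apply: measurableT_comp.
have mYA A : measurable A -> measurable (Y @^-1` A).
  by move=> mA; rewrite -[X in measurable X]setTI; exact: mY.
transitivity (limn (fun n => \int[mu]_x ((w x)%:E * (h n (Y x))%:E))).
  rewrite -monotone_convergence//.
  - apply: eq_integral => x _; apply/esym/cvg_lim => //.
    by apply: cvgeZl => //; apply: cvg_nnsfun_approx.
  - by move=> n; apply: emeasurable_funM; apply/measurable_EFinP => //; exact: mhY.
  - by move=> n x _; rewrite mule_ge0 ?lee_fin.
  - move=> x _ m n mn; rewrite lee_pmul ?lee_fin//.
    exact/lefP/nd_nnsfun_approx.
congr (limn _); apply/funext => n /=.
transitivity (\int[mu]_x (\sum_(r \in range (h n))
    (r%:E * ((w x)%:E * (\1_(Y @^-1` (h n @^-1` [set r])) x)%:E)))).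
  apply: eq_integral => x _.
  rewrite (fimfunE (h n)) -fsumEFin// ge0_mule_fsumr; last first.
    by move=> r; rewrite EFinM; exact: nnfun_muleindic_ge0.
  by apply: eq_fsbigr => r _; rewrite EFinM muleCA.
have pos r x : 0 <= r%:E * ((w x)%:E * (\1_(Y @^-1` (h n @^-1` [set r])) x)%:E).
  rewrite muleCA mule_ge0 ?lee_fin//.
  exact: (nnfun_muleindic_ge0 (h n) r (Y x)).
have mr r : measurable_fun setT (fun x => ((w x)%:E * (\1_(Y @^-1` (h n @^-1` [set r])) x)%:E)).
  apply/measurable_EFinP; apply: measurable_funM => //.
  exact/measurable_indic/mYA.
rewrite ge0_integral_fsum//; last by move=> r; apply: measurable_funeM.
apply: eq_fsbigr => r /set_mem[v _ hvr].
have r0 : (0 <= r)%R by rewrite -hvr.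
rewrite ge0_integralZl//; last first.
  by move=> x _; rewrite mule_ge0 ?lee_fin.
congr (_ * _); rewrite [RHS]integral_mkcond; apply: eq_integral => x _.
by rewrite /patch indicE; case: ifPn; rewrite ?mule1 ?mule0.
Qed.

(** The standard machine: test functions are increasing limits of simple
    functions, so that two weighted maps that agree on events agree on them. *)
Lemma eq_integral_weighted d1 (T1 : measurableType d1) d2 (T2 : measurableType d2)
    (mu1 : {measure set T1 -> \bar R}) (mu2 : {measure set T2 -> \bar R})
    (w1 : T1 -> R) (w2 : T2 -> R) (Y1 : T1 -> V) (Y2 : T2 -> V)
    (g : V -> \bar R) :
  measurable_fun [set: T1] w1 -> measurable_fun [set: T2] w2 ->
  (forall x, 0 <= w1 x)%R -> (forall x, 0 <= w2 x)%R ->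
  measurable_fun [set: T1] Y1 -> measurable_fun [set: T2] Y2 ->
  measurable_fun [set: V] g -> (forall v, 0 <= g v) ->
  (forall B, measurable B -> \int[mu1]_(x in Y1 @^-1` B) (w1 x)%:E =
                             \int[mu2]_(x in Y2 @^-1` B) (w2 x)%:E) ->
  \int[mu1]_x ((w1 x)%:E * g (Y1 x)) = \int[mu2]_x ((w2 x)%:E * g (Y2 x)).
Proof.
move=> mw1 mw2 w10 w20 mY1 mY2 mg g0 w12.
rewrite !(integral_weighted_limn _ mg)//; congr (limn _).
apply/funext => n /=; apply: eq_fsbigr => r _; congr (_ * _).
exact: w12.
Qed.

End weighted_laws.

(** * Changes of variables on the line *)

Section invariance.
Local Open Scope ereal_scope.
Context {R : realType}.

(** Passing through positive and negative parts removes the sign hypothesis from an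
    invariance property, even for functions that are not integrable. *)
Lemma eq_integral_of_ge0 d (T : measurableType d) (mu : {measure set T -> \bar R})
    (phi : T -> T) :
  (forall f : T -> \bar R, measurable_fun setT f -> (forall x, 0 <= f x) ->
    \int[mu]_x f (phi x) = \int[mu]_x f x) ->
  forall f : T -> \bar R, measurable_fun setT f ->
    \int[mu]_x f (phi x) = \int[mu]_x f x.
Proof.
move=> h f mf; rewrite [LHS]integralE [RHS]integralE.
have mp := measurable_funepos mf; have mn := measurable_funeneg mf.
have /= hp := h f^\+ mp (funepos_ge0 f); have /= hn := h f^\- mn (funeneg_ge0 f).
congr (_ - _).
  by rewrite -hp; apply: eq_integral => x _; rewrite !funeposE.
by rewrite -hn; apply: eq_integral => x _; rewrite !funenegE.
Qed.

Lemma ge0_integral_transfer d1 (T1 : measurableType d1) d2 (T2 : measurableType d2)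
    (nu1 : {measure set T1 -> \bar R}) (nu2 : {measure set T2 -> \bar R})
    (phi : T1 -> T2) : measurable_fun setT phi ->
  (forall A, measurable A -> nu1 (phi @^-1` A) = nu2 A) ->
  forall f : T2 -> \bar R, measurable_fun setT f -> (forall x, 0 <= f x) ->
  \int[nu1]_x f (phi x) = \int[nu2]_x f x.
Proof.
move=> mphi nu12 f mf f0.
have := @ge0_integral_pushforward _ _ T1 T2 R phi mphi nu1 setT f measurableT mf.
rewrite preimage_setT => <-; last by move=> x _; exact: f0.
by apply: eq_measure_integral => A mA _; exact: nu12.
Qed.

Let mu := @lebesgue_measure R.

(** Lebesgue measure is determined by its values on intervals, and c times its
    image under x |-> c x + a has the right ones. *)
Lemma ge0_integral_affine (c a : R) (f : R -> \bar R) : (0 < c)%R ->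
  measurable_fun setT f -> (forall x, 0 <= f x) ->
  c%:E * \int[mu]_x f (c * x + a)%R = \int[mu]_x f x.
Proof.
move=> c0 mf f0.
pose phi (x : R) : measurableTypeR R := (c * x + a)%R.
have mphi : measurable_fun setT phi.
  by apply: measurable_funD => //; apply: measurable_funM.
have c0' : (0 <= c)%R by exact: ltW.
have h X : ocitv X -> mu X = mscale (NngNum c0') mu (phi @^-1` X).
  move=> [[x y] _ <-]; rewrite /mscale/=.
  rewrite (_ : _ @^-1` _ = `]((x - a) / c)%R, ((y - a) / c)%R]%classic); last first.
    apply/seteqP; split => z /=; rewrite !in_itv/= ltr_pdivrMr// ler_pdivlMr//;
      by rewrite ltrBlDr lerBrDr mulrC.
  rewrite /mu !lebesgue_measure_itv/= !lte_fin ltr_pdivrMr// divfK ?gt_eqF//.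
  rewrite ltrD2r; case: ifPn => _; last by rewrite mule0.
  rewrite -!EFinB -EFinM; congr EFin; field; exact: lt0r_neq0.
have hA A : measurable A -> mu A = mscale (NngNum c0') mu (phi @^-1` A).
  move=> mA; pose nu := mscale (NngNum c0') mu.
  by have := @lebesgue_measure_unique R
    (measure_function_pushforward__canonical__measure_function_Measure nu mphi)
    h A mA.
rewrite -[RHS](@ge0_integral_transfer _ _ _ _ (mscale (NngNum c0') mu) mu phi)//.
  rewrite ge0_integral_mscale//=.
  exact: measurableT_comp mf mphi.
by move=> A mA; exact: esym (hA A mA).
Qed.

Lemma ge0_integralN (f : R -> \bar R) :
  measurable_fun setT f -> (forall x, 0 <= f x) ->
  \int[mu]_x f (- x)%R = \int[mu]_x f x.
Proof.
apply: (@ge0_integral_transfer _ _ _ _ mu mu (-%R : R -> measurableTypeR R)).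
  exact: measurable_funN.
by move=> A mA; exact: lebesgue_measureN.
Qed.

Lemma ge0_integral0y_scale (c : R) (f : R -> \bar R) : (0 < c)%R ->
  measurable_fun (`]0%R, +oo[ : set R) f -> (forall x, (0 < x)%R -> 0 <= f x) ->
  c%:E * \int[mu]_(x in `]0%R, +oo[) f (c * x)%R = \int[mu]_(x in `]0%R, +oo[) f x.
Proof.
move=> c0 mf f0; rewrite integral_mkcond [RHS]integral_mkcond.
rewrite -[RHS](@ge0_integral_affine c 0%R)//; last 2 first.
- by apply/(measurable_restrictT f) => //; exact: measurable_itv.
- by move=> x; apply: erestrict_ge0 => {}x/=; rewrite in_itv/= andbT; exact: f0.
congr (_ * _); apply: eq_integral => x _.
by rewrite /patch !mem_setE !in_itv/= !andbT addr0 pmulr_rgt0.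
Qed.

End invariance.

Section inversion.
Context {R : realType}.
Let mu := @lebesgue_measure R.
Let J (n : nat) : set R := `[n.+1%:R^-1, n.+1%:R]%classic.

Lemma itv0y_bigcup :
  (`]0, +oo[%classic : set R) = \bigcup_n J n.
Proof.
apply/seteqP; split => x /=; rewrite ?in_itv/= ?andbT; last first.
  by move=> [n _]; rewrite /J/= in_itv/= => /andP[+ _]; apply: lt_le_trans.
move=> x0; have [n nx] : exists n : nat, (Num.max x x^-1 <= n%:R).
  by exists (Num.truncn (Num.max x x^-1)).+1; exact/ltW/truncnS_gt.
exists n => //; rewrite /J/= in_itv/=; move: nx; rewrite ge_max => /andP[xn xVn].
have nn1 : (n%:R <= n.+1%:R :> R) by rewrite ler_nat.
rewrite (le_trans xn nn1) andbT -[leRHS]invrK lef_pV2 ?posrE ?invr_gt0//.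
exact: le_trans xVn nn1.
Qed.

Lemma nondecreasing_itv0y :
  nondecreasing_seq (fun n => J n).
Proof.
move=> m n mn; apply/subsetPset => x; rewrite /J/= !in_itv/= => /andP[mx xm].
apply/andP; split; last by rewrite (le_trans xm)// ler_nat ltnS.
by rewrite (le_trans _ mx)// lef_pV2 ?posrE// ler_nat ltnS.
Qed.

Lemma measurable_fun0y (g : R -> R) :
  (forall x : R, 0 < x -> {for x, continuous g}) ->
  measurable_fun (`]0, +oo[%classic : set R) g.
Proof.
move=> cg; apply: open_continuous_measurable_fun; first exact: interval_open.
by move=> x /set_mem/=; rewrite in_itv/= andbT; exact: cg.
Qed.

(** The substitution x |-> 1/x is made on the compact intervals [1/n, n], which it
    preserves and which exhaust the half-line. *)
Lemma ge0_integral0yV (f : R -> R) :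
  (forall x : R, 0 < x -> {for x, continuous f}) -> (forall x : R, 0 < x -> 0 <= f x) ->
  (\int[mu]_(x in `]0%R, +oo[) (f x)%:E =
  \int[mu]_(x in `]0%R, +oo[) (f x^-1 * x ^- 2)%:E)%E.
Proof.
move=> cf f0.
have cV (x : R) : (0 < x) -> {for x, continuous (fun x : R => x^-1)}.
  by move=> x0; apply: inv_continuous; rewrite gt_eqF.
have dV (x : R) : (0 < x) -> derive1 (fun x : R => x^-1) x = (- x ^- 2).
  move=> x0; rewrite derive1E deriveV ?gt_eqF//.
  by rewrite derive_id /GRing.scale/= mulr1.
have cdV (x : R) : 0 < x -> derive1 (fun x : R => x^-1) y @[y --> x] --> - x ^- 2.
  move=> x0; apply: (@cvg_trans _ ((fun y : R => - y ^- 2) @ x)).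
    apply: near_eq_cvg; near=> y; rewrite dV//; near: y.
    exact: lt_nbhsr.
  have c2 : {for x, continuous (fun y : R => y ^- 2)}.
    by apply: continuousV; [rewrite expf_eq0/= gt_eqF|exact: exprn_continuous].
  exact: cvgN c2.
have cfV (x : R) : (0 < x) -> {for x, continuous (fun x : R => f x^-1 * x ^- 2)}.
  move=> x0; apply: continuousM.
    by apply: continuous_comp; [exact: cV|apply: cf; rewrite invr_gt0].
  apply: continuousV; first by rewrite expf_eq0/= gt_eqF.
  exact: exprn_continuous.
have sub (n : nat) (x : R) : J n x -> (0 < x).
  by rewrite /J/= in_itv/= => /andP[+ _]; apply: lt_le_trans.
have mcont (g : R -> R) n : (forall x : R, 0 < x -> {for x, continuous g}) ->
    measurable_fun (J n) (EFin \o g).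
  move=> cg; apply/measurable_EFinP.
  apply: measurable_funS (measurable_fun0y cg) => //.
  by move=> x /sub x0; rewrite /= in_itv/= x0.
rewrite itv0y_bigcup.
have h (g : R -> R) : (forall x : R, 0 < x -> {for x, continuous g}) ->
   (forall x : R, 0 < x -> 0 <= g x) ->
   (\int[mu]_(x in \bigcup_n J n) (g x)%:E =
   limn (fun n => \int[mu]_(x in J n) (g x)%:E))%E.
  move=> cg g0; apply/esym/cvg_lim => //.
  apply: ge0_nondecreasing_set_cvg_integral.
  - exact: nondecreasing_itv0y.
  - by move=> n; exact: measurable_itv.
  - by move=> n; exact: mcont.
  - by move=> n x /sub x0; rewrite lee_fin g0.
rewrite !h//; last first.
  by move=> x x0; rewrite mulr_ge0 ?f0 ?invr_ge0 ?invr_gt0 ?exprn_ge0// ltW.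
congr (limn _); apply/funext => n.
have n1 : (n.+1%:R^-1 <= n.+1%:R :> R).
  by rewrite (@le_trans _ _ 1)// ?invf_le1// ler1n.
have := @integration_by_substitution_decreasing R (fun x => x^-1) f
  n.+1%:R^-1 n.+1%:R n1.
rewrite /= invrK => ->.
- apply: eq_integral => x /set_mem/sub x0; congr EFin.
  transitivity (f x^-1 * - derive1 (fun x : R => x^-1) x); first by [].
  by rewrite dV// opprK.
- move=> x y /sub x0 /sub y0 xy.
  by rewrite ltf_pV2.
- move=> x; rewrite in_itv/= => /andP[nx _].
  have x0 : 0 < x by apply: lt_trans nx.
  by rewrite /prop_for /continuous_at dV//; exact: cdV.
- by apply/cvg_ex; exists (- n.+1%:R^-1 ^- 2); apply: cvg_at_right_filter; exact: cdV.
- by apply/cvg_ex; exists (- n.+1%:R ^- 2); apply: cvg_at_left_filter; exact: cdV.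
- split.
  + move=> x; rewrite in_itv/= => /andP[nx _].
    have x0 : 0 < x by apply: lt_trans nx.
    by apply: derivableV; rewrite ?gt_eqF//; exact: derivable_id.
  + by apply: cvg_at_right_filter; apply: cV.
  + by apply: cvg_at_left_filter; apply: cV.
- apply: continuous_in_subspaceT => x /set_mem xJ.
  by apply: cf; exact: (sub n).
Unshelve. all: by end_near. Qed.

End inversion.

(** * Gaussian integrals on the line *)

Lemma integrable_dominated d (T : measurableType d) (R : realType)
    (mu : {measure set T -> \bar R}) (f g : T -> R) :
  measurable_fun setT f -> (forall x, `|f x| <= g x) ->
  mu.-integrable setT (EFin \o g) -> mu.-integrable setT (EFin \o f).
Proof.
move=> mf fg; apply: le_integrable => //; first exact/measurable_EFinP.
by move=> x _; rewrite /= lee_fin (le_trans (fg x))// ler_norm.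
Qed.

Lemma integrable_realZl d (T : measurableType d) (R : realType)
    (mu : {measure set T -> \bar R}) (c : R) (f : T -> R) :
  mu.-integrable setT (EFin \o f) ->
  mu.-integrable setT (EFin \o (fun x => c * f x)).
Proof.
move=> h; rewrite (_ : _ \o _ = (fun x => c%:E * (EFin \o f) x)%E)//.
exact: integrableZl.
Qed.

Lemma integrable_realD d (T : measurableType d) (R : realType)
    (mu : {measure set T -> \bar R}) (f g : T -> R) :
  mu.-integrable setT (EFin \o f) -> mu.-integrable setT (EFin \o g) ->
  mu.-integrable setT (EFin \o (fun x => f x + g x)).
Proof. exact: integrableD. Qed.

Lemma integrable_realB d (T : measurableType d) (R : realType)
    (mu : {measure set T -> \bar R}) (f g : T -> R) :
  mu.-integrable setT (EFin \o f) -> mu.-integrable setT (EFin \o g) ->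
  mu.-integrable setT (EFin \o (fun x => f x - g x)).
Proof. exact: integrableB. Qed.

Section trigonometric_measurability.
Context {R : realType}.

Lemma measurable_cos : measurable_fun [set: R] (@cos R).
Proof. by apply: continuous_measurable_fun; exact: continuous_cos. Qed.

Lemma measurable_sin : measurable_fun [set: R] (@sin R).
Proof. by apply: continuous_measurable_fun; exact: continuous_sin. Qed.

Lemma norm_cos_le1 (x : R) : `|cos x| <= 1.
Proof. by rewrite ler_norml cos_geN1 cos_le1. Qed.

Lemma norm_sin_le1 (x : R) : `|sin x| <= 1.
Proof. by rewrite ler_norml sin_geN1 sin_le1. Qed.

End trigonometric_measurability.

Section derivative_on_line.
Context {R : realType}.
Let mu := @lebesgue_measure R.

(** The boundary terms at n and - n vanish as soon as x g(x) stays bounded. *)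
Lemma Rintegral_derivative_eq0 (g g' : R -> R) (C : R) :
  (forall x : R, is_derive x 1 g (g' x)) -> continuous g' ->
  mu.-integrable setT (EFin \o g') -> (forall x, `|x| * `|g x| <= C) ->
  \int[mu]_x g' x = 0.
Proof.
move=> dg cg' ig' gC.
have cg x : {for x, continuous g}.
  by apply: differentiable_continuous; apply/derivable1_diffP; apply: ex_derive.
pose D n : set R := `[- n.+1%:R, n.+1%:R]%classic.
have FTC n : (\int[mu]_(x in D n) (g' x)%:E = (g n.+1%:R - g (- n.+1%:R))%:E)%E.
  rewrite EFinB; apply: continuous_FTC2.
  - by rewrite gtrN.
  - by apply: continuous_in_subspaceT => x _; exact: cg'.
  - split; first by move=> x _; exact: ex_derive.
    + by apply: cvg_at_right_filter; exact: cg.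
    + by apply: cvg_at_left_filter; exact: cg.
  - by move=> x _; rewrite derive1E; exact: derive_val.
have mD n : measurable (D n) by exact: measurable_itv.
have mg' : measurable_fun setT g' by exact: continuous_measurable_fun.
have lim1 : (\int[mu]_(x in D n) (g' x)%:E)%E @[n --> \oo] --> (\int[mu]_x (g' x)%:E)%E.
  under eq_fun do rewrite integral_mkcond.
  have [] := @dominated_convergence _ _ _ mu setT measurableT
    (fun n => (EFin \o g') \_ (D n)) (EFin \o g') (fun x => `|g' x|%:E) => //.
  - move=> n; apply/(measurable_restrictT _ (mD n)).
    by apply: measurable_funTS; exact/measurable_EFinP.
  - exact/measurable_EFinP.
  - apply: aeW => x _ /=; apply: cvg_near_cst; near=> n.
    rewrite /patch ifT// inE /D /= in_itv/= -ler_norml.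
    rewrite (@le_trans _ _ n%:R) ?ler_nat//.
    near: n; exact: nbhs_infty_ger.
  - by have /integrable_abse := ig'.
  - by apply: aeW => x n _; rewrite /patch; case: ifPn => _; rewrite ?lee_fin// normr0.
have lim2 : (g n.+1%:R - g (- n.+1%:R)) @[n --> \oo] --> (0 : R).
  apply: norm_cvg0; apply: (@squeeze_cvgr _ _ _ _ (cst 0) (fun n => (C + C) * n.+1%:R^-1)).
  - near=> n; rewrite normr_ge0/= (le_trans (ler_normB _ _))// mulrDl.
    have n1 : 0 < n.+1%:R :> R by [].
    have gp := gC n.+1%:R; have gm := gC (- n.+1%:R).
    rewrite ?normrN ?(ger0_norm (ltW n1)) in gp gm.
    by rewrite lerD// ler_pdivlMr// mulrC.
  - exact: cvg_cst.
  - rewrite -(mulr0 (C + C)); apply: cvgM; [exact: cvg_cst|exact: cvg_harmonic].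
have : (fine (\int[mu]_(x in D n) (g' x)%:E)%E) @[n --> \oo] --> \int[mu]_x g' x.
  apply: fine_cvg; rewrite fineK; first exact: lim1.
  exact: integrable_fin_num.
under eq_fun do rewrite FTC/=.
by move=> /cvg_unique; apply.
Unshelve. all: by end_near. Qed.

End derivative_on_line.

Section gaussian.
Context {R : realType}.
Let mu := @lebesgue_measure R.
Variable s : R.
Hypothesis s0 : 0 < s.
Let phi := normal_pdf 0 s : R -> R.

Lemma centered_normal_pdfE x :
  normal_pdf 0 s x = normal_peak s * expR (- (x ^+ 2 / (s ^+ 2 *+ 2))).
Proof.
rewrite normal_pdfE ?gt_eqF// /normal_fun subr0 mulNr//.
Qed.

Let s2_gt0 : 0 < s ^+ 2 *+ 2.
Proof. by rewrite pmulrn_lgt0// exprn_gt0. Qed.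

Let phi0 x : 0 <= phi x. Proof. exact: normal_pdf_ge0. Qed.

Let mphi : measurable_fun setT phi. Proof. exact: measurable_normal_pdf. Qed.

Let cphi : continuous phi.
Proof. by apply: continuous_normal_pdf; rewrite gt_eqF. Qed.

Lemma sqr_normal_pdf_le x :
  x ^+ 2 * normal_pdf 0 s x <= s ^+ 2 *+ 2 * normal_peak s.
Proof.
rewrite centered_normal_pdfE mulrCA mulrC ler_wpM2r ?normal_peak_ge0//.
rewrite expRN -ler_pdivlMr ?invr_gt0 ?expR_gt0// invrK.
rewrite mulrC -ler_pdivrMr//.
by rewrite (le_trans _ (expR_ge1Dx _))// lerDr.
Qed.

(** The quadratic factor is absorbed by doubling the variance. *)
Lemma integrable_1Dsqr_normal_pdf :
  mu.-integrable setT (EFin \o (fun x => (1 + x ^+ 2) * normal_pdf 0 s x)).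
Proof.
have h : mu.-integrable setT (fun x : R => (normal_peak s * (1 + s ^+ 2 *+ 4) /
   normal_peak (s * Num.sqrt 2) * normal_pdf 0 (s * Num.sqrt 2) x)%:E).
  under eq_fun do rewrite EFinM.
  apply: integrableZl => //; apply: integrable_normal_pdf.
have s20 : s * Num.sqrt 2 != 0 by rewrite mulf_neq0 ?gt_eqF ?sqrtr_gt0.
apply: integrable_dominated h.
  by apply: measurable_funM => //; apply: measurable_funD => //; apply: measurable_funX.
move=> x; rewrite normrM !ger0_norm ?addr_ge0 ?sqr_ge0//.
rewrite centered_normal_pdfE normal_pdfE// /normal_fun subr0.
rewrite [leRHS]mulrA divfK ?gt_eqF ?normal_peak_gt0//.
rewrite mulrCA -mulrA ler_wpM2l ?normal_peak_ge0//.
have -> : - x ^+ 2 / ((s * Num.sqrt 2) ^+ 2 *+ 2) = - (x ^+ 2 / (s ^+ 2 *+ 4)).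
  rewrite exprMn sqr_sqrtr//.
  by field; rewrite gt_eqF.
have -> : - (x ^+ 2 / (s ^+ 2 *+ 2)) = - (x ^+ 2 / (s ^+ 2 *+ 4)) - (x ^+ 2 / (s ^+ 2 *+ 4)).
  by field; rewrite gt_eqF.
rewrite expRD mulrA ler_wpM2r ?expR_ge0//.
rewrite expRN -ler_pdivlMr ?invr_gt0 ?expR_gt0// invrK.
set y := x ^+ 2 / _.
have -> : x ^+ 2 = s ^+ 2 *+ 4 * y by rewrite /y; field; rewrite gt_eqF.
have y0 : 0 <= y by rewrite /y divr_ge0 ?sqr_ge0// mulrn_wge0 ?sqr_ge0.
have := expR_ge1Dx y; have := sqr_ge0 s; nra.
Qed.

Let bphi (f : R -> R) (C : R) : measurable_fun setT f ->
  (forall x, `|f x| <= C * (1 + x ^+ 2)) ->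
  mu.-integrable setT (EFin \o (fun x => f x * phi x)).
Proof.
move=> mf fC; apply: (@integrable_dominated _ _ R mu _ (fun x : R => C * ((1 + x ^+ 2) * phi x))).
- exact: measurable_funM.
- by move=> x; rewrite normrM (ger0_norm (phi0 _)) mulrA ler_wpM2r.
- exact/integrable_realZl/integrable_1Dsqr_normal_pdf.
Qed.

Let is_derive_phi (x : R) : is_derive x 1 phi (- x / s ^+ 2 * phi x).
Proof.
rewrite /phi.
have -> : normal_pdf 0 s = (fun x : R => normal_peak s * expR (- (x ^+ 2 / (s ^+ 2 *+ 2)))).
  by apply/funext => y; exact: centered_normal_pdfE.
apply: is_derive_eq.
rewrite /GRing.scale/=; field.
by rewrite gt_eqF.
Qed.

Let id_bound (x : R) : `|x| <= 1 * (1 + x ^+ 2).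
Proof.
rewrite mul1r -[x ^+ 2]real_normK ?num_real//.
have := normr_ge0 x; set y := `|x|; have := sqr_ge0 (y - 1); nra.
Qed.

Let phi_decay : exists C, forall x, (1 + x ^+ 2) * phi x <= C.
Proof.
exists (normal_peak s + s ^+ 2 *+ 2 * normal_peak s) => x.
by rewrite mulrDl mul1r lerD ?sqr_normal_pdf_le ?normal_pdf_ub// gt_eqF.
Qed.

(** The derivative of x phi(x) is phi(x) - x^2 phi(x) / s^2, and it integrates
    to zero. *)
Lemma normal_pdf_second_moment :
  (\int[mu]_x (x ^+ 2 * normal_pdf 0 s x)%:E = (s ^+ 2)%:E)%E.
Proof.
have i2 : mu.-integrable setT (EFin \o (fun x : R => x ^+ 2 * phi x)).
  apply: (bphi (C := 1)) => [|x]; first exact: measurable_funX.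
  by rewrite mul1r ger0_norm ?sqr_ge0// lerDr.
have i0 : mu.-integrable setT (EFin \o phi).
  by apply: integrable_normal_pdf; rewrite gt_eqF.
have [C hC] := phi_decay.
have := @Rintegral_derivative_eq0 _ (fun x : R => x * phi x)
  (fun x : R => phi x - (s ^+ 2)^-1 * (x ^+ 2 * phi x)) C.
have is2 := integrable_realZl (s ^+ 2)^-1 i2.
have int_phi : \int[mu]_x phi x = 1.
  by rewrite /Rintegral integral_normal_pdf// gt_eqF.
move=> /(_ _ _ _ _)/wrap[].
- move=> x; have dphi := is_derive_phi x; apply: is_derive_eq.
  by rewrite /GRing.scale/=; field; rewrite gt_eqF.
- move=> x; apply: cvgB; first exact: cphi.
  apply: cvgM; first exact: cvg_cst.
  by apply: cvgM; [exact: exprn_continuous|exact: cphi].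
- exact: integrable_realB.
- move=> x; rewrite -normrM mulrA normrM -expr2 ger0_norm ?sqr_ge0// ger0_norm//.
  by apply: le_trans (hC x); rewrite ler_wpM2r// lerDr.
rewrite RintegralB// RintegralZl// int_phi => /eqP.
rewrite subr_eq0 => /eqP/(congr1 (fun y => s ^+ 2 * y)).
rewrite mulrA divff ?mul1r ?mulr1; last by rewrite expf_eq0/= gt_eqF.
move=> h; rewrite h /Rintegral fineK//.
exact: (integrable_fin_num _ i2).
Qed.

Let F b := \int[mu]_x (cos (b * x) * phi x).

Let mcosM (b : R) : measurable_fun setT (fun x : R => cos (b * x)).
Proof.
by apply: measurableT_comp; [exact: measurable_cos|exact: measurable_funM].
Qed.

Let msinM (b : R) : measurable_fun setT (fun x : R => sin (b * x)).
Proof.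
by apply: measurableT_comp; [exact: measurable_sin|exact: measurable_funM].
Qed.

Let cos_le (x y : R) : `|cos x| <= 1 * (1 + y ^+ 2).
Proof.
by rewrite mul1r (@le_trans _ _ 1) ?lerDl ?sqr_ge0// norm_cos_le1.
Qed.

Let sin_le (x y : R) : `|sin x| <= 1 * (1 + y ^+ 2).
Proof.
by rewrite mul1r (@le_trans _ _ 1) ?lerDl ?sqr_ge0// norm_sin_le1.
Qed.

Let is_derive_cosM (b x : R) :
  is_derive b 1 (fun b : R => cos (b * x) * phi x) (- (x * sin (b * x)) * phi x).
Proof.
apply: is_derive_eq.
rewrite /GRing.scale/=; ring.
Qed.

Let is_derive_sinM (b x : R) :
  is_derive x 1 (fun x : R => sin (b * x) * phi x)
    (b * (cos (b * x) * phi x) - (s ^+ 2)^-1 * (x * sin (b * x) * phi x)).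
Proof.
have dphi := is_derive_phi x; apply: is_derive_eq.
rewrite /GRing.scale/=; field.
by rewrite gt_eqF.
Qed.

Let ixsin b : mu.-integrable setT (EFin \o (fun x => x * sin (b * x) * phi x)).
Proof.
apply: (bphi (C := 1)) => [|x]; first by apply: measurable_funM.
rewrite normrM -[leRHS]mulr1 ler_pM ?id_bound//.
exact: norm_sin_le1.
Qed.

Let icos b : mu.-integrable setT (EFin \o (fun x => cos (b * x) * phi x)).
Proof. by apply: (bphi (C := 1)) => // x; exact: cos_le. Qed.

Let isin b : mu.-integrable setT (EFin \o (fun x => sin (b * x) * phi x)).
Proof. by apply: (bphi (C := 1)) => // x; exact: sin_le. Qed.

(* Differentiation under the integral, then integration by parts. *)
Let dF (b : R) : is_derive b 1 F (- (s ^+ 2 * b * F b)).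
Proof.
have [C hC] := phi_decay.
have ibp : s ^+ 2 * b * F b = \int[mu]_x (x * sin (b * x) * phi x).
  have := @Rintegral_derivative_eq0 _ (fun x : R => sin (b * x) * phi x) _ C
    (is_derive_sinM b).
  have ib := integrable_realZl b (icos b).
  have ib' := integrable_realZl (s ^+ 2)^-1 (ixsin b).
  move=> /(_ _ _ _)/wrap[].
  - move=> x; apply: cvgB; apply: cvgM; try exact: cvg_cst.
    + apply: cvgM; last exact: cphi.
      apply: (cvg_comp (fun x => b * x) cos); last exact: continuous_cos.
      by apply: cvgM; [exact: cvg_cst|exact: cvg_id].
    + apply: cvgM; last exact: cphi.
      apply: cvgM; first exact: cvg_id.
      apply: (cvg_comp (fun x => b * x) sin); last exact: continuous_sin.
      by apply: cvgM; [exact: cvg_cst|exact: cvg_id].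
  - exact: integrable_realB.
  - move=> x; rewrite normrM mulrCA (ger0_norm (phi0 _)).
    apply: le_trans (hC x); rewrite mulrA ler_wpM2r//.
    rewrite -[leRHS]mul1r ler_pM//; first exact: norm_sin_le1.
    by rewrite -[leRHS]mul1r id_bound.
  rewrite RintegralB// !RintegralZl// => /eqP.
  rewrite subr_eq0 -/(F b) => /eqP/(congr1 (fun y => s ^+ 2 * y)).
  by rewrite !mulrA divff ?mul1r// expf_eq0/= gt_eqF.
have Ib : `]b - 1, b + 1[%classic b by rewrite /= in_itv/= ltrBlDr ltrDl ltr01.
pose f (c x : R) := cos (c * x) * phi x.
have derf c x : derivable (f ^~ x) c 1 by apply: ex_derive.
have d1f c x : partial1of2 f c x = - (x * sin (c * x)) * phi x.
  rewrite partial1of2E; have dc := is_derive_cosM c x.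
  exact: (@derive_val _ _ _ _ _ _ _ dc).
have i1 : mu.-integrable setT (EFin \o (fun x => `|x| * phi x)).
  apply: (bphi (C := 1)) => [|x]; first exact: normr_measurable.
  by rewrite normr_id.
have h1 := @derivable_under_integral R _ _ mu f setT measurableT b (b - 1) (b + 1) Ib
  (fun c _ => icos c) (fun c x _ _ => derf c x) (fun x => `|x| * phi x).
have h2 := @differentiation_under_integral R _ _ mu f setT measurableT b (b - 1) (b + 1) Ib
  (fun c _ => icos c) (fun c x _ _ => derf c x) (fun x => `|x| * phi x).
have G0 x : 0 <= `|x| * phi x by rewrite mulr_ge0.
have Gub c x : `]b - 1, b + 1[%classic c -> setT x -> `|partial1of2 f c x| <= `|x| * phi x.
  move=> _ _; rewrite d1f normrM normrN normrM (ger0_norm (phi0 _)) ler_wpM2r//.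
  by rewrite ler_piMr// norm_sin_le1.
apply: DeriveDef; first exact: h1.
rewrite -derive1E (h2 G0 i1 Gub) ibp -mulN1r -RintegralZl//.
by apply: eq_Rintegral => x _; rewrite d1f mulN1r mulNr.
Qed.

(** The transform F of the density satisfies F' (b) = - s^2 b F(b), which
    integrates to a Gaussian. *)
Lemma Rintegral_cos_normal_pdf b :
  \int[mu]_x (cos (b * x) * normal_pdf 0 s x) = expR (- (s ^+ 2 * b ^+ 2 / 2)).
Proof.
pose h c := F c * expR (s ^+ 2 * c ^+ 2 / 2).
have dh (c : R) : is_derive c 1 h 0.
  have dFc := dF c; apply: is_derive_eq.
  rewrite /GRing.scale/=; field.
  by [].
have : h b = h 0 by exact: is_derive_0_is_cst.
rewrite /h expr0n/= mulr0 mul0r expR0 mulr1.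
have -> : F 0 = 1.
  rewrite /F; under eq_Rintegral do rewrite mul0r cos0 mul1r.
  by rewrite /Rintegral integral_normal_pdf// gt_eqF.
move=> /(congr1 (fun y => y / expR (s ^+ 2 * b ^+ 2 / 2))).
by rewrite mulfK ?gt_eqF ?expR_gt0// mul1r expRN.
Qed.

Lemma Rintegral_sin_normal_pdf b : \int[mu]_x (sin (b * x) * normal_pdf 0 s x) = 0.
Proof.
have := @eq_integral_of_ge0 R _ _ mu (fun x : R => - x)
  (fun f mf f0 => ge0_integralN mf f0) (fun x => (sin (b * x) * phi x)%:E).
move=> /(_ _)/wrap[].
  by apply/measurable_EFinP; apply: measurable_funM; [exact: msinM|exact: mphi].
move=> h; have : - (\int[mu]_x (sin (b * x) * phi x)) = (\int[mu]_x (sin (b * x) * phi x)).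
  rewrite -mulN1r -RintegralZl// /Rintegral -[in RHS]h; congr fine.
  apply: eq_integral => x _; rewrite mulrN sinN /phi !centered_normal_pdfE sqrrN.
  by rewrite mulN1r mulNr.
clear h; rewrite -/phi; set I := Rintegral _ _ _ => hI.
have /eqP : I *+ 2 = 0 by rewrite mulr2n -{1}hI addNr.
by rewrite mulrn_eq0/= => /eqP.
Qed.

Lemma integral_1Dcos_normal_pdf a b :
  (\int[mu]_x ((1 + cos (a + b * x)) * normal_pdf 0 s x)%:E =
   (1 + cos a * expR (- (s ^+ 2 * b ^+ 2 / 2)))%:E)%E.
Proof.
have i0 : mu.-integrable setT (EFin \o phi).
  by apply: integrable_normal_pdf; rewrite gt_eqF.
have E x : (1 + cos (a + b * x)) * phi x =
    phi x + (cos a * (cos (b * x) * phi x) - sin a * (sin (b * x) * phi x)).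
  by rewrite cosD; ring.
have ic := integrable_realZl (cos a) (icos b).
have is' := integrable_realZl (sin a) (isin b).
have iB : mu.-integrable setT (EFin \o (fun x => cos a * (cos (b * x) * phi x) - sin a * (sin (b * x) * phi x))).
  exact: integrable_realB ic is'.
have iD : mu.-integrable setT (EFin \o (fun x => phi x + (cos a * (cos (b * x) * phi x) - sin a * (sin (b * x) * phi x)))).
  exact: integrable_realD i0 iB.
under eq_integral do rewrite -/phi E.
rewrite -[LHS]fineK; last exact: (integrable_fin_num _ iD).
congr EFin; rewrite -/(Rintegral _ _ _) RintegralD// RintegralB// !RintegralZl//.
rewrite Rintegral_cos_normal_pdf Rintegral_sin_normal_pdf mulr0 subr0.
by rewrite /Rintegral integral_normal_pdf// gt_eqF.
Qed.

End gaussian.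

(** * Lebesgue measure and Gaussian densities on Euclidean space *)

Section euclidean_space.
Context {R : realType}.
Implicit Types n : nat.

Lemma measurable_dot n (xi : 'rV[R]_n) : measurable_fun setT (dot xi : 'rV[R]_n -> R).
Proof.
apply: measurable_sum => i; apply: measurable_funM => //.
exact: measurable_entry.
Qed.

Lemma dotC n (u v : 'rV[R]_n) : dot u v = dot v u.
Proof. by apply: eq_bigr => i _; rewrite mulrC. Qed.

Lemma dotDr n (u v w : 'rV[R]_n) : dot u (v + w) = dot u v + dot u w.
Proof. by rewrite -big_split; apply: eq_bigr => i _; rewrite mxE mulrDr. Qed.

Lemma dotZr n (a : R) (u v : 'rV[R]_n) : dot u (a *: v) = a * dot u v.
Proof. by rewrite mulr_sumr; apply: eq_bigr => i _; rewrite mxE mulrCA. Qed.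

Lemma dotNr n (u v : 'rV[R]_n) : dot u (- v) = - dot u v.
Proof. by rewrite -scaleN1r dotZr mulN1r. Qed.

Lemma dotNl n (u v : 'rV[R]_n) : dot (- u) v = - dot u v.
Proof. by rewrite dotC dotNr dotC. Qed.

Lemma dot0r n (u : 'rV[R]_n) : dot u 0 = 0.
Proof. by rewrite -(scale0r 0) dotZr mul0r. Qed.

Lemma dot_ge0 n (u : 'rV[R]_n) : 0 <= dot u u.
Proof. by apply: sumr_ge0 => i _; rewrite -expr2 sqr_ge0. Qed.

Lemma dot_eq0 n (u : 'rV[R]_n) : (dot u u == 0) = (u == 0).
Proof.
apply/idP/eqP => [|->]; last by rewrite dot0r.
rewrite psumr_eq0; last by move=> i _; rewrite -expr2 sqr_ge0.
move=> /allP h; apply/rowP => i; rewrite mxE.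
by have := h i (mem_index_enum _); rewrite mulf_eq0 orbb => /eqP.
Qed.

Lemma measurable_dot_self n : measurable_fun setT (fun v : 'rV[R]_n => dot v v).
Proof.
by apply: measurable_sum => i; apply: measurable_funM; exact: measurable_entry.
Qed.

Lemma sqr_enorm n (v : 'rV[R]_n) : enorm v ^+ 2 = dot v v.
Proof. by rewrite sqr_sqrtr ?dot_ge0. Qed.

Lemma measurable_enorm n : measurable_fun setT (@enorm R n).
Proof.
have h : measurable_fun setT (@Num.sqrt R).
  by apply: continuous_measurable_fun; exact: sqrt_continuous.
exact: measurableT_comp h (@measurable_dot_self n).
Qed.

End euclidean_space.

Section measurable_vector_maps.
Context {R : realType} {d : nat}.

Lemma measurable_rV_shift (a : 'rV[R]_d) : measurable_fun setT (fun v : 'rV[R]_d => v + a).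
Proof.
apply: measurable_fun_matrix => i j.
apply: (eq_measurable_fun (fun v : 'rV[R]_d => v i j + a i j)).
  by move=> v _; rewrite mxE.
by apply: measurable_funD => //; exact: measurable_entry.
Qed.

Lemma measurable_rVN : measurable_fun setT (fun v : 'rV[R]_d => - v).
Proof.
apply: measurable_fun_matrix => i j.
apply: (eq_measurable_fun (fun v : 'rV[R]_d => - v i j)).
  by move=> v _; rewrite mxE.
by apply: measurable_funN; exact: measurable_entry.
Qed.

Lemma measurable_rVD d1 (T : measurableType d1) (f g : T -> 'rV[R]_d) :
  measurable_fun setT f -> measurable_fun setT g ->
  measurable_fun setT (fun x => f x + g x).
Proof.
move=> mf mg; apply: measurable_fun_matrix => i j.
apply: (eq_measurable_fun (fun x => f x i j + g x i j)).
  by move=> v _; rewrite mxE.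
apply: measurable_funD.
  exact: (measurableT_comp (measurable_entry i j) mf).
exact: (measurableT_comp (measurable_entry i j) mg).
Qed.

Lemma measurable_dot2 :
  measurable_fun setT (fun p : 'rV[R]_d * 'rV[R]_d => dot p.1 p.2).
Proof.
apply: measurable_sum => i; apply: measurable_funM.
  exact: measurableT_comp (measurable_entry 0 i) measurable_fst.
exact: measurableT_comp (measurable_entry 0 i) measurable_snd.
Qed.

Lemma measurable_cos_dot xi : measurable_fun setT (fun z : 'rV[R]_d => cos (dot xi z)).
Proof. exact: measurableT_comp measurable_cos (measurable_dot xi). Qed.

Lemma measurable_sin_dot xi : measurable_fun setT (fun z : 'rV[R]_d => sin (dot xi z)).
Proof. exact: measurableT_comp measurable_sin (measurable_dot xi). Qed.

End measurable_vector_maps.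

Section lebesgue_Rd.
Context {R : realType}.
Implicit Types n : nat.

Lemma dot_rV_cons n (xi : 'rV[R]_n.+1) (xv : measurableTypeR R * 'rV[R]_n) :
  dot xi (rV_cons xv) = xi 0 0 * xv.1 + dot (\row_j xi 0 (lift 0 j)) xv.2.
Proof.
rewrite /dot big_ord_recl /= mxE unlift_none /=; congr (_ + _).
by apply: eq_bigr => i _; rewrite !mxE liftK.
Qed.

Lemma prod_rV_cons n (f : R -> R) (xv : measurableTypeR R * 'rV[R]_n) :
  \prod_(i < n.+1) f (rV_cons xv 0 i) = f xv.1 * \prod_(i < n) f (xv.2 0 i).
Proof.
rewrite big_ord_recl /= mxE unlift_none /=; congr (_ * _).
by apply: eq_bigr => i _; rewrite !mxE liftK.
Qed.

Local Open Scope ereal_scope.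

Lemma integral_leb0 (f : 'rV[R]_0 -> \bar R) : measurable_fun setT f ->
  \int[leb 0]_v f v = f 0%R.
Proof. by move=> mf; rewrite /= integral_dirac// diracT mul1e. Qed.

(** The form in which all properties of the n-dimensional measure are derived from
    one-dimensional ones, by induction on n. *)
Lemma ge0_integral_lebS n (f : 'rV[R]_n.+1 -> \bar R) :
  measurable_fun setT f -> (forall v, 0 <= f v) ->
  \int[leb n.+1]_v f v =
  \int[lebesgue_measure]_x \int[leb n]_v f (rV_cons (x, v)).
Proof.
move=> mf f0.
rewrite -(@ge0_integral_transfer R _ _ _ _ (lebesgue_measure \x leb n) (leb n.+1)
  (@rV_cons R n))//; last exact: measurable_rV_cons.
rewrite fubini_tonelli1//.
by apply: measurableT_comp => //; exact: measurable_rV_cons.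
Qed.

(** The induction moves the first coordinate by translation invariance on the line
    and the others by the induction hypothesis. *)
Lemma ge0_integral_leb_shift n (a : 'rV[R]_n) (f : 'rV[R]_n -> \bar R) :
  measurable_fun setT f -> (forall v, 0 <= f v) ->
  \int[leb n]_v f (v + a)%R = \int[leb n]_v f v.
Proof.
elim: n a f => [|n IH] a f mf f0.
  by congr (integral _ _ _); apply/funext => v; congr f; rewrite !thinmx0.
have mfc : measurable_fun setT (fun xv : measurableTypeR R * 'rV[R]_n => f (rV_cons xv)).
  by apply: measurableT_comp => //; exact: measurable_rV_cons.
rewrite [RHS](ge0_integral_lebS mf f0) ge0_integral_lebS; last 2 first.
- exact: measurableT_comp mf (measurable_rV_shift a).
- by move=> v; exact: f0.
pose a' : 'rV[R]_n := (\row_j a 0 (lift 0 j))%R.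
have consD x v : (rV_cons (x, v) + a = rV_cons ((x + a 0 0)%R : measurableTypeR R, v + a'))%R.
  apply/rowP => j; rewrite !mxE; case: (unliftP 0%R j) => [k|] -> //=.
  by rewrite !mxE.
transitivity (\int[lebesgue_measure]_x \int[leb n]_v f (rV_cons ((x + a 0 0)%R : measurableTypeR R, v))).
  apply: eq_integral => x _.
  rewrite -[RHS](IH a' (fun v => f (rV_cons ((x + a 0 0)%R : measurableTypeR R, v))))//.
    by apply: eq_integral => v _; rewrite consD.
  exact: measurableT_comp mfc (pair1_measurable _).
rewrite -[RHS](@ge0_integral_affine R 1%R (a 0%R 0%R))//.
- by rewrite mul1e; under [RHS]eq_integral do rewrite mul1r.
- exact: (measurable_fun_fubini_tonelli_F (fun xv : measurableTypeR R * 'rV[R]_n => f (rV_cons xv))).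
- by move=> x; apply: integral_ge0.
Qed.

Lemma ge0_integral_lebN n (f : 'rV[R]_n -> \bar R) :
  measurable_fun setT f -> (forall v, 0 <= f v) ->
  \int[leb n]_v f (- v)%R = \int[leb n]_v f v.
Proof.
elim: n f => [|n IH] f mf f0.
  by congr (integral _ _ _); apply/funext => v; congr f; rewrite !thinmx0.
have mfc : measurable_fun setT (fun xv : measurableTypeR R * 'rV[R]_n => f (rV_cons xv)).
  by apply: measurableT_comp => //; exact: measurable_rV_cons.
rewrite [RHS](ge0_integral_lebS mf f0) ge0_integral_lebS; last 2 first.
- exact: measurableT_comp mf measurable_rVN.
- by move=> v; exact: f0.
have consN x v : (- rV_cons (x, v) = rV_cons ((- x)%R : measurableTypeR R, - v))%R.
  apply/rowP => j; rewrite !mxE; case: (unliftP 0%R j) => [k _|_] //=.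
  by rewrite !mxE.
transitivity (\int[lebesgue_measure]_x \int[leb n]_v f (rV_cons ((- x)%R : measurableTypeR R, v))).
  apply: eq_integral => x _.
  rewrite -[RHS](IH (fun v => f (rV_cons ((- x)%R : measurableTypeR R, v))))//.
    by apply: eq_integral => v _; rewrite consN.
  exact: measurableT_comp mfc (pair1_measurable _).
rewrite -[RHS](@ge0_integralN R)//.
- exact: (measurable_fun_fubini_tonelli_F (fun xv : measurableTypeR R * 'rV[R]_n => f (rV_cons xv))).
- by move=> x; apply: integral_ge0.
Qed.

Lemma ge0_integral_leb_prod n (f : R -> R) (I : R) :
  measurable_fun setT f -> (forall x, 0 <= f x)%R ->
  \int[lebesgue_measure]_x (f x)%:E = I%:E ->
  \int[leb n]_v (\prod_(i < n) f (v 0%R i))%:E = (I ^+ n)%:E.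
Proof.
move=> mf f0 fI.
have mp m : measurable_fun setT (fun v : 'rV[R]_m => (\prod_(i < m) f (v 0%R i)))%R.
  apply: measurable_prod => i _.
  by apply: measurableT_comp => //; exact: measurable_entry.
have I0 : (0 <= I)%R.
  by rewrite -lee_fin -fI; apply: integral_ge0 => x _; rewrite lee_fin.
elim: n => [|n IH].
  by rewrite integral_leb0 ?expr0 ?big_ord0//; apply/measurable_EFinP; exact: mp.
rewrite ge0_integral_lebS; last 2 first.
- by apply/measurable_EFinP; exact: mp.
- by move=> v; rewrite lee_fin prodr_ge0.
transitivity (\int[lebesgue_measure]_x ((I ^+ n)%:E * (f x)%:E)).
  apply: eq_integral => x _.
  under eq_integral do rewrite prod_rV_cons EFinM /=.
  rewrite (@ge0_integralZl_EFin _ _ _ (leb n) setT _ (fun v => (\prod_(i < n) f (v 0%R i))%:E))//.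
  - by rewrite IH muleC.
  - by move=> v _; rewrite lee_fin prodr_ge0.
  - by apply/measurable_EFinP; exact: mp.
rewrite ge0_integralZl_EFin//; last 3 first.
- by move=> x _; rewrite lee_fin.
- exact/measurable_EFinP.
- by rewrite exprn_ge0.
by rewrite fI exprS mulrC EFinM.
Qed.

Lemma integral_leb_shift n (a : 'rV[R]_n) (f : 'rV[R]_n -> \bar R) :
  measurable_fun setT f -> \int[leb n]_v f (v + a)%R = \int[leb n]_v f v.
Proof.
exact: (@eq_integral_of_ge0 R _ _ (leb n) (fun v => v + a)%R
  (fun g mg g0 => ge0_integral_leb_shift a mg g0) f).
Qed.

Lemma integral_lebN n (f : 'rV[R]_n -> \bar R) :
  measurable_fun setT f -> \int[leb n]_v f (- v)%R = \int[leb n]_v f v.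
Proof.
exact: (@eq_integral_of_ge0 R _ _ (leb n) -%R
  (fun g mg g0 => ge0_integral_lebN mg g0) f).
Qed.

End lebesgue_Rd.

Section gaussian_Rd.
Context {R : realType}.
Implicit Types n : nat.
Variable s : R.
Hypothesis s0 : 0 < s.

Definition gauss_density n (v : 'rV[R]_n) : R :=
  \prod_(i < n) normal_pdf 0 s (v 0 i).

Lemma gauss_density_ge0 n (v : 'rV[R]_n) : 0 <= gauss_density v.
Proof. by apply: prodr_ge0 => i _; exact: normal_pdf_ge0. Qed.

Lemma measurable_gauss_density n : measurable_fun setT (@gauss_density n).
Proof.
apply: measurable_prod => i _.
by apply: (measurableT_comp (measurable_normal_pdf _ _)); exact: measurable_entry.
Qed.

Lemma gauss_densityE n (v : 'rV[R]_n) :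
  gauss_density v = normal_peak s ^+ n * expR (- (dot v v / (s ^+ 2 *+ 2))).
Proof.
rewrite /gauss_density (eq_bigr (fun i => normal_peak s *
    expR (- (v 0 i * v 0 i / (s ^+ 2 *+ 2))))); last first.
  by move=> i _; rewrite centered_normal_pdfE// expr2.
rewrite big_split/= prodr_const card_ord; congr (_ * _).
by rewrite -expR_sum; congr expR; rewrite sumrN -mulr_suml.
Qed.

Lemma gauss_densityN n (v : 'rV[R]_n) : gauss_density (- v) = gauss_density v.
Proof. by rewrite !gauss_densityE dotNr dotNl opprK. Qed.

Local Open Scope ereal_scope.

Lemma integral_gauss_density n : \int[leb n]_v (gauss_density v)%:E = 1.
Proof.
rewrite (@ge0_integral_leb_prod R n (normal_pdf 0 s) 1) ?expr1n//.
- exact: measurable_normal_pdf.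
- by move=> x; exact: normal_pdf_ge0.
- by rewrite integral_normal_pdf// gt_eqF.
Qed.

Lemma integrable_gauss_density n :
  (leb n).-integrable setT (EFin \o @gauss_density n).
Proof.
apply/integrableP; split.
  by apply/measurable_EFinP; exact: measurable_gauss_density.
under eq_integral do rewrite /= ger0_norm ?gauss_density_ge0//.
by rewrite integral_gauss_density ltry.
Qed.

(** The added 1 keeps all integrands nonnegative: integrating the coordinates one
    at a time produces 1 + rho cos with 0 <= rho <= 1, a convex combination of 1
    and 1 + cos. *)
Lemma integral_1Dcos_gauss n (a : R) (xi : 'rV[R]_n) :
  \int[leb n]_v ((1 + cos (a + dot xi v)) * gauss_density v)%:E =
  (1 + cos a * expR (- (s ^+ 2 * dot xi xi / 2)))%:E.
Proof.
have mc m (b : R) (u : 'rV[R]_m) : measurable_fun setT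
    (fun v : 'rV[R]_m => (1 + cos (b + dot u v)) * gauss_density v)%R.
  apply: measurable_funM; last exact: measurable_gauss_density.
  apply: measurable_funD => //; apply: (measurableT_comp measurable_cos).
  by apply: measurable_funD => //; exact: measurable_dot.
have c0 (x : R) : (0 <= 1 + cos x)%R by have := cos_geN1 x; lra.
have pos m (b : R) (u v : 'rV[R]_m) : (0 <= (1 + cos (b + dot u v)) * gauss_density v)%R.
  by rewrite mulr_ge0 ?gauss_density_ge0.
elim: n a xi => [|n IH] a xi.
  rewrite integral_leb0; last by apply/measurable_EFinP; exact: mc.
  by rewrite /gauss_density dot0r {1}/dot !big_ord0 addr0 mulr1 mulr0 mul0r oppr0 expR0 mulr1.
rewrite ge0_integral_lebS; last 2 first.
- by apply/measurable_EFinP; exact: mc.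
- by move=> v; rewrite lee_fin.
pose xi' : 'rV[R]_n := (\row_j xi 0%R (lift 0%R j))%R.
set rho := expR (- (s ^+ 2 * dot xi' xi' / 2)).
have rho01 : (0 <= rho <= 1)%R.
  rewrite expR_ge0/= -[leRHS]expR0 ler_expR oppr_le0.
  by rewrite divr_ge0// mulr_ge0 ?sqr_ge0 ?dot_ge0.
have mn : measurable_fun setT (normal_pdf 0 s) by exact: measurable_normal_pdf.
have mcx : measurable_fun setT (fun x : R => (1 + cos (a + xi 0%R 0%R * x)) * normal_pdf 0 s x)%R.
  apply: measurable_funM => //; apply: measurable_funD => //.
  apply: (measurableT_comp measurable_cos).
  by apply: measurable_funD => //; apply: measurable_funM.
transitivity (\int[lebesgue_measure]_x
    ((1 - rho)%:E * (normal_pdf 0 s x)%:E +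
     rho%:E * ((1 + cos (a + xi 0%R 0%R * x)) * normal_pdf 0 s x)%:E)).
  apply: eq_integral => x _.
  transitivity (\int[leb n]_v ((normal_pdf 0 s x)%:E *
      ((1 + cos ((a + xi 0%R 0%R * x) + dot xi' v)) * gauss_density v)%:E)).
    apply: eq_integral => v _; rewrite -EFinM; congr EFin.
    by rewrite dot_rV_cons /gauss_density prod_rV_cons addrA mulrCA.
  rewrite ge0_integralZl_EFin ?normal_pdf_ge0//; last 2 first.
  - by move=> v _; rewrite lee_fin.
  - by apply/measurable_EFinP; exact: mc.
  by rewrite IH -/rho -!EFinM -EFinD; congr EFin; ring.
move: rho01 => /andP[rho0 rho1].
have rho1' : (0 <= 1 - rho)%R by rewrite subr_ge0.
rewrite ge0_integralD//; last 4 first.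
- by move=> x _; rewrite mule_ge0 ?lee_fin ?normal_pdf_ge0.
- by apply: emeasurable_funM => //; exact/measurable_EFinP.
- by move=> x _; rewrite mule_ge0 ?lee_fin// mulr_ge0 ?normal_pdf_ge0.
- by apply: emeasurable_funM => //; exact/measurable_EFinP.
rewrite !ge0_integralZl_EFin//; last 4 first.
- by move=> x _; rewrite lee_fin mulr_ge0 ?normal_pdf_ge0.
- exact/measurable_EFinP.
- by move=> x _; rewrite lee_fin normal_pdf_ge0.
- exact/measurable_EFinP.
rewrite integral_normal_pdf ?gt_eqF// integral_1Dcos_normal_pdf// -!EFinM -EFinD.
congr EFin.
have -> : dot xi xi = (xi 0%R 0%R ^+ 2 + dot xi' xi')%R.
  rewrite /dot big_ord_recl expr2; congr (_ + _)%R.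
  by apply: eq_bigr => i _; rewrite !mxE.
have -> : (- (s ^+ 2 * (xi 0 0 ^+ 2 + dot xi' xi') / 2) =
    - (s ^+ 2 * xi 0 0 ^+ 2 / 2) + - (s ^+ 2 * dot xi' xi' / 2))%R by field.
rewrite expRD -/rho; ring.
Qed.

(** Adding a coordinate adds the one-dimensional second moment s^2. *)
Lemma integral_dot_gauss n :
  \int[leb n]_v (dot v v * gauss_density v)%:E = (s ^+ 2 *+ n)%:E.
Proof.
have mc m : measurable_fun setT (fun v : 'rV[R]_m => dot v v * gauss_density v)%R.
  apply: measurable_funM; last exact: measurable_gauss_density.
  exact: measurable_dot_self.
have pos m (v : 'rV[R]_m) : (0 <= dot v v * gauss_density v)%R.
  by rewrite mulr_ge0 ?gauss_density_ge0 ?dot_ge0.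
elim: n => [|n IH].
  rewrite integral_leb0; last by apply/measurable_EFinP; exact: mc.
  by rewrite dot0r mul0r mulr0n.
rewrite ge0_integral_lebS; last 2 first.
- by apply/measurable_EFinP; exact: mc.
- by move=> v; rewrite lee_fin.
have mn : measurable_fun setT (normal_pdf 0 s) by exact: measurable_normal_pdf.
have n0 x : (0 <= normal_pdf 0 s x)%R by exact: normal_pdf_ge0.
have mxn : measurable_fun setT (fun x : R => x ^+ 2 * normal_pdf 0 s x)%R.
  by apply: measurable_funM => //; exact: measurable_funX.
transitivity (\int[lebesgue_measure]_x
    ((x ^+ 2 * normal_pdf 0 s x)%:E + (s ^+ 2 *+ n)%:E * (normal_pdf 0 s x)%:E)).
  apply: eq_integral => x _.
  transitivity (\int[leb n]_v ((x ^+ 2 * normal_pdf 0 s x)%:E * (gauss_density v)%:E +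
     (normal_pdf 0 s x)%:E * (dot v v * gauss_density v)%:E)).
    apply: eq_integral => v _; rewrite -!EFinM -EFinD; congr EFin.
    rewrite /gauss_density prod_rV_cons /=.
    have -> : dot (rV_cons (x : measurableTypeR R, v)) (rV_cons (x : measurableTypeR R, v)) =
        (x ^+ 2 + dot v v)%R.
      rewrite dot_rV_cons mxE unlift_none/= expr2; congr (_ + _ )%R.
      by apply: eq_bigr => i _; rewrite !mxE liftK.
    ring.
  have md : measurable_fun setT (fun v : 'rV[R]_n => (gauss_density v)%:E).
    by apply/measurable_EFinP; exact: measurable_gauss_density.
  have mcn : measurable_fun setT (fun v : 'rV[R]_n => (dot v v * gauss_density v)%:E).
    by apply/measurable_EFinP; exact: mc.
  rewrite ge0_integralD//; last 4 first.
  - move=> v _; apply: mule_ge0; rewrite lee_fin; last exact: gauss_density_ge0.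
    by rewrite mulr_ge0 ?sqr_ge0.
  - exact: emeasurable_funM.
  - by move=> v _; rewrite mule_ge0 ?lee_fin.
  - exact: emeasurable_funM.
  rewrite !ge0_integralZl_EFin//; last 3 first.
  - by move=> v _; rewrite lee_fin.
  - by move=> v _; rewrite lee_fin gauss_density_ge0.
  - by rewrite mulr_ge0 ?sqr_ge0.
  by rewrite IH integral_gauss_density mule1 [in RHS]muleC.
have pos2 : (0 <= s ^+ 2 *+ n)%R by rewrite mulrn_wge0// sqr_ge0.
rewrite ge0_integralD//; last 4 first.
- by move=> x _; rewrite lee_fin mulr_ge0 ?sqr_ge0.
- exact/measurable_EFinP.
- by move=> x _; rewrite mule_ge0 ?lee_fin.
- by apply: emeasurable_funM => //; exact/measurable_EFinP.
rewrite ge0_integralZl_EFin//; last 2 first.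
- by move=> x _; rewrite lee_fin.
- exact/measurable_EFinP.
rewrite normal_pdf_second_moment// integral_normal_pdf ?gt_eqF// mule1 -EFinD.
by rewrite mulrS.
Qed.

End gaussian_Rd.

Section gaussian_kernel.
Context {R : realType} {d : nat}.
Implicit Types (u : 'rV[R]_d -> R) (v xi z x : 'rV[R]_d).
Variable s : R.
Hypothesis s0 : 0 < s.
Let gd : 'rV[R]_d -> R := @gauss_density R s d.

Let mgd : measurable_fun setT gd.
Proof. exact: (@measurable_gauss_density R s d). Qed.

Let igd : (leb d).-integrable setT (EFin \o gd).
Proof. exact: integrable_gauss_density. Qed.

Let gd0 v : 0 <= gd v. Proof. exact: gauss_density_ge0. Qed.

Lemma Rintegral_gauss_density : \int[leb d]_v gauss_density s v = 1.
Proof. by rewrite /Rintegral integral_gauss_density. Qed.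

Lemma integrable_mul_gauss (g : 'rV[R]_d -> R) (M : R) : measurable_fun setT g ->
  (forall v, `|g v| <= M) -> (leb d).-integrable setT (EFin \o (fun v => g v * gauss_density s v)).
Proof.
move=> mg gM; apply: (@integrable_dominated _ _ _ _ _ (fun v => M * gd v)).
- exact: measurable_funM.
- by move=> v; rewrite normrM [`|gauss_density s v|]ger0_norm ?gd0// ler_wpM2r.
- exact: integrable_realZl.
Qed.

Lemma Rintegral_cos_gauss xi :
  \int[leb d]_v (cos (dot xi v) * gauss_density s v) = expR (- (s ^+ 2 * dot xi xi / 2)).
Proof.
have ic : (leb d).-integrable setT (EFin \o (fun v => cos (dot xi v) * gauss_density s v)).
  apply: (@integrable_mul_gauss _ 1); first exact: measurable_cos_dot.
  by move=> v; exact: norm_cos_le1.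
have := integral_1Dcos_gauss s0 0 xi; rewrite cos0 mul1r => H.
apply: (@addrI _ 1); rewrite -[X in X + _ = _]Rintegral_gauss_density -RintegralD//.
rewrite -[RHS]/(fine (_%:E)) -H /Rintegral; congr fine; apply: eq_integral => v _.
by rewrite add0r mulrDl mul1r.
Qed.

Lemma integrable_dot_gauss :
  (leb d).-integrable setT (EFin \o (fun v => dot v v * gauss_density s v)).
Proof.
apply/integrableP; split.
  by apply/measurable_EFinP; apply: measurable_funM => //; exact: measurable_dot_self.
under eq_integral do rewrite /= ger0_norm ?mulr_ge0 ?dot_ge0//.
by rewrite integral_dot_gauss// ltry.
Qed.

(** A quadratic modulus of continuity at x costs the second moment s^2 d: as s
    tends to 0, the Gaussian kernels form an approximate identity. *)
Lemma gauss_kernel_error u (M K e : R) x : measurable_fun setT u -> (forall z, `|u z| <= M) ->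
  (forall v, `|u (v + x) - u x| <= e + K * dot v v) ->
  `|\int[leb d]_v (u (v + x) * gauss_density s v) - u x| <= e + K * (s ^+ 2 *+ d).
Proof.
move=> mu uM ue.
have mux : measurable_fun setT (fun v : 'rV[R]_d => u (v + x)).
  exact: measurableT_comp mu (measurable_rV_shift x).
have i1 : (leb d).-integrable setT (EFin \o (fun v => u (v + x) * gauss_density s v)).
  exact: integrable_mul_gauss.
have i2 : (leb d).-integrable setT (EFin \o (fun v => u x * gauss_density s v)).
  exact: integrable_realZl.
have i3 := integrable_realZl e igd.
have i4 := integrable_realZl K integrable_dot_gauss.
have -> : u x = \int[leb d]_v (u x * gauss_density s v).
  by rewrite RintegralZl// Rintegral_gauss_density mulr1.
have -> : e + K * (s ^+ 2 *+ d) =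
    \int[leb d]_v (e * gauss_density s v + K * (dot v v * gauss_density s v)).
  rewrite RintegralD// RintegralZl// Rintegral_gauss_density mulr1; congr (_ + _).
  by rewrite RintegralZl ?integrable_dot_gauss// /Rintegral integral_dot_gauss.
rewrite -RintegralB//; apply: le_trans (le_normr_Rintegral _ _) _ => //.
  exact: integrable_realB.
apply: le_Rintegral => //.
- by have := integrable_abse (integrable_realB i1 i2).
- exact: integrable_realD.
- move=> v _; rewrite -mulrBl normrM [`|gauss_density s v|]ger0_norm ?gd0//.
  by rewrite mulrA -mulrDl ler_wpM2r.
Qed.

End gaussian_kernel.

(** * Continuous functions on Euclidean space *)

Section rV_norm.
Context {R : realType} {n : nat}.
Implicit Types v w : 'rV[R]_n.

Lemma rV_norm_le (e : R) v : 0 <= e -> (forall i, `|v 0 i| <= e) -> `|v| <= e.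
Proof.
move=> e0 ve; rewrite /Num.norm/= mx_normrE; apply: bigmax_le => // -[i j] _ /=.
by rewrite ord1.
Qed.

Lemma sqr_coord_le_dot v i : v 0 i ^+ 2 <= dot v v.
Proof.
rewrite /dot (bigD1 i)//= -expr2 lerDl; apply: sumr_ge0 => j _.
by rewrite -expr2 sqr_ge0.
Qed.

(** The sup norm is dominated by a quantity whose Gaussian mean is explicit; the
    inequality is y <= s + y^2 / s in each coordinate. *)
Lemma rV_norm_le_dot (s : R) v : 0 < s -> `|v| <= s + dot v v / s.
Proof.
move=> s0; apply: rV_norm_le => [|i].
  by rewrite addr_ge0 ?divr_ge0 ?dot_ge0// ltW.
apply: (@le_trans _ _ (s + v 0 i ^+ 2 / s)); last first.
  by rewrite lerD2l ler_pM2r ?invr_gt0// sqr_coord_le_dot.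
rewrite -[v 0 i ^+ 2]real_normK ?num_real//; set y := `|_|.
have y0 : 0 <= y by exact: normr_ge0.
rewrite -(ler_pM2r s0) mulrDl divfK ?gt_eqF//.
have := sqr_ge0 (y - s); nra.
Qed.

End rV_norm.

Section continuous_measurable.
Context {R : realType} {n : nat}.

Let grid (k : nat) (v : 'rV[R]_n) : 'rV[int]_n := \row_i Num.floor (k.+1%:R * v 0 i).
Let rnd (k : nat) (m : 'rV[int]_n) : 'rV[R]_n := \row_i ((m 0 i)%:~R / k.+1%:R).

Let measurable_grid k m : measurable [set v | grid k v = m].
Proof.
rewrite (_ : [set v | _] = \bigcap_(i in [set: 'I_n])
    [set v : 'rV[R]_n | (m 0 i)%:~R <= k.+1%:R * v 0 i < (m 0 i + 1)%:~R]); last first.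
  apply/seteqP; split => v /=.
    by move=> <- i _ /=; rewrite mxE floor_le_tmp floorD1_gt.
  by move=> h; apply/rowP => i; rewrite mxE; apply/floor_def/h.
apply: fin_bigcap_measurable => // i _.
rewrite -[X in measurable X]setTI.
have mk : measurable_fun setT (fun v : 'rV[R]_n => k.+1%:R * v 0 i).
  by apply: measurable_funM => //; exact: measurable_entry.
rewrite (_ : [set v | _] = (fun v : 'rV[R]_n => k.+1%:R * v 0 i) @^-1`
   `[(m 0 i)%:~R, (m 0 i + 1)%:~R[%classic); last first.
  by apply/seteqP; split => v /=; rewrite in_itv.
exact: mk.
Qed.

Let cvg_grid (v : 'rV[R]_n) : rnd k (grid k v) @[k --> \oo] --> v.
Proof.
apply/cvgrPdist_le => e e0; near=> k.
apply: rV_norm_le => [|i]; first exact: ltW.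
rewrite !mxE.
have k0 : 0 < k.+1%:R :> R by [].
have ke : k.+1%:R^-1 <= e.
  rewrite -[leRHS]invrK lef_pV2 ?posrE ?invr_gt0//.
  near: k; exists (Num.truncn e^-1).+1 => // k /= hk.
  rewrite ltW// (lt_le_trans (truncnS_gt _))// ler_nat.
  by rewrite (leq_trans hk).
apply: le_trans ke; rewrite -[X in X - _](mulfK (lt0r_neq0 k0)) -mulrBl normrM.
rewrite [X in _ * X]ger0_norm ?invr_ge0// ler_piMl ?invr_ge0//.
have := floor_le_tmp (k.+1%:R * v 0 i); have := floorD1_gt (k.+1%:R * v 0 i).
rewrite intrD mulrC; set x := _ * _; set y := _%:~R => h1 h2.
by rewrite ler_norml; lra.
Unshelve. all: by end_near. Qed.

(** The sigma-algebra on R^n is generated by coordinates; a continuous function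
    is the limit of its roundings to a grid, which take countably many values. *)
Lemma continuous_measurable_rV (f : 'rV[R]_n -> R) :
  continuous f -> measurable_fun setT f.
Proof.
move=> cf; apply: (@measurable_fun_cvg _ _ R setT (fun k v => f (rnd k (grid k v)))).
- move=> k _ B mB; rewrite setTI.
  rewrite (_ : _ @^-1` B = \bigcup_(m in [set m | B (f (rnd k m))])
      [set v | grid k v = m]); last first.
    apply/seteqP; split => v /=; first by move=> h; exists (grid k v).
    by move=> [m /= Bm ->].
  rewrite bigcup_mkcond; apply: countable_bigcupT_measurable.
    exact: countableP.
  by move=> m; case: ifP => _ //; exact: measurable_grid.
- by move=> v _; apply: (continuous_cvg _ (cf v)); exact: cvg_grid.
Qed.

End continuous_measurable.

Section inf_convolution.
Context {R : realType} {V : normedModType R}.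
Variable g : V -> R.
Hypothesis g0 : forall x, 0 <= g x.

(** The largest k-Lipschitz minorant of g. *)
Definition inf_convolution (k : R) (x : V) : R :=
  inf [set g y + k * `|x - y| | y in setT].

Variable k : R.
Hypothesis k0 : 0 <= k.

Let lb0 x : lbound [set g y + k * `|x - y| | y in setT] 0.
Proof. by move=> _ [y _ <-]; rewrite addr_ge0 ?mulr_ge0. Qed.

Let nonempty x : [set g y + k * `|x - y| | y in setT] !=set0.
Proof. by exists (g x + k * `|x - x|); exists x. Qed.

Lemma inf_convolution_ge0 x : 0 <= inf_convolution k x.
Proof. exact: lb_le_inf. Qed.

Lemma inf_convolution_le x y : inf_convolution k x <= g y + k * `|x - y|.
Proof. by apply: ge_inf; [exists 0; exact: lb0|exists y]. Qed.

Lemma inf_convolution_le_id x : inf_convolution k x <= g x.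
Proof. by rewrite (le_trans (inf_convolution_le x x))// subrr normr0 mulr0 addr0. Qed.

Lemma inf_convolution_lipschitz x y :
  inf_convolution k x <= inf_convolution k y + k * `|x - y|.
Proof.
rewrite -lerBlDr; apply: lb_le_inf => // _ [z _ <-].
rewrite lerBlDr (le_trans (inf_convolution_le x z))// -addrA lerD2l.
by rewrite -mulrDr ler_wpM2l// [leRHS]addrC ler_distD.
Qed.

End inf_convolution.

Section inf_convolution_cvg.
Context {R : realType} {V : normedModType R}.

(** Points y far from x are penalized by k |x - y|, which exceeds g x for large k;
    near x the values g y are close to g x. *)
Lemma cvg_inf_convolution (g : V -> R) : (forall x, 0 <= g x) -> continuous g ->
  forall x, inf_convolution g k%:R x @[k --> \oo] --> g x.
Proof.
move=> g0 cg x; apply/cvgrPdist_le => e e0.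
have /cvgrPdist_lt/(_ e e0) := cg x.
move=> /nbhs_ballP[r /= r0 hr]; near=> k.
have le1 := inf_convolution_le_id g0 (ler0n R k) x.
rewrite ger0_norm ?subr_ge0// lerBlDl -lerBlDr.
apply: lb_le_inf => [|_ [y _ <-]].
  by exists (g x + k%:R * `|x - x|); exists x.
have [xy|xy] := ltP `|x - y| r.
  rewrite lerBlDr (@le_trans _ _ (g y + e))//; last by rewrite lerD2r lerDl mulr_ge0.
  by have := hr y; rewrite -ball_normE /= => /(_ xy); rewrite ltr_norml; lra.
rewrite (@le_trans _ _ (g x))//; first by rewrite gerBl ltW.
rewrite (@le_trans _ _ (k%:R * `|x - y|))//; last by rewrite lerDr.
rewrite (@le_trans _ _ (k%:R * r))//; last by rewrite ler_wpM2l.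
rewrite -ler_pdivrMr//; near: k; exact: nbhs_infty_ger.
Unshelve. all: by end_near. Qed.

Lemma lipschitz_continuous (h : V -> R) (L : R) :
  (forall x y, h x <= h y + L * `|x - y|) -> continuous h.
Proof.
move=> hL x; have L1 : 0 < `|L| + 1 by rewrite ltr_wpDl.
apply/cvgrPdist_le => e e0; apply/nbhs_ballP; exists (e / (`|L| + 1)).
  by rewrite /= divr_gt0.
move=> y; rewrite -ball_normE/= ltr_pdivlMr// => xy.
have h1 := hL x y; have h2 := hL y x; rewrite distrC in h2.
have h3 : L * `|x - y| <= e.
  apply: le_trans (ltW xy); rewrite mulrC ler_wpM2l//.
  by rewrite (le_trans (ler_norm L))// lerDl.
by rewrite ler_norml; lra.
Qed.

End inf_convolution_cvg.

(** * Gaussian smoothing and cosine transforms of laws *)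

Section smoothing.
Local Open Scope ereal_scope.
Context {R : realType} {d : nat}.
Implicit Types h : 'rV[R]_d -> R.

(** Valued in the extended reals, so that Tonelli's theorem applies to nonnegative
    h without any integrability condition. *)
Definition gauss_smoothing (s : R) h (x : 'rV[R]_d) : \bar R :=
  \int[leb d]_z (h z * gauss_density s (z - x))%:E.

Variable s : R.
Hypothesis s0 : (0 < s)%R.

Lemma gauss_smoothingE h x : measurable_fun setT h ->
  gauss_smoothing s h x = \int[leb d]_v (h (v + x)%R * gauss_density s v)%:E.
Proof.
move=> mh; rewrite /gauss_smoothing.
rewrite -(@integral_leb_shift R d x (fun z => (h z * gauss_density s (z - x)%R)%:E)).
  by apply: eq_integral => v _; rewrite addrK.
apply/measurable_EFinP; apply: measurable_funM => //.
by apply: (measurableT_comp (@measurable_gauss_density R s d)); exact: measurable_rV_shift.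
Qed.

(** Instance of the kernel estimate, with the Lipschitz modulus L |v| replaced by
    the quadratic bound L (s + |v|^2 / s), whose Gaussian mean is L s (d + 1). *)
Lemma gauss_smoothing_lipschitz h (L M : R) : (forall x, 0 <= h x)%R ->
  (forall x, h x <= M)%R -> (0 <= L)%R ->
  (forall x y, h x <= h y + L * `|x - y|)%R -> forall x,
  (h x)%:E <= gauss_smoothing s h x + (L * (s *+ d.+1))%:E /\
  gauss_smoothing s h x <= (h x)%:E + (L * (s *+ d.+1))%:E.
Proof.
move=> h0 hM L0 hL x.
have mh : measurable_fun setT h.
  by apply: continuous_measurable_rV; exact: lipschitz_continuous hL.
have hM' z : (`|h z| <= M)%R by rewrite ger0_norm.
have bnd (v : 'rV[R]_d) : (`|h (v + x) - h x| <= L * s + L / s * dot v v)%R.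
  have -> : (L * s + L / s * dot v v = L * (s + dot v v / s))%R by ring.
  apply: (@le_trans _ _ (L * `|v|)%R); last by rewrite ler_wpM2l// rV_norm_le_dot.
  have := hL (v + x)%R x; have := hL x (v + x)%R.
  by rewrite opprD addrCA subrr addr0 normrN addrK ler_norml; lra.
have mhx : measurable_fun setT (fun v : 'rV[R]_d => h (v + x))%R.
  exact: measurableT_comp mh (measurable_rV_shift x).
have ih := @integrable_mul_gauss R d s _ M mhx (fun v => hM' (v + x)%R).
have IE : \int[leb d]_v (h (v + x)%R * gauss_density s v)%:E =
    (\int[leb d]_v (h (v + x)%R * gauss_density s v)%R)%:E.
  by rewrite fineK//; exact: integrable_fin_num ih.
rewrite gauss_smoothingE// IE -!EFinD !lee_fin.
have E : (L * s + L / s * (s ^+ 2 *+ d) = L * (s *+ d.+1))%R.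
  rewrite mulrS -[in RHS]mulr_natr -[in LHS]mulr_natr.
  by field; rewrite gt_eqF.
have H := gauss_kernel_error s0 mh hM' bnd; rewrite E ler_norml in H.
by split; lra.
Qed.

(** Up to normalization a Gaussian is its own Fourier transform; this is how the
    transforms of X enter the density of its smoothing. *)
Lemma gauss_density_mixture (w : 'rV[R]_d) :
  (gauss_density s w)%:E = (normal_peak s ^+ d)%:E *
   (\int[leb d]_xi ((1 + cos (dot xi w)) * gauss_density s^-1 xi)%:E - 1).
Proof.
have sV0 : (0 < s^-1)%R by rewrite invr_gt0.
have := @integral_1Dcos_gauss R _ sV0 d 0%R w.
under eq_integral do rewrite add0r dotC.
move=> ->; rewrite cos0 mul1r -EFinB -EFinM gauss_densityE//; congr EFin.
rewrite addrAC subrr add0r; congr (_ * expR (- _))%R.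
by field; rewrite gt_eqF.
Qed.

Section law.
Context {d0} {Om : measurableType d0} (P : probability Om R) (X : Om -> 'rV[R]_d).
Hypothesis mX : measurable_fun setT X.

(** The shifts a = 0 and a = - pi / 2 recover the real and imaginary parts of the
    characteristic function; adding 1 keeps the integrand nonnegative, so that
    integrals can be exchanged freely. *)
Definition cos_transform (a : R) (xi : 'rV[R]_d) : \bar R :=
  \int[P]_w (1 + cos (a + dot xi (X w)))%:E.

Let c0 (x : R) : (0 <= 1 + cos x)%R.
Proof. by have := cos_geN1 x; lra. Qed.

Let c2 (x : R) : (1 + cos x <= 2)%R.
Proof. by have := cos_le1 x; lra. Qed.

Lemma cos_transform_ge0 a xi : 0 <= cos_transform a xi.
Proof. by apply: integral_ge0 => w _; rewrite lee_fin. Qed.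

Let mcX a xi : measurable_fun setT (fun w => (1 + cos (a + dot xi (X w)))%:E).
Proof.
apply/measurable_EFinP; apply: measurable_funD => //.
apply: (measurableT_comp measurable_cos); apply: measurable_funD => //.
exact: measurableT_comp (measurable_dot xi) mX.
Qed.

Lemma cos_transform_le2 a xi : cos_transform a xi <= 2%:E.
Proof.
apply: (@le_trans _ _ (\int[P]_w 2%:E)); last first.
  by rewrite integral_cst//= probability_setT mule1.
by apply: ge0_le_integral => // w _; rewrite lee_fin.
Qed.

Lemma measurable_cos_transform (a : 'rV[R]_d -> R) : measurable_fun setT a ->
  measurable_fun setT (fun xi => cos_transform (a xi) xi).
Proof.
move=> ma.
apply: (@measurable_fun_fubini_tonelli_F _ _ 'rV[R]_d Om R P
  (fun p => (1 + cos (a p.1 + dot p.1 (X p.2)))%:E)).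
  apply/measurable_EFinP; apply: measurable_funD => //.
  apply: (measurableT_comp measurable_cos); apply: measurable_funD.
    exact: measurableT_comp ma measurable_fst.
  apply: measurable_sum => i; apply: measurable_funM.
    exact: measurableT_comp (measurable_entry 0%R i) measurable_fst.
  apply: (measurableT_comp (measurable_entry 0%R i)).
  exact: measurableT_comp mX measurable_snd.
by move=> p; rewrite lee_fin.
Qed.

(** The density at z of X plus an independent Gaussian vector. *)
Definition smoothed_density (z : 'rV[R]_d) : \bar R :=
  \int[P]_w (gauss_density s (z - X w))%:E.

(** The smoothed density is determined by the cosine transforms of X: expand the
    Gaussian as a mixture of cosines and integrate over X first. *)
Lemma smoothed_densityE z : smoothed_density z = (normal_peak s ^+ d)%:E *
  (\int[leb d]_xi ((gauss_density s^-1 xi)%:E * cos_transform (- dot xi z) xi) - 1).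
Proof.
have sV0 : (0 < s^-1)%R by rewrite invr_gt0.
have mgX : measurable_fun setT (fun w => (gauss_density s (z - X w))%:E).
  apply/measurable_EFinP; apply: (measurableT_comp (@measurable_gauss_density R s d)).
  apply: measurable_rVD => //; exact: measurableT_comp measurable_rVN mX.
pose I w := \int[leb d]_xi ((1 + cos (dot xi (X w - z)%R)) * gauss_density s^-1 xi)%:E.
have mF : measurable_fun setT (fun p : Om * 'rV[R]_d =>
    ((1 + cos (dot p.2 (X p.1 - z)%R)) * gauss_density s^-1 p.2)%:E).
  apply/measurable_EFinP; apply: measurable_funM; last first.
    exact: measurableT_comp (@measurable_gauss_density R s^-1 d) measurable_snd.
  apply: measurable_funD => //; apply: (measurableT_comp measurable_cos).
  apply: measurable_sum => i; apply: measurable_funM.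
    exact: measurableT_comp (measurable_entry 0%R i) measurable_snd.
  apply: (measurableT_comp (measurable_entry 0%R i)).
  apply: (measurableT_comp (measurable_rV_shift _)).
  exact: measurableT_comp mX measurable_fst.
have F0 (p : Om * 'rV[R]_d) :
    0 <= ((1 + cos (dot p.2 (X p.1 - z)%R)) * gauss_density s^-1 p.2)%:E.
  by rewrite lee_fin mulr_ge0// gauss_density_ge0.
have IE w : I w = 1 + ((normal_peak s ^+ d)^-1 * gauss_density s (z - X w))%:E.
  have -> : gauss_density s (z - X w)%R = gauss_density s (X w - z)%R.
    by rewrite -[in LHS](opprB (X w) z) gauss_densityN.
  rewrite EFinM gauss_density_mixture -/(I w).
  have [r rE] : exists r, I w = r%:E.
    have := @integral_1Dcos_gauss R _ sV0 d 0%R (X w - z)%R.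
    by under eq_integral do rewrite add0r dotC; rewrite -/(I w) => ->; eexists.
  rewrite rE -!EFinB -!EFinM -EFinD; congr EFin.
  by rewrite mulKf ?expf_neq0 ?gt_eqF ?normal_peak_gt0 ?gt_eqF//; ring.
have II : \int[P]_w I w = 1 + ((normal_peak s ^+ d)^-1)%:E * smoothed_density z.
  under eq_integral do rewrite IE EFinM.
  rewrite ge0_integralD//; last 2 first.
  - by move=> w _; rewrite mule_ge0 ?lee_fin ?invr_ge0 ?exprn_ge0 ?normal_peak_ge0 ?gauss_density_ge0.
  - exact: emeasurable_funM.
  rewrite integral_cst//= probability_setT mule1 ge0_integralZl_EFin//.
  - by move=> w _; rewrite lee_fin gauss_density_ge0.
  - by rewrite invr_ge0 exprn_ge0 ?normal_peak_ge0.
have -> : \int[leb d]_xi ((gauss_density s^-1 xi)%:E * cos_transform (- dot xi z) xi) =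
    \int[P]_w I w.
  rewrite /I (fubini_tonelli (fun p : Om * 'rV[R]_d =>
    ((1 + cos (dot p.2 (X p.1 - z)%R)) * gauss_density s^-1 p.2)%:E))//.
  apply: eq_integral => xi _ /=.
  rewrite -ge0_integralZl_EFin ?gauss_density_ge0//.
  apply: eq_integral => w _; rewrite -EFinM mulrC; congr ((1 + cos _) * _)%:E.
  by rewrite dotDr dotNr addrC.
rewrite II addeAC subee// add0e muleA -EFinM divff ?mul1e//.
by rewrite expf_neq0// gt_eqF// normal_peak_gt0// gt_eqF.
Qed.

Lemma measurable_smoothed_density : measurable_fun setT smoothed_density.
Proof.
apply: (@measurable_fun_fubini_tonelli_F _ _ 'rV[R]_d Om R P
  (fun p => (gauss_density s (p.1 - X p.2))%:E)).
  apply/measurable_EFinP; apply: (measurableT_comp (@measurable_gauss_density R s d)).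
  apply: measurable_rVD; first exact: measurable_fst.
  apply: (measurableT_comp measurable_rVN).
  exact: measurableT_comp mX measurable_snd.
by move=> p; rewrite lee_fin gauss_density_ge0.
Qed.

Lemma integral_smoothed_density h : measurable_fun setT h -> (forall x, 0 <= h x)%R ->
  \int[leb d]_z ((h z)%:E * smoothed_density z) = \int[P]_w gauss_smoothing s h (X w).
Proof.
move=> mh h0; rewrite /gauss_smoothing.
have mg : measurable_fun setT (fun p : Om * 'rV[R]_d => gauss_density s (p.2 - X p.1)).
  apply: (measurableT_comp (@measurable_gauss_density R s d)).
  apply: measurable_rVD; first exact: measurable_snd.
  apply: (measurableT_comp measurable_rVN).
  exact: measurableT_comp mX measurable_fst.
rewrite (fubini_tonelli (fun p : Om * 'rV[R]_d => (h p.2 * gauss_density s (p.2 - X p.1))%:E)).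
- apply: eq_integral => z _; rewrite -ge0_integralZl_EFin//.
  + by move=> w _; rewrite lee_fin gauss_density_ge0.
  + apply/measurable_EFinP; exact: measurableT_comp mg (pair2_measurable z).
- apply/measurable_EFinP; apply: measurable_funM => //.
  exact: measurableT_comp mh measurable_snd.
- by move=> p; rewrite lee_fin mulr_ge0// gauss_density_ge0.
Qed.

End law.
End smoothing.

(** * Convergence of transforms implies convergence in distribution *)

(** A lower bound on the lower limit holds eventually up to any e > 0; this turns
    the extended-real conclusion of Fatou's lemma into a usable inequality. *)
Lemma limn_einf_near_le {R : realType} (u : (\bar R)^nat) (x : \bar R) (e : R) :
  x \is a fin_num -> (x <= limn_einf u)%E -> 0 < e ->
  \forall n \near \oo, (x <= u n + e%:E)%E.
Proof.
move=> xfin xu e0; rewrite limn_einf_lim in xu.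
have /cvg_lim L := @cvg_einfs_sup R u.
rewrite L// in xu.
have : (x - e%:E < ereal_sup (range (einfs u)))%E.
  by rewrite (lt_le_trans _ xu)// lteBlDr// lteDl// lte_fin.
move=> /ereal_sup_gt[_ [N _ <-]] xN; near=> n.
rewrite -leeBlDr//; apply: (le_trans (ltW xN)).
rewrite /einfs/=; apply: ereal_inf_lbound; exists n => //=.
by near: n; exists N.
Unshelve. all: by end_near. Qed.

Section smoothing_regularity.
Local Open Scope ereal_scope.
Context {R : realType} {d : nat}.

Lemma gauss_smoothing_ge0 (s : R) (h : 'rV[R]_d -> R) x :
  (forall x, 0 <= h x)%R -> 0 <= gauss_smoothing s h x.
Proof.
move=> h0; apply: integral_ge0 => v _.
by rewrite lee_fin mulr_ge0// gauss_density_ge0.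
Qed.

Lemma measurable_gauss_smoothing (s : R) (h : 'rV[R]_d -> R) :
  measurable_fun setT h -> (forall x, 0 <= h x)%R ->
  measurable_fun setT (gauss_smoothing s h).
Proof.
move=> mh h0.
apply: (@measurable_fun_fubini_tonelli_F _ _ 'rV[R]_d 'rV[R]_d R (leb d)
  (fun p => (h p.2 * gauss_density s (p.2 - p.1))%:E)).
  apply/measurable_EFinP; apply: measurable_funM.
    exact: measurableT_comp mh measurable_snd.
  apply: (measurableT_comp (@measurable_gauss_density R s d)).
  apply: measurable_rVD; first exact: measurable_snd.
  exact: measurableT_comp measurable_rVN measurable_fst.
by move=> p; rewrite lee_fin mulr_ge0// gauss_density_ge0.
Qed.

Lemma integral_probability_cst d0 (Om : measurableType d0) (P : probability Om R)
  (c : \bar R) : \int[P]_w c = c.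
Proof. by rewrite integral_cst//= probability_setT mule1. Qed.

Lemma integral_probability_le d0 (Om : measurableType d0) (P : probability Om R)
    (f : Om -> \bar R) (M : R) : measurable_fun setT f -> (forall w, 0 <= f w) ->
  (forall w, f w <= M%:E) -> \int[P]_w f w <= M%:E.
Proof.
move=> mf f0 fM; rewrite -(integral_probability_cst P M%:E).
by apply: ge0_le_integral => // w _; exact: fM.
Qed.

Lemma integral_gauss_smoothing_lipschitz (s : R) (h : 'rV[R]_d -> R) (L M : R)
    d0 (Om : measurableType d0) (P : probability Om R) (X : Om -> 'rV[R]_d) :
  (0 < s)%R -> measurable_fun setT X ->
  (forall x, 0 <= h x)%R -> (forall x, h x <= M)%R -> (0 <= L)%R ->
  (forall x y, h x <= h y + L * `|x - y|)%R ->
  \int[P]_w (h (X w))%:E <=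
    \int[P]_w gauss_smoothing s h (X w) + (L * (s *+ d.+1))%:E /\
  \int[P]_w gauss_smoothing s h (X w) <=
    \int[P]_w (h (X w))%:E + (L * (s *+ d.+1))%:E.
Proof.
move=> s0 mX h0 hM L0 hL; set e := (L * (s *+ d.+1))%R.
have e0 : (0 <= e)%R by rewrite mulr_ge0// mulrn_wge0// ltW.
have mh : measurable_fun setT h.
  by apply: continuous_measurable_rV; exact: lipschitz_continuous hL.
have mhX : measurable_fun setT (fun w => (h (X w))%:E).
  by apply/measurable_EFinP; exact: measurableT_comp mh mX.
have msX : measurable_fun setT (fun w => gauss_smoothing s h (X w)).
  exact: measurableT_comp (measurable_gauss_smoothing _ mh h0) mX.
have s_ge0 x : 0 <= gauss_smoothing s h x by exact: gauss_smoothing_ge0.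
rewrite -(integral_probability_cst P e%:E) -!ge0_integralD//.
split; apply: ge0_le_integral => //.
- by move=> w _; rewrite lee_fin.
- exact: emeasurable_funD.
- by move=> w _; have [] := gauss_smoothing_lipschitz s0 h0 hM L0 hL (X w).
- exact: emeasurable_funD.
- by move=> w _; have [] := gauss_smoothing_lipschitz s0 h0 hM L0 hL (X w).
- by move=> w _; rewrite lee_fin.
Qed.

End smoothing_regularity.

Section levy_continuity.
Local Open Scope ereal_scope.
Context {R : realType} {d : nat}.
Context {disp : nat -> measure_display} {Om : forall n, measurableType (disp n)}.
Context (P : forall n, probability (Om n) R) (X : forall n, Om n -> 'rV[R]_d).
Arguments X : clear implicits.
Hypothesis mX : forall n, measurable_fun setT (X n).
Arguments mX : clear implicits.
Context {disp' : measure_display} {Om' : measurableType disp'}.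
Context (P' : probability Om' R) (Z : Om' -> 'rV[R]_d).
Hypothesis mZ : measurable_fun setT Z.
Hypothesis cvg_transform : forall a xi,
  cos_transform (P n) (X n) a xi @[n --> \oo] --> cos_transform P' Z a xi.

(** Pointwise convergence of the smoothed densities, by dominated convergence in
    the frequency: cosine transforms are at most 2 and the weight is Gaussian. *)
Lemma cvg_smoothed_density (s : R) (z : 'rV[R]_d) : (0 < s)%R ->
  smoothed_density s (P n) (X n) z @[n --> \oo] --> smoothed_density s P' Z z.
Proof.
move=> s0; have sV0 : (0 < s^-1)%R by rewrite invr_gt0.
under eq_fun do rewrite smoothed_densityE//.
rewrite smoothed_densityE//; apply: cvgeZl => //.
have mgs : measurable_fun setT (fun xi : 'rV[R]_d => (gauss_density s^-1 xi)%:E).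
  by apply/measurable_EFinP; exact: measurable_gauss_density.
have mz : measurable_fun setT (fun xi : 'rV[R]_d => - dot xi z)%R.
  apply: measurable_funN; under eq_fun do rewrite dotC.
  exact: measurable_dot.
have g0 (xi : 'rV[R]_d) : 0 <= (gauss_density s^-1 xi)%:E.
  by rewrite lee_fin gauss_density_ge0.
have [|||||_ _] := @dominated_convergence _ _ _ (leb d) setT measurableT
  (fun n xi => (gauss_density s^-1 xi)%:E * cos_transform (P n) (X n) (- dot xi z)%R xi)
  (fun xi => (gauss_density s^-1 xi)%:E * cos_transform P' Z (- dot xi z)%R xi)
  (fun xi => 2%:E * (gauss_density s^-1 xi)%:E).
- by move=> n; apply: emeasurable_funM => //; exact: measurable_cos_transform.
- by apply: emeasurable_funM => //; exact: measurable_cos_transform.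
- by apply: aeW => xi _; apply: cvgeZl => //; exact: cvg_transform.
- by apply: integrableZl => //; exact: integrable_gauss_density.
- apply: aeW => xi n _; rewrite gee0_abs; last first.
    by rewrite mule_ge0// cos_transform_ge0.
  by rewrite muleC lee_wpmul2r// cos_transform_le2.
move=> h; apply: cvgeB => //; last exact: cvg_cst.
by rewrite fin_num_adde_defl.
Qed.

(** Fatou's lemma for the smoothed densities; smoothing at scale s changes the
    expectations of h by at most delta, a multiple of s. *)
Lemma expectation_liminf_lipschitz (h : 'rV[R]_d -> R) (L M : R) :
  (forall x, 0 <= h x)%R -> (forall x, h x <= M)%R -> (0 <= L)%R ->
  (forall x y, h x <= h y + L * `|x - y|)%R -> forall e, (0 < e)%R ->
  \forall n \near \oo,
    \int[P']_w (h (Z w))%:E <= \int[P n]_w (h (X n w))%:E + e%:E.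
Proof.
move=> h0 hM L0 hL e e0.
(* The error is paid twice, once on each side, and Fatou costs e / 3. *)
pose s := (e / 3 / (L *+ d.+1 + 1))%R.
have den0 : (0 < L *+ d.+1 + 1)%R by rewrite ltr_wpDl// mulrn_wge0.
have s0 : (0 < s)%R by rewrite !divr_gt0.
set delta := (L * (s *+ d.+1))%R.
have delta_le : (delta <= e / 3)%R.
  rewrite /delta mulrnAr -mulrnAl /s mulrCA ler_piMr ?divr_ge0 ?ltW//.
  by rewrite ltr_pdivrMr// mul1r ltrDl.
have delta0 : (0 <= delta)%R by rewrite mulr_ge0// mulrn_wge0// ltW.
have mh : measurable_fun setT h.
  by apply: continuous_measurable_rV; exact: lipschitz_continuous hL.
have [hZ1 hZ2] := integral_gauss_smoothing_lipschitz P' s0 mZ h0 hM L0 hL.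
have sE : \int[leb d]_z ((h z)%:E * smoothed_density s P' Z z) =
    \int[P']_w gauss_smoothing s h (Z w) by exact: integral_smoothed_density.
have mhs n : measurable_fun setT (fun z => (h z)%:E * smoothed_density s (P n) (X n) z).
  by apply: emeasurable_funM; [exact/measurable_EFinP|exact: measurable_smoothed_density].
have pos0 n z : 0 <= (h z)%:E * smoothed_density s (P n) (X n) z.
  rewrite mule_ge0 ?lee_fin//; apply: integral_ge0 => w _.
  by rewrite lee_fin gauss_density_ge0.
have fat := fatou (leb d) measurableT mhs (fun n x _ => pos0 n x).
have limE z : limn_einf (fun n => (h z)%:E * smoothed_density s (P n) (X n) z) =
    (h z)%:E * smoothed_density s P' Z z.
  have -> // := (cvg_limn_einf_sup (cvgeZl (y := (h z)%:E) _ (@cvg_smoothed_density s z s0))).1.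
rewrite [X in X <= _](_ : _ = \int[leb d]_z ((h z)%:E * smoothed_density s P' Z z)) in fat;
  last by apply: eq_integral => z _; exact: limE.
rewrite sE in fat.
have fin : \int[P']_w gauss_smoothing s h (Z w) \is a fin_num.
  rewrite ge0_fin_numE; last first.
    by apply: integral_ge0 => w _; exact: gauss_smoothing_ge0.
  apply: le_lt_trans hZ2 _.
  apply: (@le_lt_trans _ _ (M%:E + delta%:E)); last by rewrite -EFinD ltry.
  rewrite leeD2r// integral_probability_le//.
  - by apply/measurable_EFinP; exact: measurableT_comp mh mZ.
  - by move=> w; rewrite lee_fin.
  - by move=> w; rewrite lee_fin.
have e3 : (0 < e / 3)%R by rewrite divr_gt0.
have near1 := limn_einf_near_le fin fat e3.
near=> n.
have hn : \int[P']_w gauss_smoothing s h (Z w) <=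
    \int[leb d]_z ((h z)%:E * smoothed_density s (P n) (X n) z) + (e / 3)%:E.
  by near: n; exact: near1.
rewrite (integral_smoothed_density s (P n) (mX n) mh h0) in hn.
have [_ hX2] := integral_gauss_smoothing_lipschitz (P n) s0 (mX n) h0 hM L0 hL.
apply: le_trans hZ1 _; apply: (le_trans (leeD2r _ hn)).
apply: (le_trans (leeD2r _ (leeD2r _ hX2))).
apply: (@le_trans _ _ (\int[P n]_w (h (X n w))%:E + (delta + (e / 3 + delta))%:E)).
  by rewrite !EFinD !addeA.
apply: leeD2l; rewrite lee_fin; lra.
Unshelve. all: by end_near. Qed.

(** Continuous functions are increasing limits of Lipschitz ones, and a lower bound
    on expectations survives such limits. *)
Lemma expectation_liminf_continuous (g : 'rV[R]_d -> R) (M : R) :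
  (forall x, 0 <= g x)%R -> (forall x, g x <= M)%R -> continuous g ->
  forall e, (0 < e)%R -> \forall n \near \oo,
    \int[P']_w (g (Z w))%:E <= \int[P n]_w (g (X n w))%:E + e%:E.
Proof.
move=> g0 gM cg e e0.
pose gk (k : nat) := inf_convolution g k%:R.
have mg : measurable_fun setT g by exact: continuous_measurable_rV.
have gk0 k x : (0 <= gk k x)%R by exact: inf_convolution_ge0.
have gkg k x : (gk k x <= g x)%R by exact: inf_convolution_le_id.
have gkL k : forall x y, (gk k x <= gk k y + k%:R * `|x - y|)%R.
  by move=> x y; exact: inf_convolution_lipschitz.
have mgk k : measurable_fun setT (gk k).
  by apply: continuous_measurable_rV; exact: lipschitz_continuous (gkL k).
have mgkZ k : measurable_fun setT (fun w => (gk k (Z w))%:E).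
  by apply/measurable_EFinP; exact: measurableT_comp (mgk k) mZ.
have mgZ : measurable_fun setT (fun w => (g (Z w))%:E).
  by apply/measurable_EFinP; exact: measurableT_comp mg mZ.
have mgkX k n : measurable_fun setT (fun w => (gk k (X n w))%:E).
  by apply/measurable_EFinP; apply: measurableT_comp; [exact: mgk|exact: mX].
have mgX n : measurable_fun setT (fun w => (g (X n w))%:E).
  by apply/measurable_EFinP; apply: measurableT_comp; [exact: mg|exact: mX].
have [|||||_ _ lim] := @dominated_convergence _ _ _ P' setT measurableT
  (fun k w => (gk k (Z w))%:E) (fun w => (g (Z w))%:E) (fun w => M%:E) => //.
- apply: aeW => w _; apply: cvg_EFin; first exact: nearW.
  exact: (cvg_inf_convolution g0 cg).
- exact: finite_measure_integrable_cst.
- by apply: aeW => w k _; rewrite lee_fin ger0_norm// (le_trans (gkg _ _)).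
have fing : \int[P']_w (g (Z w))%:E \is a fin_num.
  rewrite ge0_fin_numE; last by apply: integral_ge0 => w _; rewrite lee_fin.
  by apply: le_lt_trans (integral_probability_le P' mgZ _ _) (ltry M) => w; rewrite lee_fin.
have e2 : (0 < e / 2)%R by rewrite divr_gt0.
have /(limn_einf_near_le fing)/(_ e2)[k _ hk] :
    \int[P']_w (g (Z w))%:E <= limn_einf (fun k => \int[P']_w (gk k (Z w))%:E).
  by rewrite (cvg_limn_einf_sup lim).1.
have := hk k (leqnn k) => {}hk.
near=> n; apply: (le_trans hk).
have : \int[P']_w (gk k (Z w))%:E <= \int[P n]_w (gk k (X n w))%:E + (e / 2)%:E.
  near: n; apply: (@expectation_liminf_lipschitz (gk k) k%:R M) => //.
  by move=> x; exact: le_trans (gkg _ _) (gM _).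
move=> h; apply: (le_trans (leeD2r _ h)).
rewrite -addeA -EFinD -splitr leeD2r//.
apply: ge0_le_integral => //.
- by move=> w _; rewrite lee_fin.
- by move=> w _; rewrite lee_fin.
Unshelve. all: by end_near. Qed.

(** The one-sided bound, applied to the nonnegative functions M + f and M - f. *)
Theorem levy_continuity (f : 'rV[R]_d -> R) (M : R) :
  continuous f -> (forall x, `|f x| <= M)%R ->
  \int[P n]_w (f (X n w))%:E @[n --> \oo] --> \int[P']_w (f (Z w))%:E.
Proof.
move=> cf fM.
have mf : measurable_fun setT f by exact: continuous_measurable_rV.
have intf d0 (T : measurableType d0) (Q : probability T R) (Y : T -> 'rV[R]_d) :
    measurable_fun setT Y -> Q.-integrable setT (EFin \o (fun w => f (Y w))).
  move=> mY; apply: (@integrable_dominated _ _ _ _ _ (fun=> M)) => //.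
    exact: measurableT_comp mf mY.
  exact: finite_measure_integrable_cst.
have E (c : R) d0 (T : measurableType d0) (Q : probability T R) (Y : T -> 'rV[R]_d) :
    measurable_fun setT Y ->
    \int[Q]_w (M + c * f (Y w))%:E = (M + c * \int[Q]_w (f (Y w)))%:E.
  move=> mY; have iY := intf _ _ Q _ mY.
  have icY := integrable_realZl c iY.
  have iM : Q.-integrable setT (EFin \o (fun w : T => M)).
    exact: finite_measure_integrable_cst.
  rewrite -[LHS]fineK; last exact: (integrable_fin_num _ (integrable_realD iM icY)).
  congr EFin; rewrite -/(Rintegral _ _ _) RintegralD// RintegralZl//; congr (_ + _)%R.
  by rewrite /Rintegral integral_probability_cst.
have fE d0 (T : measurableType d0) (Q : probability T R) (Y : T -> 'rV[R]_d) :
    measurable_fun setT Y -> \int[Q]_w (f (Y w))%:E = (\int[Q]_w (f (Y w)))%:E.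
  by move=> mY; rewrite fineK//; exact: (integrable_fin_num _ (intf _ _ Q _ mY)).
have lower (c : R) : (`|c| <= 1)%R -> forall e, (0 < e)%R -> \forall n \near \oo,
    (c * \int[P']_w (f (Z w)) <= c * \int[P n]_w (f (X n w)) + e)%R.
  move=> c1 e e0; have cfM x : (`|c * f x| <= M)%R.
    by rewrite normrM -[leRHS]mul1r ler_pM.
  have := @expectation_liminf_continuous (fun x => M + c * f x)%R (M + M)%R.
  move=> /(_ _ _ _ e e0)/wrap[||| near1].
  - by move=> x; have := cfM x; rewrite ler_norml; lra.
  - by move=> x; have := cfM x; rewrite ler_norml; lra.
  - move=> x; apply: (@continuous_comp _ _ _ f (fun y : R => M + c * y)%R x (cf x)).
    by apply: cvgD; [exact: cvg_cst|apply: cvgM; [exact: cvg_cst|exact: cvg_id]].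
  near=> n; have : \int[P']_w (M + c * f (Z w))%:E <=
     \int[P n]_w (M + c * f (X n w))%:E + e%:E by near: n; exact: near1.
  by rewrite !E// -EFinD lee_fin -addrA lerD2l.
rewrite fE//; under eq_fun do rewrite fE//.
apply: cvg_EFin; first exact: nearW.
apply/cvgrPdist_le => e e0; near=> n.
have : (1 * \int[P']_w (f (Z w)) <= 1 * \int[P n]_w (f (X n w)) + e)%R.
  by near: n; apply: lower => //; rewrite normr1.
have : (-1 * \int[P']_w (f (Z w)) <= -1 * \int[P n]_w (f (X n w)) + e)%R.
  by near: n; apply: lower => //; rewrite normrN normr1.
rewrite /= ler_norml; set a := Rintegral P' _ _; set b := Rintegral (P n) _ _; lra.
Unshelve. all: by end_near. Qed.

End levy_continuity.

(** * Independent signed sums *)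

Section bounded_integrals.
Context {R : realType} {d0} {Om : measurableType d0} (P : probability Om R).

Lemma integrable_bounded (f : Om -> R) (M : R) :
  measurable_fun setT f -> (forall w, `|f w| <= M) -> P.-integrable setT (EFin \o f).
Proof.
move=> mf fM; apply: (integrable_dominated mf fM).
exact: finite_measure_integrable_cst.
Qed.

Lemma Rintegral_probability_cst (c : R) : \int[P]_w c = c.
Proof. by rewrite /Rintegral integral_probability_cst. Qed.

Lemma Rintegral_indic_mul (f : Om -> R) (D : set Om) :
  \int[P]_(w in D) f w = \int[P]_w (\1_D w * f w).
Proof.
rewrite Rintegral_mkcond; apply: eq_Rintegral => w _.
by rewrite patchE indicE; case: ifP => _; rewrite ?mul1r ?mul0r.
Qed.

(** A bounded weight w is independent of Y as soon as it is so on the events of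
    Y; adding constants to w and to the test function makes both nonnegative, so
    that the standard machine applies. *)
Lemma Rintegral_weighted_independent dV (V : measurableType dV)
    (w : Om -> R) (Y : Om -> V) (k M M' : R) (g : V -> R) :
  measurable_fun setT w -> measurable_fun setT Y -> measurable_fun setT g ->
  (forall x, `|w x| <= M) -> (forall v, `|g v| <= M') ->
  (forall D, measurable D -> \int[P]_(x in Y @^-1` D) w x = k * fine (P (Y @^-1` D))) ->
  \int[P]_x (w x * g (Y x)) = k * \int[P]_x g (Y x).
Proof.
move=> mw mY mg wM gM h.
have iw := integrable_bounded mw wM.
have igY : P.-integrable setT (EFin \o (fun x => g (Y x))).
  by apply: (@integrable_bounded _ M') => //; exact: measurableT_comp mg mY.
have iwg : P.-integrable setT (EFin \o (fun x => w x * g (Y x))).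
  apply: (@integrable_bounded _ (M * M')).
    by apply: measurable_funM => //; exact: measurableT_comp mg mY.
  by move=> x; rewrite normrM ler_pM.
have icst c : P.-integrable setT (EFin \o (fun=> c : R)).
  exact: finite_measure_integrable_cst.
have kE : \int[P]_x w x = k.
  by have := h setT measurableT; rewrite preimage_setT probability_setT mulr1.
have kM : 0 <= k + M.
  rewrite -kE -[X in _ + X]Rintegral_probability_cst -RintegralD//.
  by apply: Rintegral_ge0 => x _; have := wM x; rewrite ler_norml; lra.
have wM0 x : 0 <= w x + M by have := wM x; rewrite ler_norml; lra.
have gM0 v : 0 <= g v + M' by have := gM v; rewrite ler_norml; lra.
have mwM : measurable_fun setT (fun x => w x + M) by exact: measurable_funD.
have mYD D : measurable D -> measurable (Y @^-1` D).
  by move=> mD; rewrite -[X in measurable X]setTI; exact: mY.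
have := @eq_integral_weighted R _ V _ Om _ Om P P (fun x => w x + M) (fun=> k + M)
  Y Y (fun v => (g v + M')%:E) mwM (measurable_cst _) wM0 (fun=> kM) mY mY.
move=> /(_ _ _ _)/wrap[|||].
- by apply/measurable_EFinP; exact: measurable_funD.
- by move=> v; rewrite lee_fin.
- move=> D mD; have mYD' := mYD D mD.
  have sub (f : Om -> R) : P.-integrable setT (EFin \o f) -> P.-integrable (Y @^-1` D) (EFin \o f).
    by apply: integrableS.
  have i1 := sub _ iw; have i2 := sub _ (icst M).
  rewrite -[LHS]fineK; last exact: (integrable_fin_num _ (integrableD mYD' i1 i2)).
  rewrite -/(Rintegral _ _ _) RintegralD// h// Rintegral_cst// -mulrDl.
  by rewrite integral_cst// EFinM fineK// fin_num_measure.
move=> H.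
have : \int[P]_x ((w x + M) * (g (Y x) + M')) = \int[P]_x ((k + M) * (g (Y x) + M')).
  by rewrite /Rintegral; congr fine; rewrite -H; apply: eq_integral.
have E1 : \int[P]_x ((w x + M) * (g (Y x) + M')) =
    \int[P]_x (w x * g (Y x)) + (M' * k + (M * \int[P]_x g (Y x) + M * M')).
  transitivity (\int[P]_x (w x * g (Y x) + (M' * w x + (M * g (Y x) + M * M')))).
    by apply: eq_Rintegral => x _; ring.
  have i1 := integrable_realZl M' iw; have i2 := integrable_realZl M igY.
  have i3 := integrable_realD i2 (icst (M * M')).
  rewrite RintegralD//; last exact: integrable_realD.
  by rewrite RintegralD// RintegralD// !RintegralZl// kE Rintegral_probability_cst.
have E2 : \int[P]_x ((k + M) * (g (Y x) + M')) = (k + M) * (\int[P]_x g (Y x) + M').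
  rewrite RintegralZl//; last exact: integrable_realD igY (icst M').
  by rewrite RintegralD// Rintegral_probability_cst.
rewrite E1 E2 => H'; apply/eqP; rewrite -subr_eq0; apply/eqP.
transitivity ((\int[P]_x (w x * g (Y x)) + (M' * k + (M * \int[P]_x g (Y x) + M * M')))
  - (k + M) * (\int[P]_x g (Y x) + M')); first by ring.
by rewrite H' subrr.
Qed.

End bounded_integrals.

Section independent_signed_sum.
Context {R : realType} {d0} {Om : measurableType d0} (P : probability Om R).
Context {d : nat} (NF : set_system Om) (eps : nat -> Om -> R) (Y : nat -> Om -> 'rV[R]_d).
Arguments eps : clear implicits.
Arguments Y : clear implicits.

Let F (i : option (nat + nat)) : set_system Om :=
  match i with
  | None => NF
  | Some (inl j) => sigma_rv (eps j)
  | Some (inr j) => sigma_rv (Y j)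
  end.

Hypothesis mNF : forall A, NF A -> measurable A.
Hypothesis meps : forall j, measurable_fun setT (eps j).
Hypothesis mY : forall j, measurable_fun setT (Y j).
Arguments meps : clear implicits.
Arguments mY : clear implicits.
Hypothesis indep : mutually_independent P F.

Let mF i A : F i A -> measurable A.
Proof.
case: i => [[j|j]|] /=; last exact: mNF.
- by move=> [B mB <-]; exact: meps.
- by move=> [B mB <-]; exact: mY.
Qed.

Let fut (k : nat) (i : option (nat + nat)) : bool :=
  match i with
  | None => true
  | Some (inl j) => (k <= j)%N
  | Some (inr j) => (k <= j)%N
  end.

(* Finite intersections of events of N and of the variables numbered from k on:
   the events by which the induction on k may be weighted. *)
Let future (k : nat) (E : set Om) := exists s A, [/\ uniq s,
  forall i, i \in s -> F i (A i) /\ fut k i & E = \bigcap_(i in [set` s]) A i].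

Let future_measurable k E : future k E -> measurable E.
Proof.
move=> [s [A [us sA ->]]]; apply: fin_bigcap_measurable.
  exact: finite_seq.
by move=> i /= /sA[/mF].
Qed.

Let future_split k E B D : future k.+1 E -> sigma_rv (eps k) B -> sigma_rv (Y k) D ->
  future k (E `&` B `&` D) /\
  fine (P (E `&` B `&` D)) = fine (P E) * fine (P B) * fine (P D).
Proof.
move=> [s [A [us sA ->]]] hB hD.
pose A' i := if i == Some (inl k) then B else if i == Some (inr k) then D else A i.
have A'inl : A' (Some (inl k)) = B by rewrite /A' eqxx.
have A'inr : A' (Some (inr k)) = D by rewrite /A' /= eqxx.
have ninl : Some (inl k) \notin s.
  by apply/negP => /sA[_ /=]; rewrite ltnn.
have ninr : Some (inr k) \notin s.
  by apply/negP => /sA[_ /=]; rewrite ltnn.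
have A's i : i \in s -> A' i = A i.
  move=> si; rewrite /A'; case: eqP => [e|_]; first by rewrite -e si in ninl.
  by case: eqP => [e|_] //; rewrite -e si in ninr.
have us' : uniq [:: Some (inl k), Some (inr k) & s].
  by rewrite /= inE negb_or ninl ninr us.
have EA' : (\bigcap_(i in [set` s]) A i) `&` B `&` D =
    \bigcap_(i in [set` [:: Some (inl k), Some (inr k) & s]]) A' i.
  apply/seteqP; split => w.
  - move=> [[wA wB] wD] i /=; rewrite !inE => /or3P[/eqP ->|/eqP ->|si].
    + by rewrite A'inl.
    + by rewrite A'inr.
    + by rewrite A's//; exact: wA.
  - move=> h; split; [split|].
    + by move=> i /= si; rewrite -A's//; apply: h; rewrite /= !inE si !orbT.
    + by rewrite -A'inl; apply: h; rewrite /= inE eqxx.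
    + by rewrite -A'inr; apply: h; rewrite /= !inE eqxx orbT.
have FA' i : i \in [:: Some (inl k), Some (inr k) & s] -> F i (A' i) /\ fut k i.
  rewrite !inE => /or3P[/eqP ->|/eqP ->|si].
  - by rewrite A'inl/= leqnn.
  - by rewrite A'inr/= leqnn.
  - rewrite A's//; have [Fi fi] := sA i si; split => //.
    by case: i fi {si Fi} => [[j|j]|]//=; exact: ltnW.
split; first by exists [:: Some (inl k), Some (inr k) & s], A'.
rewrite EA' indep//; last by move=> i /FA'[].
rewrite indep//; last by move=> i /sA[].
rewrite !big_cons /= A'inl A'inr mulrA mulrC mulrA; congr (_ * _ * _).
by apply: eq_big_seq => i /A's ->.
Qed.

Variables (p q : R) (xi : 'rV[R]_d) (phi : R).
Hypothesis pq1 : p + q = 1.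
Hypothesis eps_law : forall j, P [set w | eps j w = 1] = p%:E /\
                               P [set w | eps j w = -1] = q%:E.
Hypothesis Y_cos : forall j, \int[P]_w cos (dot xi (Y j w)) = phi.
Hypothesis Y_sin : forall j, \int[P]_w sin (dot xi (Y j w)) = 0.

Definition signed_sum (k : nat) (w : Om) : R :=
  \sum_(j < k) eps j w * dot xi (Y j w).

Lemma measurable_signed_sum k : measurable_fun setT (signed_sum k).
Proof.
apply: measurable_sum => j; apply: measurable_funM; first exact: meps.
exact: measurableT_comp (measurable_dot xi) (mY j).
Qed.

Let sign_event k c : sigma_rv (eps k) [set w | eps k w = c].
Proof.
by exists [set c]; [exact: measurable_set1|rewrite setTI; apply/seteqP; split].
Qed.

Let meas_sign k c : measurable [set w | eps k w = c].
Proof. exact: (@mF (Some (inl k))) (sign_event k c). Qed.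

Let mcos_sum (a : R) k : measurable_fun setT (fun w => cos (a + signed_sum k w)).
Proof.
apply: (measurableT_comp measurable_cos).
by apply: measurable_funD => //; exact: measurable_signed_sum.
Qed.

(* The sign is only almost surely 1 or -1, hence the null set. *)
Let sign_split k (E : set Om) (f : Om -> R) (M : R) : measurable E ->
  measurable_fun setT f -> (forall w, `|f w| <= M) ->
  \int[P]_w (\1_E w * f w) =
  \int[P]_w (\1_(E `&` [set w | eps k w = 1]) w * f w) +
  \int[P]_w (\1_(E `&` [set w | eps k w = -1]) w * f w).
Proof.
move=> mE mf fM; have [hp hq] := eps_law k.
set B1 := [set w | eps k w = 1]; set B2 := [set w | eps k w = -1].
have mB1 : measurable B1 by exact: meas_sign.
have mB2 : measurable B2 by exact: meas_sign.
have hp' : P B1 = p%:E by exact: hp.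
have hq' : P B2 = q%:E by exact: hq.
have dis w : B1 w -> B2 w -> False.
  move=> w1 w2; have /eqP : (1 : R) = -1 by exact: etrans (esym w1) w2.
  by rewrite -subr_eq0 opprK paddr_eq0// oner_eq0.
have i1 D : measurable D -> P.-integrable setT (EFin \o (fun w => \1_D w * f w)).
  move=> mD; apply: (@integrable_bounded _ _ _ _ _ M).
    by apply: measurable_funM => //; exact: measurable_indic.
  move=> w; rewrite normrM -[leRHS]mul1r ler_pM//.
  by rewrite indicE; case: (_ \in _); rewrite ?normr1 ?normr0.
have mEB1 : measurable (E `&` B1) by exact: measurableI.
have mEB2 : measurable (E `&` B2) by exact: measurableI.
rewrite -RintegralD//; try exact: i1.
congr fine; apply: ae_eq_integral => //.
- by apply/measurable_EFinP; apply: measurable_funM => //; exact: measurable_indic.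
- by apply/measurable_EFinP; apply: measurable_funD;
    apply: measurable_funM => //; exact: measurable_indic.
exists (~` (B1 `|` B2)); split.
- by apply: measurableC; exact: measurableU.
- have mU : measurable (B1 `|` B2) by exact: measurableU.
  transitivity (1 - P (B1 `|` B2))%E; first exact: (probability_setC P mU).
  have -> : P (B1 `|` B2) = (P B1 + P B2)%E.
    by apply: measureU => //; apply/seteqP; split => // w [w1]; exact: dis.
  by rewrite hp' hq' -EFinD pq1 subrr.
- move=> w /= hw [w1|w2]; apply: hw => _.
  + congr EFin; rewrite !indicE.
    have w2 : w \notin B2 by apply/negP; rewrite inE => w2; exact: dis w1 w2.
    by rewrite !in_setI (mem_set w1) (negbTE w2) andbT andbF mul0r addr0.
  + congr EFin; rewrite !indicE.
    have w1 : w \notin B1 by apply/negP; rewrite inE => w1; exact: dis w1 w2.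
    by rewrite !in_setI (mem_set w2) (negbTE w1) andbT andbF mul0r add0r.
Qed.

(** Each summand multiplies the transform of the partial sum by phi, on every
    event of the variables that are still to come. *)
Let cos_signed_sum_future k E a : future k E ->
  \int[P]_w (\1_E w * cos (a + signed_sum k w)) = fine (P E) * (cos a * phi ^+ k).
Proof.
elim: k E a => [|k IH] E a futE.
  have mE := future_measurable futE.
  under eq_Rintegral do rewrite /signed_sum big_ord0 addr0 mulrC.
  rewrite RintegralZl//.
    rewrite expr0 mulr1 mulrC; congr (_ * _).
    by rewrite /Rintegral integral_indic// setIT.
  by apply: (@integrable_bounded _ _ _ _ _ 1) => // w;
    rewrite indicE; case: (_ \in _); rewrite ?normr1 ?normr0.
have mE := future_measurable futE.
rewrite (@sign_split k _ _ 1)//; last first.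
- by move=> w; exact: norm_cos_le1.
have half c : c = 1 \/ c = -1 ->
    \int[P]_w (\1_(E `&` [set w | eps k w = c]) w * cos (a + signed_sum k.+1 w)) =
    fine (P E) * fine (P [set w | eps k w = c]) * (cos a * phi ^+ k.+1).
  move=> c1; set B := [set w | eps k w = c].
  have mEB : measurable (E `&` B) by apply: measurableI => //; exact: meas_sign.
  have key b : forall D : set 'rV[R]_d, measurable D ->
      \int[P]_(w in Y k @^-1` D) (\1_(E `&` B) w * cos (b + signed_sum k w)) =
      fine (P E) * fine (P B) * (cos b * phi ^+ k) * fine (P (Y k @^-1` D)).
    move=> D mD.
    have [futEB PEB] := future_split futE (sign_event k c)
      (ex_intro2 _ _ D mD (setTI _) : sigma_rv (Y k) (Y k @^-1` D)).
    transitivity (\int[P]_w (\1_(E `&` B `&` Y k @^-1` D) w * cos (b + signed_sum k w))).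
      rewrite Rintegral_indic_mul; apply: eq_Rintegral => w _.
      by rewrite [in RHS]indicI /=; ring.
    by rewrite (IH _ b futEB) PEB -/B; ring.
  have bnd b w : `|\1_(E `&` B) w * cos (b + signed_sum k w)| <= 1.
    rewrite normrM -[leRHS]mul1r ler_pM ?norm_cos_le1//.
    by rewrite indicE; case: (_ \in _); rewrite ?normr1 ?normr0.
  have mw b : measurable_fun setT (fun w => \1_(E `&` B) w * cos (b + signed_sum k w)).
    by apply: measurable_funM => //; exact: measurable_indic.
  (* cos (a - pi/2 + t) = sin (a + t): the sine term of the addition formula is
     again a cosine with a shifted phase, to which the induction applies. *)
  have H1 := Rintegral_weighted_independent (mw a) (mY k) (measurable_cos_dot xi) (bnd a)
    (fun v => norm_cos_le1 (dot xi v)) (key a).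
  have H2 := Rintegral_weighted_independent (mw (a - pi / 2)) (mY k) (measurable_sin_dot xi) (bnd (a - pi / 2))
    (fun v => norm_sin_le1 (dot xi v)) (key (a - pi / 2)).
  rewrite Y_cos in H1; rewrite Y_sin mulr0 in H2.
  have ib b (g : 'rV[R]_d -> R) : measurable_fun setT g -> (forall v, `|g v| <= 1) ->
     P.-integrable setT (EFin \o (fun w => \1_(E `&` B) w * cos (b + signed_sum k w) * g (Y k w))).
    move=> mg g1; apply: (@integrable_bounded _ _ _ _ _ 1).
      by apply: measurable_funM => //; exact: measurableT_comp mg (mY k).
    by move=> w; rewrite normrM -[leRHS]mul1r ler_pM.
  have isin : P.-integrable setT (EFin \o (fun w =>
      \1_(E `&` B) w * cos (a - pi / 2 + signed_sum k w) * sin (dot xi (Y k w)))).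
    by apply: (ib _ (fun v => sin (dot xi v))) => [|v]; [exact: measurable_sin_dot|exact: norm_sin_le1].
  transitivity (\int[P]_w (\1_(E `&` B) w * cos (a + signed_sum k w) * cos (dot xi (Y k w)) -
     c * (\1_(E `&` B) w * cos (a - pi / 2 + signed_sum k w) * sin (dot xi (Y k w))))).
    apply: eq_Rintegral => w _; rewrite indicE.
    have [wEB|_] := boolP (w \in E `&` B); last by rewrite !mul0r mulr0 subr0.
    move: wEB; rewrite inE => -[_ /= ek].
    rewrite !mul1r /signed_sum big_ord_recr /= ek -/(signed_sum k w) addrA.
    have -> : cos (a - pi / 2 + signed_sum k w) = sin (a + signed_sum k w).
      by rewrite addrAC cosB cos_pihalf sin_pihalf mulr0 add0r mulr1.
    rewrite (cosD (a + signed_sum k w)); case: c1 => ->; first by rewrite !mul1r.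
    by rewrite !mulN1r cosN sinN mulrN !opprK.
  rewrite RintegralB//; last 2 first.
  - by apply: (ib _ (fun v => cos (dot xi v))) => [|v]; [exact: measurable_cos_dot|exact: norm_cos_le1].
  - exact: integrable_realZl.
  rewrite RintegralZl//.
  by rewrite H1 H2 mulr0 subr0 exprSr !mulrA.
rewrite !half; [|by right|by left].
have [-> ->] := eps_law k.
by rewrite /= -mulrDl -mulrDr pq1 mulr1.
Qed.

Lemma Rintegral_cos_signed_sum (E : set Om) k a : NF E ->
  \int[P]_w (\1_E w * cos (a + signed_sum k w)) = fine (P E) * (cos a * phi ^+ k).
Proof.
move=> NE; apply: cos_signed_sum_future.
exists [:: None], (fun=> E); split => //.
- by move=> i; rewrite inE => /eqP ->.
- apply/seteqP; split => w; first by move=> h i.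
  by move=> h; apply: (h None); rewrite /= inE.
Qed.

End independent_signed_sum.

(** * Compound Poisson sums *)

Section poisson_compound.
Context {R : realType} {d0} {Om : measurableType d0} (P : probability Om R).
Context {d : nat} (NF : set_system Om) (Nt : Om -> nat).
Context (eps : nat -> Om -> R) (Y : nat -> Om -> 'rV[R]_d).
Arguments eps : clear implicits.
Arguments Y : clear implicits.
Hypothesis mNt : measurable_fun setT Nt.
Hypothesis meps : forall j, measurable_fun setT (eps j).
Hypothesis mY : forall j, measurable_fun setT (Y j).
Arguments meps : clear implicits.
Arguments mY : clear implicits.

Definition compound_sum (w : Om) : 'rV[R]_d := \sum_(j < (Nt w).+1) eps j w *: Y j w.

Lemma dot_sumr n (u : 'rV[R]_d) (f : 'I_n -> 'rV[R]_d) :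
  dot u (\sum_(j < n) f j) = \sum_(j < n) dot u (f j).
Proof.
elim: n f => [|n IH] f; first by rewrite !big_ord0 dot0r.
by rewrite !big_ord_recl dotDr IH.
Qed.

Let Nt_event n : measurable [set w | Nt w = n].
Proof.
rewrite (_ : [set w | _] = Nt @^-1` [set n]); last by apply/seteqP; split.
by rewrite -[X in measurable X]setTI; exact: mNt.
Qed.

Lemma measurable_compound_sum : measurable_fun setT compound_sum.
Proof.
apply: measurable_fun_matrix => i j _ B mB; rewrite setTI.
pose S n w := \sum_(k < n) eps k w * Y k w i j.
have mS n : measurable_fun setT (S n).
  apply: measurable_sum => k; apply: measurable_funM; first exact: meps.
  exact: measurableT_comp (measurable_entry i j) (mY k).
rewrite (_ : _ @^-1` B = \bigcup_n ([set w | Nt w = n] `&` S n.+1 @^-1` B)).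
  apply: bigcupT_measurable => n; apply: measurableI => //.
  by rewrite -[X in measurable X]setTI; exact: mS.
have E w : compound_sum w i j = S (Nt w).+1 w.
  by rewrite /compound_sum summxE; apply: eq_bigr => k _; rewrite mxE.
apply/seteqP; split => w /=; rewrite E; first by move=> h; exists (Nt w).
by move=> [n _ [/= <-]].
Qed.

Variables (p q m : R) (xi : 'rV[R]_d) (phi : R).
Hypothesis m0 : 0 < m.
Hypothesis mNF : forall A, NF A -> measurable A.
Hypothesis NtNF : forall n, NF [set w | Nt w = n].
Hypothesis indep : mutually_independent P (fun i : option (nat + nat) =>
  match i with
  | None => NF
  | Some (inl j) => sigma_rv (eps j)
  | Some (inr j) => sigma_rv (Y j)
  end).
Hypothesis pq1 : p + q = 1.
Hypothesis Nt_law : forall n, P [set w | Nt w = n] = (poisson_pmf m n)%:E.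
Hypothesis eps_law : forall j, P [set w | eps j w = 1] = p%:E /\
                               P [set w | eps j w = -1] = q%:E.
Hypothesis Y_cos : forall j, \int[P]_w cos (dot xi (Y j w)) = phi.
Hypothesis Y_sin : forall j, \int[P]_w sin (dot xi (Y j w)) = 0.

(** The transforms of the partial sums are averaged over the values of the Poisson
    variable; there is one summand more than that value, whence the factor phi. *)
Lemma cos_transform_compound_sum a :
  cos_transform P compound_sum a xi =
  (1 + cos a * (phi * expR (- (m * (1 - phi)))))%:E.
Proof.
rewrite /cos_transform.
have c0 (x : R) : 0 <= 1 + cos x by have := cos_geN1 x; lra.
have dotE w : dot xi (compound_sum w) = signed_sum eps Y xi (Nt w).+1 w.
  by rewrite dot_sumr; apply: eq_bigr => j _; rewrite dotZr.
pose f w := (1 + cos (a + dot xi (compound_sum w)))%:E.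
have mf : measurable_fun setT f.
  apply/measurable_EFinP; apply: measurable_funD => //.
  apply: (measurableT_comp measurable_cos); apply: measurable_funD => //.
  exact: measurableT_comp (measurable_dot xi) measurable_compound_sum.
have U : [set: Om] = \bigcup_n [set w | Nt w = n].
  by apply/seteqP; split => w // _; exists (Nt w).
rewrite -/f U ge0_integral_bigcup//; last 2 first.
- by rewrite -U.
- by apply/trivIsetP => i j _ _ /eqP ij; apply/seteqP; split => // w [/= -> ].
pose c n := poisson_pmf m n * (1 + cos a * phi ^+ n.+1).
have cE n : (\int[P]_(w in [set w | Nt w = n]) f w = (c n)%:E)%E.
  set E := [set w | Nt w = n].
  transitivity (\int[P]_w (\1_E w * (1 + cos (a + signed_sum eps Y xi n.+1 w)))%:E)%E.
    rewrite integral_mkcond; apply: eq_integral => w _.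
    rewrite patchE indicE; case: ifP => [|_]; last by rewrite mul0r.
    by rewrite inE /E/= => Nw; rewrite /f mul1r dotE Nw.
  have mE : measurable E by exact: Nt_event.
  have b1 w : `|\1_E w : R| <= 1.
    by rewrite indicE; case: (_ \in _); rewrite ?normr1 ?normr0.
  have i1 : P.-integrable setT (EFin \o (\1_E : Om -> R)).
    by apply: (integrable_bounded P _ b1); exact: measurable_indic.
  have ms := @measurable_signed_sum _ _ _ _ eps Y meps mY xi n.+1.
  have i2 : P.-integrable setT (EFin \o (fun w => \1_E w * cos (a + signed_sum eps Y xi n.+1 w))).
    apply: (@integrable_bounded _ _ _ _ _ 1).
      apply: measurable_funM; first exact: measurable_indic.
      by apply: (measurableT_comp measurable_cos); exact: measurable_funD.
    by move=> w; rewrite normrM -[leRHS]mul1r ler_pM// norm_cos_le1.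
  under eq_integral do rewrite mulrDr mulr1.
  rewrite -[LHS]fineK; last exact: (integrable_fin_num _ (integrable_realD i1 i2)).
  rewrite -/(Rintegral _ _ _) RintegralD//.
  rewrite (Rintegral_cos_signed_sum mNF meps mY indep pq1 eps_law Y_cos Y_sin _ _ (NtNF n)).
  have PE : P E = (poisson_pmf m n)%:E by exact: Nt_law.
  rewrite {1}/Rintegral integral_indic//= setIT PE /c/=.
  by congr EFin; ring.
rewrite (eq_eseriesr (fun n _ => cE n)).
apply/cvg_lim => //.
(* The partial sums of the Poisson series are those of two exponential series,
   with parameters m and m phi. *)
have partial k : (\sum_(0 <= i < k) (c i)%:E)%E =
    (expR (- m) * (series (exp_coeff m) k + cos a * phi * series (exp_coeff (m * phi)) k))%:E.
  rewrite sumEFin; congr EFin; rewrite /series/= !mulr_sumr -big_split/= mulr_sumr.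
  apply: eq_bigr => i _; rewrite /c /poisson_pmf m0 /exp_coeff/= exprMn exprS.
  ring.
rewrite (_ : (fun _ => _) = (fun k => (expR (- m) * (series (exp_coeff m) k +
    cos a * phi * series (exp_coeff (m * phi)) k))%:E)); last exact/funext.
apply: cvg_EFin; first exact: nearW.
have -> : 1 + cos a * (phi * expR (- (m * (1 - phi)))) =
    expR (- m) * (expR m + cos a * phi * expR (m * phi)).
  have e1 : expR (- m) * expR m = 1 by rewrite -expRD addNr expR0.
  have -> : expR (- (m * (1 - phi))) = expR (- m) * expR (m * phi).
    by rewrite -expRD; congr expR; ring.
  by rewrite -[X in X + _]e1; ring.
apply: cvgM; first exact: cvg_cst.
by apply: cvgD; [|apply: cvgM; first exact: cvg_cst]; exact: is_cvg_series_exp_coeff.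
Qed.

End poisson_compound.

(** * Gaussian vectors with random variance *)

Section random_variance_law.
Context {R : realType} {d : nat}.
Variables (alpha g : R).
Hypothesis g0 : 0 < g.
Let mu := @lebesgue_measure R.
Let half : set R := `]0, +oo[%classic.
Let pdf := @recip_gamma_pdf R alpha.

Let mhalf : measurable half. Proof. exact: measurable_itv. Qed.

Let halfE x : half x = (0 < x) :> Prop.
Proof. by rewrite /half/= in_itv/= andbT. Qed.

Lemma Gamma_ge0 (a : R) : 0 <= Gamma a.
Proof.
by apply: Rintegral_ge0 => x _; rewrite mulr_ge0 ?powR_ge0 ?expR_ge0.
Qed.

Lemma recip_gamma_pdf_ge0 x : 0 <= recip_gamma_pdf alpha x.
Proof. by rewrite mulr_ge0 ?expR_ge0// divr_ge0 ?powR_ge0// Gamma_ge0. Qed.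

(* On the half-line these are the densities; powers in place of inverses make them
   measurable functions on the whole line. *)
Let pdf' (x : R) := x `^ (- alpha - 1) / Gamma alpha * expR (- x `^ (- 1)).

Let gd' (p : R * 'rV[R]_d) : R :=
  (Num.sqrt (Num.sqrt (g / 2 * p.1) ^+ 2 * pi *+ 2) `^ (- 1)) ^+ d *
  expR (- (dot p.2 p.2 * (Num.sqrt (g / 2 * p.1) ^+ 2 *+ 2) `^ (- 1))).

Let mpdf' : measurable_fun setT pdf'.
Proof.
apply: measurable_funM.
  by apply: measurable_funM => //; exact: measurable_powR.
apply: (measurableT_comp (@measurable_expR R)); apply: measurable_funN.
exact: measurable_powR.
Qed.

Let msqrt : measurable_fun setT (@Num.sqrt R).
Proof. by apply: continuous_measurable_fun; exact: sqrt_continuous. Qed.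

Let mgd' : measurable_fun setT gd'.
Proof.
have ms : measurable_fun setT (fun p : R * 'rV[R]_d => Num.sqrt (g / 2 * p.1) ^+ 2).
  apply: measurable_funX; apply: (measurableT_comp msqrt).
  by apply: measurable_funM => //; exact: measurable_fst.
apply: measurable_funM.
  apply: measurable_funX; apply: (measurableT_comp (@measurable_powR R (-1))).
  apply: (measurableT_comp msqrt).
  have -> : (fun p : R * 'rV[R]_d => Num.sqrt (g / 2 * p.1) ^+ 2 * pi *+ 2) =
    (fun p => Num.sqrt (g / 2 * p.1) ^+ 2 * (pi *+ 2)).
    by apply/funext => p; rewrite [RHS]mulrnAr.
  by apply: measurable_funM.
apply: (measurableT_comp (@measurable_expR R)); apply: measurable_funN.
apply: measurable_funM.
  exact: measurableT_comp (@measurable_dot_self R d) measurable_snd.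
apply: (measurableT_comp (@measurable_powR R (-1))).
have -> : (fun p : R * 'rV[R]_d => Num.sqrt (g / 2 * p.1) ^+ 2 *+ 2) =
    (fun p => Num.sqrt (g / 2 * p.1) ^+ 2 * 2).
  by apply/funext => p; rewrite mulr_natr.
by apply: measurable_funM.
Qed.

Let sd (x : R) : R := Num.sqrt (g / 2 * x).

Let sd_gt0 x : 0 < x -> 0 < sd x.
Proof. by move=> x0; rewrite sqrtr_gt0 mulr_gt0// divr_gt0. Qed.

Let gd'E x v : 0 < x -> gd' (x, v) = gauss_density (sd x) v.
Proof.
move=> x0; rewrite gauss_densityE ?sd_gt0// /gd' /= /normal_peak -/(sd x).
by rewrite !powR_inv1// mulrn_wge0// sqr_ge0. 
Qed.

Let pdf'E x : 0 < x -> pdf' x = pdf x.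
Proof. by move=> x0; rewrite /pdf' /pdf /recip_gamma_pdf powR_inv1// ltW. Qed.

Lemma measurable_recip_gamma_pdf : measurable_fun half (recip_gamma_pdf alpha).
Proof.
apply: (eq_measurable_fun pdf').
  by move=> x /set_mem; rewrite halfE; exact: pdf'E.
exact: measurable_funTS.
Qed.

Let w2 (p : measurableTypeR R * 'rV[R]_d) : R := \1_half p.1 * (gd' p * pdf' p.1).

Let mw2 : measurable_fun setT w2.
Proof.
apply: measurable_funM.
  have mi : measurable_fun setT (\1_half : R -> R) by exact: measurable_indic.
  exact: measurableT_comp mi measurable_fst.
apply: measurable_funM; first exact: mgd'.
exact: measurableT_comp mpdf' measurable_fst.
Qed.

Let w2_ge0 p : 0 <= w2 p.
Proof.
rewrite mulr_ge0// mulr_ge0//.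
  by rewrite mulr_ge0 ?expR_ge0// exprn_ge0// powR_ge0.
by rewrite mulr_ge0 ?expR_ge0// divr_ge0 ?powR_ge0// Gamma_ge0.
Qed.

(* The law of Y is that of the second component under the weight w2, the joint
   density of the reciprocal gamma variable and of the vector. *)
Let w2_tonelli (k : 'rV[R]_d -> R) : measurable_fun setT k -> (forall v, 0 <= k v) ->
  (\int[mu \x leb d]_p ((w2 p)%:E * (k p.2)%:E) =
   \int[mu]_(x in half)
     ((\int[leb d]_v (k v * gauss_density (sd x) v)%:E) * (pdf x)%:E))%E.
Proof.
move=> mk k0; rewrite (fubini_tonelli1 (fun p => ((w2 p)%:E * (k p.2)%:E)%E)); last 2 first.
- apply: emeasurable_funM; apply/measurable_EFinP; first exact: mw2.
  exact: measurableT_comp mk measurable_snd.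
- by move=> p; rewrite mule_ge0 ?lee_fin.
rewrite [RHS]integral_mkcond; apply: eq_integral => x _; rewrite patchE.
case: ifPn => [/set_mem|xh]; last first.
  by rewrite /fubini_F integral0_eq// => v _; rewrite /w2 indicE (negbTE xh) mul0r mul0e.
rewrite halfE => x0; rewrite muleC -ge0_integralZl_EFin ?recip_gamma_pdf_ge0//.
- rewrite /fubini_F; apply: eq_integral => v _.
  rewrite -!EFinM /w2 /= indicE mem_set ?halfE// mul1r gd'E// pdf'E//.
  by congr EFin; ring.
- by move=> v _; rewrite lee_fin mulr_ge0// gauss_density_ge0.
- by apply/measurable_EFinP; apply: measurable_funM => //; exact: measurable_gauss_density.
Qed.

Context {d0} {Om : measurableType d0} (P : probability Om R) (Y : Om -> 'rV[R]_d).
Hypothesis mY : measurable_fun setT Y.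
Hypothesis Y_law : forall B, measurable B ->
  P (Y @^-1` B) = random_variance_gauss_law alpha g B.

Let integral_law (h : 'rV[R]_d -> R) : measurable_fun setT h -> (forall v, 0 <= h v) ->
  (\int[P]_w (h (Y w))%:E = \int[mu]_(x in half)
     ((\int[leb d]_v (h v * gauss_density (sd x) v)%:E) * (pdf x)%:E))%E.
Proof.
move=> mh h0; rewrite -w2_tonelli//.
rewrite -(@eq_integral_weighted R _ 'rV[R]_d _ Om _ _ P (mu \x leb d)%E (fun=> 1)
  w2 Y snd (fun v => (h v)%:E))//.
- by apply: eq_integral => w _; rewrite mul1e.
- exact/measurable_EFinP.
- move=> B mB; rewrite integral_cst; last by rewrite -[X in measurable X]setTI; exact: mY.
  rewrite mul1e /= Y_law// /random_variance_gauss_law.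
  transitivity (\int[mu \x leb d]_p ((w2 p)%:E * (\1_B p.2)%:E))%E; last first.
    rewrite [RHS]integral_mkcond; apply: eq_integral => p _.
    rewrite patchE indicE; have -> : (p \in snd @^-1` B) = (p.2 \in B).
      by apply/idP/idP; rewrite !inE.
    by case: ifP => _; rewrite ?mule1 ?mule0.
  have mk : measurable_fun setT (\1_B : 'rV[R]_d -> R) by exact: measurable_indic.
  have k0 v : 0 <= \1_B v :> R by rewrite indicE.
  rewrite (w2_tonelli mk k0).
  apply: eq_integral => x _; congr (_ * _)%E.
  rewrite /gauss_law integral_mkcond; apply: eq_integral => v _.
  by rewrite patchE indicE; case: ifP => _; rewrite ?mul1r ?mul0r.
Qed.

Lemma integral_recip_gamma_pdf :
  (\int[mu]_(x in `]0%R, +oo[) (recip_gamma_pdf alpha x)%:E = 1)%E.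
Proof.
have := @integral_law (fun=> 1) (measurable_cst _) (fun=> ler01).
rewrite integral_probability_cst => ->; apply: eq_integral => x /set_mem xh.
have x0 : 0 < x by rewrite -halfE.
under eq_integral do rewrite mul1r.
by rewrite integral_gauss_density ?sd_gt0// mul1e.
Qed.

(** The average, over the random variance, of the Gaussian transforms. *)
Definition mixture_transform (xi : 'rV[R]_d) : R :=
  \int[mu]_(x in `]0%R, +oo[)
    (expR (- (g / 4 * x * dot xi xi)) * recip_gamma_pdf alpha x).

Let mexp (c : R) : measurable_fun half (fun x : R => expR (- (g / 4 * x * c))).
Proof.
apply: measurable_funTS; apply: (measurableT_comp (@measurable_expR R)).
by apply: measurable_funN; apply: measurable_funM => //; apply: measurable_funM.
Qed.

Let ipdf : mu.-integrable half (EFin \o pdf).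
Proof.
apply/integrableP; split; first by apply/measurable_EFinP; exact: measurable_recip_gamma_pdf.
under eq_integral do rewrite /= ger0_norm ?recip_gamma_pdf_ge0//.
by rewrite integral_recip_gamma_pdf ltry.
Qed.

Let iexp (xi : 'rV[R]_d) : mu.-integrable half
  (EFin \o (fun x => expR (- (g / 4 * x * dot xi xi)) * pdf x)).
Proof.
apply: le_integrable ipdf => //.
  apply/measurable_EFinP; apply: measurable_funM; first exact: mexp.
  exact: measurable_recip_gamma_pdf.
move=> x; rewrite halfE => x0; rewrite /= lee_fin normrM.
rewrite ler_piMl// ger0_norm ?expR_ge0// -expR0 ler_expR oppr_le0.
by rewrite mulr_ge0 ?dot_ge0// mulr_ge0 ?divr_ge0// ltW.
Qed.

Lemma Rintegral_cos_mixture b xi :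
  \int[P]_w cos (b + dot xi (Y w)) = cos b * mixture_transform xi.
Proof.
have mc : measurable_fun setT (fun v : 'rV[R]_d => cos (b + dot xi v)).
  apply: (measurableT_comp measurable_cos); apply: measurable_funD => //.
  exact: measurable_dot.
have c0 (x : R) : 0 <= 1 + cos x by have := cos_geN1 x; lra.
have := @integral_law (fun v => 1 + cos (b + dot xi v)).
move=> /(_ _ _)/wrap[||H].
- exact: measurable_funD.
- by move=> v; exact: c0.
have mcY : measurable_fun setT (fun w => cos (b + dot xi (Y w))).
  exact: measurableT_comp mc mY.
have icY : P.-integrable setT (EFin \o (fun w => cos (b + dot xi (Y w)))).
  by apply: (integrable_bounded P mcY (M := 1)) => w; exact: norm_cos_le1.
have i1 : P.-integrable setT (EFin \o (fun=> 1 : R)).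
  exact: finite_measure_integrable_cst.
have : 1 + \int[P]_w cos (b + dot xi (Y w)) = 1 + cos b * mixture_transform xi.
  rewrite -[X in X + _ = _](Rintegral_probability_cst P 1) -RintegralD//.
  rewrite {1}/Rintegral H.
  transitivity (fine (\int[mu]_(x in half)
      (pdf x + cos b * (expR (- (g / 4 * x * dot xi xi)) * pdf x))%:E)%E).
    congr fine; apply: eq_integral => x /set_mem; rewrite halfE => x0.
    rewrite integral_1Dcos_gauss ?sd_gt0// -EFinM; congr EFin.
    rewrite /sd sqr_sqrtr; last by rewrite mulr_ge0 ?divr_ge0 ?(ltW g0) ?(ltW x0).
    rewrite mulrDl mul1r mulrA; congr (_ + cos b * expR (- _) * _); field.
    by [].
  have iZ : mu.-integrable half (EFin \o (fun x => cos b * (expR (- (g / 4 * x * dot xi xi)) * pdf x))).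
    rewrite (_ : EFin \o _ = (fun x => (cos b)%:E *
      (EFin \o (fun x : R => (expR (- (g / 4 * x * dot xi xi)) * pdf x)%R)) x)%E)//.
    exact: integrableZl.
  rewrite -/(Rintegral _ _ _) RintegralD// RintegralZl//; congr (_ + _).
  by rewrite /Rintegral integral_recip_gamma_pdf.
by move/addrI.
Qed.

End random_variance_law.

(** * The jump intensity of the stable limit *)

Section jump_intensity.
Context {R : realType}.
Let mu := @lebesgue_measure R.
Let half : set R := `]0, +oo[%classic.
Variable alpha : R.
Hypothesis alpha_01 : 0 < alpha < 1.

Let a0 : 0 < alpha. Proof. by have /andP[] := alpha_01. Qed.
Let a1 : alpha < 1. Proof. by have /andP[] := alpha_01. Qed.

Let mhalf : measurable half. Proof. exact: measurable_itv. Qed.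

Let halfE x : half x = (0 < x) :> Prop.
Proof. by rewrite /half/= in_itv/= andbT. Qed.

Definition stable_intensity (u : R) : R :=
  u `^ (- alpha - 1) * (1 - expR (- (u / 4))).

(** Up to a factor, the Laplace exponent at 1/4 of the one-sided alpha-stable
    subordinator, in its Levy-Khintchine form. *)
Definition stable_mass : \bar R := (\int[mu]_(u in `]0%R, +oo[) (stable_intensity u)%:E)%E.

Lemma continuous_powR_gt0 (p x : R) : 0 < x -> {for x, continuous (fun y => y `^ p)}.
Proof.
move=> x0; apply: differentiable_continuous; apply/derivable1_diffP.
by apply: derivable_powR; rewrite in_itv/= x0.
Qed.

Lemma stable_intensity_ge0 u : 0 <= u -> 0 <= stable_intensity u.
Proof.
move=> u0; rewrite mulr_ge0 ?powR_ge0// subr_ge0 -[leRHS]expR0 ler_expR oppr_le0.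
by rewrite divr_ge0.
Qed.

Let cexp (c x : R) : {for x, continuous (fun u : R => 1 - expR (- (c * u)))}.
Proof.
apply: continuousB; first exact: cst_continuous.
apply: (@continuous_comp _ _ _ (fun u : R => - (c * u)) expR); last exact: continuous_expR.
by apply: continuousN; apply: continuousM; [exact: cst_continuous|exact: cvg_id].
Qed.

Lemma measurable_stable_intensity : measurable_fun half stable_intensity.
Proof.
apply: measurable_fun0y => x x0; apply: continuousM; first exact: continuous_powR_gt0.
rewrite (_ : (fun x => _) = (fun u : R => 1 - expR (- (4^-1 * u)))); first exact: cexp.
by apply/funext => u; rewrite mulrC.
Qed.

Let integral_power (p x y : R) : p != 0 -> 0 < x -> x < y ->
  (\int[mu]_(u in `[x, y]) (u `^ (p - 1))%:E = ((y `^ p - x `^ p) / p)%:E)%E.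
Proof.
move=> p0 x0 xy.
have pos (u : R) : u \in `[x, y]%classic -> 0 < u.
  by rewrite inE/= in_itv/= => /andP[+ _]; exact: lt_le_trans.
have der (u : R) : 0 < u -> is_derive u 1 (fun v : R => p^-1 * v `^ p) (u `^ (p - 1)).
  move=> u0; have du : derivable (fun v : R => v `^ p) u 1.
    by apply: derivable_powR; rewrite in_itv/= u0.
  apply: DeriveDef; first by apply: derivableM => //; exact: derivable_cst.
  rewrite -derive1E derive1Ml//.
  rewrite powR_derive1 ?in_itv/= ?u0//.
  by rewrite mulrA mulVf// mul1r.
rewrite (_ : ((y `^ p - x `^ p) / p)%:E = ((p^-1 * y `^ p)%:E - (p^-1 * x `^ p)%:E)%E); last first.
  by rewrite -EFinB; congr EFin; ring.
have cF (u : R) : 0 < u -> {for u, continuous (fun v : R => p^-1 * v `^ p)}.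
  move=> u0; apply: continuousM; first exact: cst_continuous.
  exact: continuous_powR_gt0.
have y0 : 0 < y by exact: lt_trans xy.
apply: (@continuous_FTC2 _ (fun u => u `^ (p - 1)) (fun v : R => p^-1 * v `^ p)) => //.
- apply: continuous_in_subspaceT => u /pos u0; exact: continuous_powR_gt0.
- split.
  + move=> u; rewrite in_itv/= => /andP[xu _].
    by have du := der u (lt_trans x0 xu); exact: ex_derive.
  + by apply: cvg_at_right_filter; exact: cF.
  + by apply: cvg_at_left_filter; exact: cF.
- move=> u; rewrite in_itv/= => /andP[xu _].
  by have du := der u (lt_trans x0 xu); rewrite derive1E; exact: derive_val.
Qed.

(** Near 0 the intensity is at most u^-alpha, near infinity at most
    u^(-alpha-1). *)
Lemma stable_mass_lty : (stable_mass < +oo)%E.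
Proof.
pose J (n : nat) : set R := `[n.+1%:R^-1, n.+1%:R]%classic.
have mJ n : measurable (J n) by exact: measurable_itv.
have Jpos n u : J n u -> 0 < u.
  by rewrite /J/= in_itv/= => /andP[+ _]; apply: lt_le_trans.
have mm : measurable_fun half (EFin \o stable_intensity).
  by apply/measurable_EFinP; exact: measurable_stable_intensity.
have lim : (\int[mu]_(u in J n) (stable_intensity u)%:E)%E @[n --> \oo] --> stable_mass.
  rewrite /stable_mass itv0y_bigcup; apply: ge0_nondecreasing_set_cvg_integral => //.
  - exact: nondecreasing_itv0y.
  - by move=> n; apply: measurable_funS mm => // u /Jpos; rewrite halfE.
  - by move=> n u /Jpos u0; rewrite lee_fin stable_intensity_ge0// ltW.
apply: (@le_lt_trans _ _ ((1 - alpha)^-1 + alpha^-1)%:E); last exact: ltry.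
rewrite -(cvg_lim _ lim)//; apply: lime_le; first exact: cvgP lim.
near=> n.
have n1 : 1 < n.+1%:R :> R by rewrite ltr1n ltnS; near: n; exact: nbhs_infty_gt.
have nV1 : n.+1%:R^-1 < 1 :> R by rewrite invf_lt1.
have mS (D : set R) : measurable D -> (forall u, D u -> 0 < u) ->
    measurable_fun D (EFin \o stable_intensity).
  by move=> mD D0; apply: measurable_funS mm => // u /D0; rewrite halfE.
have JU : J n = `[n.+1%:R^-1, 1]%classic `|` `]1, n.+1%:R]%classic.
  by rewrite /J -itv_bndbnd_setU// bnd_simp ltW.
have p1 (u : R) : `[n.+1%:R^-1, 1]%classic u -> 0 < u.
  by rewrite /= in_itv/= => /andP[+ _]; apply: lt_le_trans.
have p2 (u : R) : `[1, n.+1%:R]%classic u -> 0 < u.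
  by rewrite /= in_itv/= => /andP[+ _]; apply: lt_le_trans.
have p2' (u : R) : `]1, n.+1%:R]%classic u -> 0 < u.
  by rewrite /= in_itv/= => /andP[+ _]; apply: lt_trans.
rewrite -/(J n) JU ge0_integral_setU//; first last.
- apply/disj_setPS => u [/=]; rewrite !in_itv/= => /andP[_ u1] /andP[u1' _].
  by move: (lt_le_trans u1' u1); rewrite ltxx.
- move=> u [/p1|/p2'] u0; by rewrite lee_fin stable_intensity_ge0// ltW.
- by apply: mS => [|u [/p1|/p2']//]; apply: measurableU.
rewrite EFinD; apply: leeD.
- apply: (@le_trans _ _ (\int[mu]_(u in `[n.+1%:R^-1%R, 1%R]) (u `^ ((1 - alpha) - 1))%:E)%E).
    apply: ge0_le_integral => //.
    + by move=> u /p1 u0; rewrite lee_fin stable_intensity_ge0// ltW.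
    + exact: mS.
    + by apply/measurable_EFinP; apply: measurable_funTS; exact: measurable_powR.
    + move=> u /p1 u0; rewrite lee_fin /stable_intensity.
      have -> : u `^ (1 - alpha - 1) = u `^ (- alpha - 1) * u.
        rewrite -{3}(powRr1 (ltW u0)) -powRD ?(gt_eqF u0) ?implybT//.
        by congr (_ `^ _); ring.
      rewrite ler_wpM2l ?powR_ge0// lerBlDr -lerBlDl.
      have := expR_ge1Dx (- (u / 4)); lra.
  rewrite integral_power//; last by rewrite subr_eq0 gt_eqF.
  rewrite lee_fin powR1 ler_pdivrMr ?subr_gt0// mulVf ?subr_eq0 ?gt_eqF//.
- apply: (@le_trans _ _ (\int[mu]_(u in `[1%R, n.+1%:R]) (u `^ (- alpha - 1))%:E)%E).
    apply: (@le_trans _ _ (\int[mu]_(u in `]1%R, n.+1%:R]) (u `^ (- alpha - 1))%:E)%E).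
      apply: ge0_le_integral => //.
      + by move=> u /p2' u0; rewrite lee_fin stable_intensity_ge0// ltW.
      + exact: mS.
      + by apply/measurable_EFinP; apply: measurable_funTS; exact: measurable_powR.
      + move=> u /p2' u0; rewrite lee_fin ler_piMr ?powR_ge0//.
    apply: ge0_subset_integral => //.
    + by apply/measurable_EFinP; apply: measurable_funTS; exact: measurable_powR.
    + by move=> u _; rewrite lee_fin powR_ge0.
    + by apply: subset_itvr; rewrite bnd_simp.
  rewrite integral_power ?oppr_eq0 ?gt_eqF// lee_fin powR1.
  by rewrite invrN mulrN -mulNr opprB ler_pdivrMr// mulVf ?gt_eqF// gerBl powR_ge0.
Unshelve. all: by end_near. Qed.

Lemma stable_mass_gt0 : (0 < stable_mass)%E.
Proof.
pose c : R := 2 `^ (- alpha - 1) * (1 - expR (- 4^-1)).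
have c0 : 0 < c.
  by rewrite mulr_gt0 ?powR_gt0// subr_gt0 -[ltRHS]expR0 ltr_expR oppr_lt0 invr_gt0.
have m12 : measurable (`[1, 2]%classic : set R) by exact: measurable_itv.
have sub : (`[1, 2]%classic : set R) `<=` half.
  by move=> u; rewrite halfE /= in_itv/= => /andP[+ _]; apply: lt_le_trans.
have mm : measurable_fun half (EFin \o stable_intensity).
  by apply/measurable_EFinP; exact: measurable_stable_intensity.
apply: (@lt_le_trans _ _ (\int[mu]_(u in `[1%R, 2%R]) c%:E)%E).
  rewrite /mu integral_cst//= lebesgue_measure_itv/= lte_fin ltr1n/= -EFinB -EFinM lte_fin.
  by rewrite mulr_gt0//; lra.
apply: (@le_trans _ _ (\int[mu]_(u in `[1%R, 2%R]) (stable_intensity u)%:E)%E).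
  apply: ge0_le_integral => //.
  - by move=> u _; rewrite lee_fin ltW.
  - exact: measurable_funS mm.
  - move=> u; rewrite /= in_itv/= => /andP[u1 u2]; rewrite lee_fin /c /stable_intensity.
    have u0 : 0 < u by exact: lt_le_trans u1.
    apply: ler_pM; rewrite ?powR_ge0//.
    + rewrite -opprD !powRN lef_pV2 ?posrE ?powR_gt0//.
      by rewrite ge0_ler_powR ?nnegrE// ltW// addr_gt0.
    + by rewrite lerD2l lerN2 ler_expR lerN2 ler_pdivlMr// mulVf.
apply: ge0_subset_integral => //.
move=> u uh; have u0 : 0 < u by rewrite -halfE.
  by rewrite lee_fin stable_intensity_ge0// ltW.
Qed.

Lemma stable_mass_fin_num : stable_mass \is a fin_num.
Proof. by rewrite ge0_fin_numE ?stable_mass_lty// ltW// stable_mass_gt0. Qed.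

Lemma integrable_stable_intensity : mu.-integrable half (EFin \o stable_intensity).
Proof.
apply/integrableP; split; first by apply/measurable_EFinP; exact: measurable_stable_intensity.
rewrite (_ : (\int[mu]_(x in half) _)%E = stable_mass) ?stable_mass_lty//.
apply: eq_integral => u /set_mem uh; have u0 : 0 < u by rewrite -halfE.
  rewrite /=.
by rewrite ger0_norm// stable_intensity_ge0// ltW.
Qed.

(* The powers of c gathered by the substitution u -> c u. *)
Let powR_scale (c u : R) : 0 < c -> 0 < u ->
  (c * u) `^ (- alpha - 1) = c `^ (- alpha - 1) * u `^ (- alpha - 1).
Proof. by move=> c0 u0; rewrite powRM// ltW. Qed.

Let scale_const (c : R) : 0 < c -> c `^ alpha * (c * c `^ (- alpha - 1)) = 1.
Proof.
move=> c0; rewrite -{2}(powRr1 (ltW c0)) -!powRD ?(gt_eqF c0) ?implybT//.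
by rewrite (_ : _ + _ = 0) ?powRr0//; ring.
Qed.

(** Self-similarity: the exponent of the subordinator is a power. *)
Lemma stable_mass_scale (c : R) : 0 < c ->
  (\int[mu]_(u in `]0%R, +oo[) (u `^ (- alpha - 1) * (1 - expR (- (c * u / 4))))%:E =
   (c `^ alpha)%:E * stable_mass)%E.
Proof.
move=> c0.
rewrite /stable_mass -(@ge0_integral0y_scale R c (EFin \o stable_intensity))//; last 2 first.
- by apply/measurable_EFinP; exact: measurable_stable_intensity.
- by move=> u u0; rewrite lee_fin stable_intensity_ge0// ltW.
rewrite muleA -EFinM -ge0_integralZl_EFin//; last 3 first.
- move=> u uh; have u0 : 0 < u by rewrite -halfE.
  by rewrite lee_fin stable_intensity_ge0// ltW// mulr_gt0.
- apply/measurable_EFinP; apply: (measurable_comp (F := half)) => //.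
  + move=> _ [u uh <-]; have u0 : 0 < u by rewrite -halfE.
    by rewrite halfE mulr_gt0.
  + exact: measurable_stable_intensity.
- by rewrite mulr_ge0 ?powR_ge0// ltW.
apply: eq_integral => u /set_mem uh; have u0 : 0 < u by rewrite -halfE.
rewrite -EFinM /stable_intensity powR_scale//; congr EFin.
by rewrite !mulrA -[c `^ alpha * c * _]mulrA scale_const// mul1r.
Qed.

(** The form taken by the integral when the power of |y| is written as a Gamma
    integral: the variable is the inverse of a variance. *)
Lemma stable_mass_inverse (c : R) : 0 < c ->
  (\int[mu]_(s in `]0%R, +oo[) (s `^ (alpha - 1) * (1 - expR (- (c * s^-1 / 4))))%:E =
   (c `^ alpha)%:E * stable_mass)%E.
Proof.
move=> c0; rewrite -(stable_mass_scale c0).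
rewrite (@ge0_integral0yV R (fun u => u `^ (- alpha - 1) * (1 - expR (- (c * u / 4)))))//.
- apply: eq_integral => s /set_mem sh; have s0 : 0 < s by rewrite -halfE.
  congr EFin.
  have -> : s^-1 `^ (- alpha - 1) = s `^ (alpha + 1).
    by rewrite -powR_inv1 ?ltW// -powRrM; congr (_ `^ _); ring.
  have -> : s ^- 2 = s `^ (- 2%:R) by rewrite powR_invn// ltW.
  rewrite [RHS]mulrAC -powRD ?(gt_eqF s0) ?implybT//.
  by congr (_ `^ _ * _); ring.
- move=> x x0; apply: continuousM; first exact: continuous_powR_gt0.
  rewrite (_ : (fun x => _) = (fun u : R => 1 - expR (- ((c / 4) * u)))); first exact: cexp.
  by apply/funext => u; rewrite mulrAC.
- move=> x x0; rewrite mulr_ge0 ?powR_ge0// subr_ge0 -[leRHS]expR0 ler_expR oppr_le0.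
  by rewrite divr_ge0// mulr_ge0// ltW.
Qed.

(** With D = |xi|^2 this is the limit of gamma^(-alpha) (1 - phi). In the variable
    u = gamma D x the integrand is the stable intensity times a factor that
    increases to 1 as gamma tends to 0. The normalization of the density ensures
    that Gamma alpha is not the default value 0. *)
Lemma cvg_jump_defect (D : R) (g : nat -> R) : 0 <= D ->
  (forall n, 0 < g n) -> g n @[n --> \oo] --> 0 ->
  (\int[mu]_(x in `]0%R, +oo[) (recip_gamma_pdf alpha x)%:E)%E = 1%E ->
  (g n `^ alpha)^-1 *
    (1 - \int[mu]_(x in `]0%R, +oo[) (expR (- (g n / 4 * x * D)) * recip_gamma_pdf alpha x))
  @[n --> \oo] --> D `^ alpha * (fine stable_mass / Gamma alpha).
Proof.
move=> D0 g0 g_0 pdf1.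
pose phi n := \int[mu]_(x in `]0%R, +oo[)
  (expR (- (g n / 4 * x * D)) * recip_gamma_pdf alpha x).
rewrite -/phi.
have mpdf : measurable_fun half (recip_gamma_pdf alpha) by exact: measurable_recip_gamma_pdf.
have ipdf : mu.-integrable half (EFin \o recip_gamma_pdf alpha).
  apply/integrableP; split; first by apply/measurable_EFinP.
  under eq_integral do rewrite /= ger0_norm ?recip_gamma_pdf_ge0//.
  by rewrite pdf1 ltry.
have G0 : Gamma alpha != 0.
  apply/negP => /eqP G0; move: pdf1; rewrite integral0_eq.
    by move=> /eqP; rewrite eqe eq_sym oner_eq0.
  by move=> x _; rewrite /recip_gamma_pdf G0 invr0 mulr0 mul0r.
have [D_0|Dn0] := eqVneq D 0.
  rewrite D_0 powR0 ?gt_eqF// mul0r.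
  rewrite (_ : (fun n => _) = (fun=> 0)); first exact: cvg_cst.
  apply/funext => n.
  under eq_Rintegral do rewrite mulr0 oppr0 expR0 mul1r.
  by rewrite /Rintegral pdf1 subrr mulr0.
have Dp : 0 < D by rewrite lt_neqAle eq_sym Dn0.
pose c n := g n * D.
have c0 n : 0 < c n by rewrite mulr_gt0.
pose f n (u : R) := stable_intensity u * expR (- (c n * u^-1)).
have f_ge0 n (u : R) : 0 <= u -> 0 <= f n u.
  by move=> u0; rewrite mulr_ge0 ?expR_ge0// stable_intensity_ge0.
have mf n : measurable_fun half (f n).
  apply: measurable_fun0y => x x0; apply: continuousM.
    apply: continuousM; first exact: continuous_powR_gt0.
    rewrite (_ : (fun x => _) = (fun u : R => 1 - expR (- (4^-1 * u)))); first exact: cexp.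
    by apply/funext => u; rewrite mulrC.
  apply: (@continuous_comp _ _ _ (fun u : R => - (c n * u^-1)) expR); last exact: continuous_expR.
  apply: continuousN; apply: continuousM; first exact: cst_continuous.
  by apply: continuousV; [rewrite gt_eqF|exact: cvg_id].
have fle n (u : R) : 0 < u -> `|f n u| <= stable_intensity u.
  move=> u0; rewrite ger0_norm ?f_ge0 ?(ltW u0)// ler_piMr//.
    by rewrite stable_intensity_ge0// ltW.
  by rewrite -[leRHS]expR0 ler_expR oppr_le0 mulr_ge0 ?invr_ge0 ?(ltW (c0 n)) ?(ltW u0).
have key n : (g n `^ alpha)^-1 * (1 - phi n) =
    D `^ alpha / Gamma alpha * fine (\int[mu]_(u in `]0%R, +oo[) (f n u)%:E)%E.
  have iphi : mu.-integrable half (EFin \o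
      (fun x => expR (- (g n / 4 * x * D)) * recip_gamma_pdf alpha x)).
    apply: le_integrable ipdf => //.
      apply/measurable_EFinP; apply: measurable_funM => //.
      apply: measurable_funTS; apply: (measurableT_comp (@measurable_expR R)).
      by apply: measurable_funN; apply: measurable_funM => //; apply: measurable_funM.
    move=> x xh; have x0 : 0 < x by rewrite -halfE.
    rewrite /= lee_fin normrM ler_piMl// ger0_norm ?expR_ge0//.
    rewrite -[leRHS]expR0 ler_expR oppr_le0.
    by rewrite mulr_ge0// mulr_ge0 ?(ltW x0)// divr_ge0 ?(ltW (g0 n)).
  have iB : mu.-integrable half (fun x => (recip_gamma_pdf alpha x -
      expR (- (g n / 4 * x * D)) * recip_gamma_pdf alpha x)%:E).
    rewrite (_ : (fun x => _) = (fun x => (recip_gamma_pdf alpha x)%:E -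
      (expR (- (g n / 4 * x * D)) * recip_gamma_pdf alpha x)%:E)%E)//.
    exact: integrableB.
  have -> : 1 - phi n = \int[mu]_(x in half)
      (recip_gamma_pdf alpha x - expR (- (g n / 4 * x * D)) * recip_gamma_pdf alpha x).
    by rewrite RintegralB//; congr (_ - _); rewrite /Rintegral pdf1.
  have -> : (\int[mu]_(u in `]0%R, +oo[) (f n u)%:E =
      (c n * (c n `^ (- alpha - 1) * Gamma alpha))%:E * \int[mu]_(x in half)
      (recip_gamma_pdf alpha x - expR (- (g n / 4 * x * D)) * recip_gamma_pdf alpha x)%:E)%E.
    rewrite -(ge0_integral0y_scale (f := EFin \o f n) (c0 n)); last 2 first.
    - by apply/measurable_EFinP.
    - by move=> u u0; rewrite lee_fin f_ge0// ltW.
    rewrite (EFinM (c n)) -muleA; congr (_ * _)%E.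
    rewrite -ge0_integralZl_EFin//.
    - apply: eq_integral => x /set_mem xh; have x0 : 0 < x by rewrite -halfE.
      rewrite -EFinM /= /f /stable_intensity (powR_scale (c0 n) x0) /recip_gamma_pdf; congr EFin.
      have -> : c n * (c n * x)^-1 = x^-1 by rewrite invfM mulrA mulfV ?mul1r// gt_eqF.
      have -> : c n * x / 4 = g n / 4 * x * D by rewrite /c; ring.
      by field.
    - move=> x xh; have x0 : 0 < x by rewrite -halfE.
      rewrite lee_fin subr_ge0 ler_piMl ?recip_gamma_pdf_ge0//.
      rewrite -[leRHS]expR0 ler_expR oppr_le0.
      by rewrite mulr_ge0// mulr_ge0 ?(ltW x0)// divr_ge0 ?(ltW (g0 n)).
    - exact: measurable_int iB.
    - by rewrite mulr_ge0 ?powR_ge0// Gamma_ge0.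
  rewrite fineM//; last first.
    exact: integrable_fin_num iB.
  rewrite /= -/(Rintegral _ _ _).
  have : (g n `^ alpha * D `^ alpha) * (c n * c n `^ (- alpha - 1)) = 1.
    by rewrite -powRM ?(ltW (g0 n))//; exact: (scale_const (c0 n)).
  have gn0 : g n `^ alpha != 0 by rewrite gt_eqF// powR_gt0.
  set I := Rintegral _ _ _; set A := g n `^ alpha; set B := D `^ alpha.
  set K := c n `^ _ => E.
  have -> : B / Gamma alpha * (c n * (K * Gamma alpha) * I) = A^-1 * (A * B * (c n * K)) * I.
    by field; rewrite gn0 G0.
  by rewrite E mulr1.
rewrite (_ : (fun n => _) = (fun n => D `^ alpha / Gamma alpha *
    fine (\int[mu]_(u in `]0%R, +oo[) (f n u)%:E)%E)); last by apply/funext.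
rewrite [X in _ --> X](_ : _ = D `^ alpha / Gamma alpha * fine stable_mass); last by ring.
apply: cvgM; first exact: cvg_cst.
apply: fine_cvg; rewrite fineK ?stable_mass_fin_num//.
have := @dominated_convergence _ _ R mu half mhalf (fun n => EFin \o f n)
  (EFin \o stable_intensity) (EFin \o stable_intensity).
move=> /(_ _ _ _ _ _)/wrap[|||||[_ _]//].
- by move=> n; apply/measurable_EFinP; exact: mf.
- by apply/measurable_EFinP; exact: measurable_stable_intensity.
- apply: aeW => x xh; have x0 : 0 < x by rewrite -halfE.
  apply: cvg_EFin; first exact: nearW.
  rewrite -[X in _ --> X]mulr1; apply: cvgM; first exact: cvg_cst.
  rewrite -expR0; apply: continuous_cvg; first exact: continuous_expR.
  rewrite -[X in _ --> X]oppr0; apply: cvgN.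
  rewrite -(mul0r x^-1); apply: cvgM; last exact: cvg_cst.
  by rewrite -(mul0r D); apply: cvgM => //; exact: cvg_cst.
- exact: integrable_stable_intensity.
- by apply: aeW => x n xh; rewrite lee_fin fle// -halfE.
Qed.

End jump_intensity.

(** * The normalizing constant of the fractional Laplacian *)

Section gamma_integral.
Context {R : realType}.
Let mu := @lebesgue_measure R.
Let half : set R := `]0, +oo[%classic.

Let mhalf : measurable half. Proof. exact: measurable_itv. Qed.

Let halfE x : half x = (0 < x) :> Prop.
Proof. by rewrite /half/= in_itv/= andbT. Qed.

Definition Gamma_integral (a : R) : \bar R :=
  (\int[mu]_(s in `]0%R, +oo[) (s `^ (a - 1) * expR (- s))%:E)%E.

Lemma GammaE a : Gamma a = fine (Gamma_integral a).
Proof. by []. Qed.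

Lemma Gamma_integral_ge0 a : (0 <= Gamma_integral a)%E.
Proof.
by apply: integral_ge0 => s _; rewrite lee_fin mulr_ge0 ?powR_ge0 ?expR_ge0.
Qed.

Let mpe (a c : R) : measurable_fun setT (fun s : R => s `^ (a - 1) * expR (- (c * s))).
Proof.
apply: measurable_funM; first exact: measurable_powR.
apply: (measurableT_comp (@measurable_expR R)); apply: measurable_funN.
exact: measurable_funM.
Qed.

(** At c = |y|^2 this writes a negative power of |y| as a mixture of Gaussian
    functions of y. *)
Lemma Gamma_integral_scale (a c : R) : 0 < c ->
  (\int[mu]_(s in `]0%R, +oo[) (s `^ (a - 1) * expR (- (c * s)))%:E =
   (c `^ (- a))%:E * Gamma_integral a)%E.
Proof.
move=> c0.
rewrite /Gamma_integral -(ge0_integral0y_scale (c := c)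
  (f := fun s => (s `^ (a - 1) * expR (- s))%:E))//; last 2 first.
- apply: measurable_funTS; apply/measurable_EFinP.
  have := mpe a 1; apply: eq_measurable_fun => s _.
  by rewrite mul1r.
- by move=> s s0; rewrite lee_fin mulr_ge0 ?powR_ge0 ?expR_ge0.
rewrite muleA -EFinM -ge0_integralZl_EFin//.
- apply: eq_integral => s /set_mem sh; have s0 : 0 < s by rewrite -halfE.
  rewrite -EFinM powRM ?ltW//; congr EFin.
  have E : c `^ (- a) * c * c `^ (a - 1) = 1.
    rewrite -{2}(powRr1 (ltW c0)) -!powRD ?(gt_eqF c0) ?implybT//.
    by rewrite (_ : _ + _ = 0) ?powRr0//; ring.
  by rewrite !mulrA E mul1r.
- by move=> s _; rewrite lee_fin mulr_ge0 ?powR_ge0 ?expR_ge0.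
- apply/measurable_EFinP; apply: measurable_funTS.
  apply: measurable_funM.
    by apply: (measurableT_comp (@measurable_powR R _)); apply: measurable_funM.
  apply: (measurableT_comp (@measurable_expR R)); apply: measurable_funN.
  exact: measurable_funM.
- by rewrite mulr_ge0 ?powR_ge0// ltW.
Qed.

End gamma_integral.

Section cosine_integral.
Context {R : realType} {d : nat}.
Variable alpha : R.
Hypothesis alpha_01 : 0 < alpha < 1.
Let mu := @lebesgue_measure R.
Let half : set R := `]0, +oo[%classic.
Let a : R := alpha + d%:R / 2.

Let mhalf : measurable half. Proof. exact: measurable_itv. Qed.

Let halfE x : half x = (0 < x) :> Prop.
Proof. by rewrite /half/= in_itv/= andbT. Qed.

(** The Levy-Khintchine exponent of the measure |y|^(-2 alpha - d) dy. *)
Definition cosine_exponent (xi : 'rV[R]_d) : \bar R :=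
  (\int[leb d]_y ((1 - cos (dot xi y)) * (enorm y `^ (2 * alpha + d%:R))^-1)%:E)%E.

Lemma onem_cos_ge0 (x : R) : 0 <= 1 - cos x.
Proof. by rewrite subr_ge0 cos_le1. Qed.

Lemma enorm_powR (v : 'rV[R]_d) (p : R) : enorm v `^ p = dot v v `^ (p / 2).
Proof. by rewrite /enorm -powR12_sqrt ?dot_ge0// -powRrM mulrC. Qed.

Lemma cosine_exponent_ge0 xi : (0 <= cosine_exponent xi)%E.
Proof.
apply: integral_ge0 => y _.
by rewrite lee_fin mulr_ge0 ?onem_cos_ge0// invr_ge0 powR_ge0.
Qed.

Lemma measurable_onem_cos (xi : 'rV[R]_d) :
  measurable_fun setT (fun y : 'rV[R]_d => 1 - cos (dot xi y)).
Proof.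
apply: measurable_funB => //; apply: (measurableT_comp measurable_cos).
exact: measurable_dot.
Qed.

Lemma measurable_inv_enorm_powR (p : R) :
  measurable_fun setT (fun y : 'rV[R]_d => (enorm y `^ p)^-1).
Proof.
have -> : (fun y : 'rV[R]_d => (enorm y `^ p)^-1) = (fun y => enorm y `^ (- p)).
  by apply/funext => y; rewrite powRN.
exact: measurableT_comp (@measurable_powR R _) (@measurable_enorm R d).
Qed.

Let ms : measurable_fun setT (fun y : 'rV[R]_d => (enorm y `^ (2 * alpha + d%:R))^-1).
Proof. exact: measurable_inv_enorm_powR. Qed.

(* The joint integrand, extended by zero to nonpositive s. *)
Let F (xi : 'rV[R]_d) (p : 'rV[R]_d * measurableTypeR R) : R :=
  (1 - cos (dot xi p.1)) *
  (\1_half p.2 * (p.2 `^ (a - 1) * expR (- (dot p.1 p.1 * p.2)))).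

Let mF xi : measurable_fun setT (F xi).
Proof.
apply: measurable_funM.
  exact: measurableT_comp (measurable_onem_cos xi) measurable_fst.
apply: measurable_funM.
  have mi : measurable_fun setT (\1_half : R -> R) by exact: measurable_indic.
  exact: measurableT_comp mi measurable_snd.
apply: measurable_funM.
  exact: measurableT_comp (@measurable_powR R _) measurable_snd.
apply: (measurableT_comp (@measurable_expR R)); apply: measurable_funN.
apply: measurable_funM => //.
exact: measurableT_comp (@measurable_dot_self R d) measurable_fst.
Qed.

Let F_ge0 xi p : 0 <= F xi p.
Proof.
by rewrite mulr_ge0 ?onem_cos_ge0// mulr_ge0 ?indicE// mulr_ge0 ?powR_ge0 ?expR_ge0.
Qed.

(* At y = 0 the power is a default value, harmless since 1 - cos vanishes. *)
Let integral_F_s xi y : (\int[mu]_s (F xi (y, s))%:E =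
  ((1 - cos (dot xi y)) * (enorm y `^ (2 * alpha + d%:R))^-1)%:E * Gamma_integral a)%E.
Proof.
transitivity ((1 - cos (dot xi y))%:E *
    \int[mu]_(s in half) (s `^ (a - 1) * expR (- (dot y y * s)))%:E)%E.
  rewrite [X in (_ * X)%E]integral_mkcond -ge0_integralZl_EFin ?onem_cos_ge0//.
  - apply: eq_integral => s _; rewrite patchE /F indicE /=.
    by case: ifPn => _; rewrite -EFinM ?mul1r ?mul0r.
  - move=> s _; rewrite patchE; case: ifPn => // _.
    by rewrite lee_fin mulr_ge0 ?powR_ge0 ?expR_ge0.
  - apply/(measurable_restrictT _ _).1 => //; apply: measurable_funTS.
    apply/measurable_EFinP; apply: measurable_funM; first exact: measurable_powR.
    apply: (measurableT_comp (@measurable_expR R)); apply: measurable_funN.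
    exact: measurable_funM.
have [->|y0] := eqVneq y 0; first by rewrite dot0r cos0 subrr mul0r !mul0e.
rewrite Gamma_integral_scale; last by rewrite lt_neqAle eq_sym dot_eq0 y0 dot_ge0.
rewrite muleA -EFinM; congr ((_ * _)%:E * _)%E.
by rewrite powRN enorm_powR; congr ((_ `^ _)^-1); rewrite /a; field.
Qed.

(* As a function of y, exp (- s |y|^2) is a multiple of a Gaussian density with
   variance 1 / (2 s); the shift by pi turns 1 + cos into 1 - cos. *)
Let integral_F_y xi (s : R) : 0 < s -> (\int[leb d]_y (F xi (y, s))%:E =
  (pi `^ (d%:R / 2) *
     (s `^ (alpha - 1) * (1 - expR (- (dot xi xi * s^-1 / 4)))))%:E)%E.
Proof.
move=> s0.
pose sd := Num.sqrt (2 * s)^-1.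
have sd2 : sd ^+ 2 = (2 * s)^-1 by rewrite sqr_sqrtr// invr_ge0 mulr_ge0// ltW.
have sd0 : 0 < sd by rewrite sqrtr_gt0 invr_gt0 mulr_gt0.
have pk : normal_peak sd ^+ d != 0 by rewrite expf_neq0// gt_eqF// normal_peak_gt0// gt_eqF.
transitivity ((s `^ (a - 1) * (normal_peak sd ^+ d)^-1)%:E *
   \int[leb d]_y ((1 + cos (pi + dot xi y)) * gauss_density sd y)%:E)%E.
  rewrite -ge0_integralZl_EFin//.
  - apply: eq_integral => y _; rewrite /F /= indicE mem_set ?halfE// mul1r.
    rewrite gauss_densityE// -EFinM [pi + _]addrC cosDpi sd2; congr EFin.
    have -> : dot y y / ((2 * s)^-1 *+ 2) = dot y y * s.
      by rewrite -mulr_natr; field; rewrite gt_eqF.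
    by field.
  - move=> y _; rewrite lee_fin mulr_ge0// ?gauss_density_ge0//.
  - apply/measurable_EFinP; apply: measurable_funM; last exact: (@measurable_gauss_density R sd d).
    apply: measurable_funD => //; apply: (measurableT_comp measurable_cos).
    by apply: measurable_funD => //; exact: measurable_dot.
  - by rewrite mulr_ge0 ?powR_ge0// invr_ge0 exprn_ge0// normal_peak_ge0.
rewrite integral_1Dcos_gauss// cospi mulN1r sd2 -EFinM; congr EFin.
have -> : (2 * s)^-1 * dot xi xi / 2 = dot xi xi * s^-1 / 4.
  by field; rewrite gt_eqF.
rewrite mulrA; congr (_ * _).
have -> : (normal_peak sd ^+ d)^-1 = (pi / s) `^ (d%:R / 2).
  rewrite /normal_peak sd2 exprVn invrK.
  have -> : (2 * s)^-1 * pi *+ 2 = pi / s :> R.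
    by rewrite -mulr_natr; field; rewrite gt_eqF.
  rewrite -powR12_sqrt; last by rewrite divr_ge0 ?pi_ge0// ltW.
  by rewrite -powR_mulrn ?powR_ge0// -powRrM [2^-1 * _]mulrC.
have -> : pi / s = pi * s `^ (- 1) by rewrite powR_inv1// ltW.
rewrite powRM ?pi_ge0 ?powR_ge0// -powRrM mulrCA -powRD ?(gt_eqF s0) ?implybT//.
by congr (_ * _ `^ _); rewrite /a; field.
Qed.

(** Writing |y|^(-2 alpha - d) as a mixture of Gaussian densities reduces the
    exponent to a one-dimensional integral. *)
Lemma cosine_exponent_Gamma xi :
  (cosine_exponent xi * Gamma_integral a =
   (pi `^ (d%:R / 2) * dot xi xi `^ alpha)%:E * stable_mass alpha)%E.
Proof.
rewrite /cosine_exponent -ge0_integralZr//; first last.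
- exact: Gamma_integral_ge0.
- by move=> y _; rewrite lee_fin mulr_ge0 ?onem_cos_ge0// invr_ge0 powR_ge0.
- by apply/measurable_EFinP; apply: measurable_funM => //; exact: measurable_onem_cos.
under eq_integral do rewrite -integral_F_s.
rewrite (fubini_tonelli (m1 := leb d) (m2 := mu) (fun p => (F xi p)%:E)); last 2 first.
- by apply/measurable_EFinP; exact: mF.
- by move=> p; rewrite lee_fin F_ge0.
transitivity (\int[mu]_(s in half) ((pi `^ (d%:R / 2))%:E *
    (s `^ (alpha - 1) * (1 - expR (- (dot xi xi * s^-1 / 4))))%:E))%E.
  rewrite [RHS]integral_mkcond; apply: eq_integral => s _; rewrite patchE.
  case: ifPn => [/set_mem|sh]; last first.
    by apply: integral0_eq => y _; rewrite /F /= indicE (negbTE sh) mul0r mulr0.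
  by rewrite halfE => s0; rewrite integral_F_y.
have [->|xi0] := eqVneq xi 0.
  rewrite dot0r powR0 ?gt_eqF//; last by case/andP : alpha_01.
  rewrite mulr0 mul0e integral0_eq// => s _.
  by rewrite !mul0r oppr0 expR0 subrr mulr0 mule0.
have D0 : 0 < dot xi xi by rewrite lt_neqAle eq_sym dot_eq0 xi0 dot_ge0.
rewrite EFinM -muleA -(stable_mass_inverse alpha D0) ge0_integralZl_EFin//.
- move=> s sh; have s0 : 0 < s by rewrite -halfE.
  rewrite lee_fin mulr_ge0 ?powR_ge0// subr_ge0 -[leRHS]expR0 ler_expR oppr_le0.
  by rewrite divr_ge0// mulr_ge0 ?invr_ge0// ltW.
- apply/measurable_EFinP; apply: measurable_fun0y => s s0.
  apply: continuousM; first exact: continuous_powR_gt0.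
  apply: continuousB; first exact: cst_continuous.
  apply: (@continuous_comp _ _ _ (fun u : R => - (dot xi xi * u^-1 / 4)) expR); last exact: continuous_expR.
  apply: continuousN; apply: continuousM; last exact: cst_continuous.
  apply: continuousM; first exact: cst_continuous.
  by apply: continuousV; [rewrite gt_eqF|exact: cvg_id].
- exact: powR_ge0.
Qed.

Section normalization.
Variable i : 'I_d.

Let e : 'rV[R]_d := delta_mx 0 i.

Let dote y : dot e y = y 0 i.
Proof.
rewrite /dot (bigD1 i)//= big1; last first.
  by move=> j ji; rewrite /e mxE eqxx/= (negbTE ji) mul0r.
by rewrite /e mxE !eqxx mul1r addr0.
Qed.

(* A product of nonnegative extended reals that is finite and positive has finite
   and positive factors. *)
Let Je_gt0_fin : [/\ (0 < cosine_exponent e)%E, (cosine_exponent e < +oo)%E,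
  (0 < Gamma_integral a)%E & (Gamma_integral a < +oo)%E].
Proof.
have E := cosine_exponent_Gamma e.
rewrite dote /e mxE !eqxx powR1 mulr1 -/e in E.
have p0 : (0 < pi `^ (d%:R / 2) :> R) by rewrite powR_gt0// pi_gt0.
have r0 : (0 < (pi `^ (d%:R / 2))%:E * stable_mass alpha)%E.
  by rewrite mule_gt0// ?lte_fin// stable_mass_gt0.
have roo : ((pi `^ (d%:R / 2))%:E * stable_mass alpha < +oo)%E.
  by rewrite lte_mul_pinfty ?lee_fin ?(ltW p0)// stable_mass_lty.
rewrite -E in r0 roo.
have J0 := cosine_exponent_ge0 e; have G0 := Gamma_integral_ge0 a.
have Jp : (0 < cosine_exponent e)%E.
  by rewrite lt_neqAle J0 andbT; apply/eqP => J; move: r0; rewrite -J mul0e ltxx.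
have Gp : (0 < Gamma_integral a)%E.
  by rewrite lt_neqAle G0 andbT; apply/eqP => G; move: r0; rewrite -G mule0 ltxx.
split=> //; rewrite ltNge leye_eq; apply/negP => /eqP H; move: roo.
  by rewrite H gt0_mulye// ltxx.
by rewrite H gt0_muley// ltxx.
Qed.

Let cos_integralE : (cos_integral alpha i)%:E = cosine_exponent e.
Proof.
have [J0 Joo _ _] := Je_gt0_fin.
rewrite -[RHS]fineK; last by rewrite ge0_fin_numE// ltW.
congr EFin; rewrite /cos_integral /Rintegral; congr fine; apply: eq_integral => y _.
by rewrite dote.
Qed.

Lemma cos_integral_gt0 : 0 < cos_integral alpha i.
Proof. by have [J0 _ _ _] := Je_gt0_fin; rewrite -lte_fin cos_integralE. Qed.

Lemma cos_integral_Gamma :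
  cos_integral alpha i * Gamma (alpha + d%:R / 2) =
  pi `^ (d%:R / 2) * fine (stable_mass alpha).
Proof.
have [_ _ G0 Goo] := Je_gt0_fin.
apply/EFin_inj; rewrite EFinM cos_integralE GammaE fineK; last first.
  by rewrite ge0_fin_numE// ltW.
rewrite cosine_exponent_Gamma dote /e mxE !eqxx powR1 mulr1.
by rewrite EFinM fineK// stable_mass_fin_num.
Qed.

(** In the previous identities xi enters only through |xi|^(2 alpha), and a basis
    vector fixes the constant. *)
Lemma cosine_exponentE xi :
  cosine_exponent xi = (cos_integral alpha i * enorm xi `^ (2 * alpha))%:E.
Proof.
have [J0 Joo G0 Goo] := Je_gt0_fin.
have Gf : Gamma_integral a \is a fin_num by rewrite ge0_fin_numE// ltW.
have E := cosine_exponent_Gamma xi.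
have G_0 : Gamma a != 0 by rewrite GammaE gt_eqF// fine_gt0// G0.
have : (cosine_exponent xi * (Gamma a)%:E =
        (cos_integral alpha i * enorm xi `^ (2 * alpha))%:E * (Gamma a)%:E)%E.
  have EG : (Gamma a)%:E = Gamma_integral a by rewrite GammaE fineK.
  rewrite [X in (cosine_exponent xi * X)%E]EG E.
  rewrite -EFinM mulrAC cos_integral_Gamma enorm_powR.
  rewrite (_ : 2 * alpha / 2 = alpha); last by field.
  rewrite -[X in (_ * X)%E]fineK ?stable_mass_fin_num// -EFinM; congr EFin; ring.
move=> /(congr1 (fun x => x * ((Gamma a)^-1)%:E)%E).
by rewrite -!muleA -!EFinM mulfV// mule1 mulr1 => ->.
Qed.

End normalization.
End cosine_integral.

(** * Convergence to the stable process *)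

Section randomized_sum_transform.
Context {R : realType} {d0} {Om : measurableType d0} (P : probability Om R).
Context {d : nat}.

Lemma le_measure_ae (A B : set Om) : measurable A -> measurable B ->
  {ae P, forall w, A w -> B w} -> (P A <= P B)%E.
Proof.
move=> mA mB [N [mN PN sub]].
apply: (@le_trans _ _ (P (B `|` N))).
  apply: le_measure; rewrite ?inE//; first exact: measurableU.
  move=> w Aw; have [Bw|nBw] := pselect (B w); first by left.
  by right; apply: sub => /= /(_ Aw).
by rewrite (le_trans (measureU2 _ mB mN))// [X in (_ + X)%E]PN adde0.
Qed.

Variables (lambda alpha p q g : R).
Variables (N : R -> {RV P >-> nat}) (eps : nat -> {RV P >-> R})
  (Y : nat -> {RV P >-> 'rV[R]_d}).

Let N_event t n : measurable [set w | N t w = n].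
Proof.
rewrite (_ : [set w | _] = N t @^-1` [set n]); last by apply/seteqP; split.
by rewrite -[X in measurable X]setTI; exact: measurable_funP.
Qed.

(** The increment of N over [0, t] is N t, up to the null event on which N 0 is
    not 0. *)
Lemma poisson_process_law t n : 0 < t -> poisson_process lambda N ->
  P [set w | N t w = n] = (poisson_pmf (lambda * t) n)%:E.
Proof.
move=> t0 [N0 /(_ 0 t (lexx _) t0 n) law _ _].
rewrite subr0 in law; rewrite -law.
have E : [set w | N t w = (N 0 w + n)%N] =
    \bigcup_k ([set w | N 0 w = k] `&` [set w | N t w = (k + n)%N]).
  apply/seteqP; split => w /=; first by move=> h; exists (N 0 w).
  by move=> [k _ [/= <-]].
have mB : measurable [set w | N t w = (N 0 w + n)%N].
  by rewrite E; apply: bigcupT_measurable => k; apply: measurableI.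
apply/eqP; rewrite eq_le; apply/andP; split; apply: le_measure_ae => //.
- by apply: filterS N0 => w /= ->.
- by apply: filterS N0 => w /= ->.
Qed.

Lemma sigma_process_measurable A : sigma_process N A -> measurable A.
Proof.
apply: smallest_sub; first exact: sigma_algebra_measurable.
move=> B [t _ [C mC <-]]; rewrite setTI -[X in measurable X]setTI.
exact: measurable_funP.
Qed.

Lemma sigma_process_event t n : 0 <= t -> sigma_process N [set w | N t w = n].
Proof.
move=> t0; apply: sub_sigma_algebra; exists t => //; exists [set n] => //.
by rewrite setTI.
Qed.

Lemma measurable_randomized_sum t : measurable_fun setT (randomized_sum N eps Y t).
Proof.
apply: (@measurable_compound_sum R _ Om d (N t) eps Y).
- exact: measurable_funP.
- by move=> j; exact: measurable_funP.
- by move=> j; exact: measurable_funP.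
Qed.

Hypothesis g0 : 0 < g.
Hypothesis model : randomized_sum_model lambda alpha p q g N eps Y.

Let Y_law j B : measurable B -> P (Y j @^-1` B) = random_variance_gauss_law alpha g B.
Proof. by have [_ _ h _] := model; exact: h. Qed.

Lemma model_recip_gamma_pdf :
  (\int[lebesgue_measure]_(x in `]0%R, +oo[) (recip_gamma_pdf alpha x)%:E = 1)%E.
Proof.
apply: (integral_recip_gamma_pdf g0 (P := P) (Y := Y 0%N)).
  exact: measurable_funP.
exact: Y_law.
Qed.

Lemma cos_transform_randomized_sum t a xi : 0 < lambda -> p + q = 1 -> 0 < t ->
  cos_transform P (randomized_sum N eps Y t) a xi =
  (1 + cos a * (mixture_transform alpha g xi *
     expR (- (lambda * t * (1 - mixture_transform alpha g xi)))))%:E.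
Proof.
move=> l0 pq1 t0; have [pp eps_law _ indep] := model.
apply: (@cos_transform_compound_sum R _ Om P d (sigma_process N) (N t) eps Y
  _ _ _ p q) => //.
- exact: mulr_gt0.
- exact: sigma_process_measurable.
- by move=> n; apply: sigma_process_event; exact: ltW.
- by move=> n; exact: poisson_process_law.
- move=> j.
  have := @Rintegral_cos_mixture R d alpha g g0 _ _ P (Y j) _ (@Y_law j) 0 xi.
  move=> /(_ _)/wrap[|]; first exact: measurable_funP.
  rewrite cos0 mul1r => <-; by under [RHS]eq_Rintegral do rewrite add0r.
- move=> j.
  have := @Rintegral_cos_mixture R d alpha g g0 _ _ P (Y j) _ (@Y_law j) (- (pi / 2)) xi.
  move=> /(_ _)/wrap[|]; first exact: measurable_funP.
  rewrite cosN cos_pihalf mul0r => E; rewrite -[RHS]E.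
  by apply: eq_Rintegral => w _; rewrite addrC -sinDpihalf subrK.
Qed.

End randomized_sum_transform.

Section stable_transform.
Context {R : realType} {d0} {Om : measurableType d0} (P : probability Om R).
Context {d : nat}.

Lemma integrable_cos_dot (X : Om -> 'rV[R]_d) xi : measurable_fun setT X ->
  P.-integrable setT (EFin \o (fun w => cos (dot xi (X w)))).
Proof.
move=> mX; apply: (integrable_bounded P _ (M := 1)) => [|w]; last exact: norm_cos_le1.
apply: (measurableT_comp measurable_cos).
exact: measurableT_comp (measurable_dot xi) mX.
Qed.

Lemma integrable_sin_dot (X : Om -> 'rV[R]_d) xi : measurable_fun setT X ->
  P.-integrable setT (EFin \o (fun w => sin (dot xi (X w)))).
Proof.
move=> mX; apply: (integrable_bounded P _ (M := 1)) => [|w]; last exact: norm_sin_le1.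
apply: (measurableT_comp measurable_sin).
exact: measurableT_comp (measurable_dot xi) mX.
Qed.

Lemma cos_transform_char_fun (X : Om -> 'rV[R]_d) a xi : measurable_fun setT X ->
  cos_transform P X a xi =
  (1 + (cos a * complex.Re (char_fun P X xi) - sin a * complex.Im (char_fun P X xi)))%:E.
Proof.
move=> mX; have ic := integrable_cos_dot xi mX; have is_ := integrable_sin_dot xi mX.
have ic' := integrable_realZl (cos a) ic; have is' := integrable_realZl (sin a) is_.
have i1 : P.-integrable setT (EFin \o (fun=> 1 : R)) by exact: finite_measure_integrable_cst.
rewrite /cos_transform.
have iB := integrable_realB ic' is'.
under eq_integral do rewrite cosD.
rewrite -[LHS]fineK; last exact: (integrable_fin_num _ (integrable_realD i1 iB)).
rewrite -/(Rintegral _ _ _) RintegralD// RintegralB// !RintegralZl//.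
by rewrite Rintegral_probability_cst.
Qed.

Lemma cos_transform_stable alpha (S : R -> {RV P >-> 'rV[R]_d}) s a xi : 0 <= s ->
  isotropic_stable alpha S ->
  cos_transform P (S s) a xi =
  (1 + cos a * expR (- (s * enorm xi `^ (2 * alpha))))%:E.
Proof.
move=> s0 [_ /(_ s xi s0) E].
rewrite cos_transform_char_fun; last exact: measurable_funP.
by rewrite E /= mulr0 subr0.
Qed.

End stable_transform.

Section convergence.
Context {R : realType} {d : nat}.
Variables (lambda alpha p q : R) (i : 'I_d).
Hypothesis lambda_gt0 : 0 < lambda.
Hypothesis alpha_01 : 0 < alpha < 1.
Hypothesis pq1 : p + q = 1.

Definition stable_rate : R := lambda *
  (Gamma (alpha + d%:R / 2) / (pi `^ (d%:R / 2) * Gamma alpha)) * cos_integral alpha i.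

(** The constant in front of the fractional Laplacian is the one produced by the
    limit of the compound Poisson exponent. *)
Lemma stable_rateE : stable_rate = lambda * (fine (stable_mass alpha) / Gamma alpha).
Proof.
have p0 : (pi : R) `^ (d%:R / 2) != 0 by rewrite gt_eqF// powR_gt0// pi_gt0.
have E := cos_integral_Gamma alpha_01 i.
rewrite /stable_rate invfM.
have -> : lambda * (fine (stable_mass alpha) / Gamma alpha) =
  lambda * (pi `^ (d%:R / 2) * fine (stable_mass alpha)) * ((pi `^ (d%:R / 2))^-1 * (Gamma alpha)^-1).
  move: p0; set u := pi `^ _; set v := (Gamma alpha)^-1 => u0; by field.
by rewrite -E; ring.
Qed.

Lemma stable_rate_ge0 : 0 <= stable_rate.
Proof.
rewrite stable_rateE mulr_ge0 ?(ltW lambda_gt0)// divr_ge0 ?Gamma_ge0//.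
by rewrite fine_ge0// ltW// stable_mass_gt0.
Qed.

Context {disp : R -> measure_display} {Om : forall gamma : R, measurableType (disp gamma)}.
Context (P : forall gamma : R, probability (Om gamma) R).
Context (N : forall gamma : R, R -> {RV (P gamma) >-> nat}).
Context (eps : forall gamma : R, nat -> {RV (P gamma) >-> R}).
Context (Y : forall gamma : R, nat -> {RV (P gamma) >-> 'rV[R]_d}).
Arguments N : clear implicits.
Arguments eps : clear implicits.
Arguments Y : clear implicits.
Hypothesis model : forall gamma : R, 0 < gamma ->
  randomized_sum_model lambda alpha p q gamma (N gamma) (eps gamma) (Y gamma).
Context {disp' : measure_display} {Om' : measurableType disp'}.
Context (P' : probability Om' R) (S : R -> {RV P' >-> 'rV[R]_d}).
Hypothesis S_stable : isotropic_stable alpha S.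

(** The defect 1 - phi is of order gamma^alpha: it is compensated by the number of
    summands in the exponent, while the isolated factor phi tends to 1. *)
Lemma cvg_cos_transform_randomized_sum (g : nat -> R) t a xi : 0 < t ->
  (forall n, 0 < g n) -> g n @[n --> \oo] --> 0 ->
  cos_transform (P (g n)) (randomized_sum (N (g n)) (eps (g n)) (Y (g n))
    (t / g n `^ alpha)) a xi @[n --> \oo] --> cos_transform P' (S (stable_rate * t)) a xi.
Proof.
move=> t0 g0 g_0.
rewrite (cos_transform_stable _ _ _ S_stable); last first.
  by rewrite mulr_ge0 ?stable_rate_ge0// ltW.
pose phi n := mixture_transform alpha (g n) xi.
have ga0 n : 0 < g n `^ alpha by rewrite powR_gt0.
rewrite (_ : (fun n => _) = (fun n => (1 + cos a * (phi n *
    expR (- (lambda * t * ((g n `^ alpha)^-1 * (1 - phi n))))))%:E)); last first.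
  apply/funext => n; rewrite (cos_transform_randomized_sum (g0 n) (model (g0 n)))//; last first.
    by rewrite divr_gt0.
  by congr (_ + _ * (_ * expR (- _)))%:E; rewrite !mulrA.
have defect := cvg_jump_defect alpha_01 (dot_ge0 xi) g0 g_0
  (model_recip_gamma_pdf (g0 0%N) (model (g0 0%N))).
have defect' : (g n `^ alpha)^-1 * (1 - phi n) @[n --> \oo] -->
  dot xi xi `^ alpha * (fine (stable_mass alpha) / Gamma alpha) by exact: defect.
have ga : g n `^ alpha @[n --> \oo] --> 0.
  have /cvg_at_rightP := @powR_cvg0 R alpha (proj1 (andP alpha_01)).
  by apply; split.
have phi1 : phi n @[n --> \oo] --> (1 : R).
  rewrite (_ : phi = (fun n => 1 - g n `^ alpha * ((g n `^ alpha)^-1 * (1 - phi n)))); last first.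
    by apply/funext => n; rewrite mulrA mulfV ?gt_eqF// mul1r opprB addrC subrK.
  rewrite -[X in _ --> X]subr0; apply: cvgB; first exact: cvg_cst.
  rewrite -(mul0r (dot xi xi `^ alpha * (fine (stable_mass alpha) / Gamma alpha))).
  exact: cvgM.
apply: cvg_EFin; first exact: nearW.
apply: cvgD; first exact: cvg_cst.
apply: cvgM; first exact: cvg_cst.
rewrite -[X in _ --> X]mul1r; apply: cvgM => //.
apply: continuous_cvg; first exact: continuous_expR.
apply: cvgN; rewrite enorm_powR (_ : 2 * alpha / 2 = alpha); last by field.
rewrite (_ : stable_rate * t * dot xi xi `^ alpha =
  lambda * t * (dot xi xi `^ alpha * (fine (stable_mass alpha) / Gamma alpha))); last first.
  by rewrite stable_rateE; ring.
by apply: cvgM => //; exact: cvg_cst.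
Qed.

(** Convergence as gamma tends to 0 from the right is convergence along all positive
    sequences that tend to 0. *)
Lemma cvg_randomized_sum t : 0 < t ->
  cvg_in_distribution (0 : R)^'+ P
    (fun gamma : R => randomized_sum (N gamma) (eps gamma) (Y gamma) (t / gamma `^ alpha))
    P' (S (stable_rate * t)).
Proof.
move=> t0 f cf [M fM]; rewrite unlock.
have mf : measurable_fun setT f by exact: continuous_measurable_rV.
have iS : P'.-integrable setT (EFin \o (f \o S (stable_rate * t))).
  apply: (integrable_bounded P' _ (M := M)) => [|w]; last exact: fM.
  by apply: measurableT_comp mf _; exact: measurable_funP.
rewrite -[X in _ --> X]fineK; last exact: integrable_fin_num iS.
apply/cvge_at_rightP => g [g0 g_0].
rewrite fineK; last exact: integrable_fin_num iS.
apply: (@levy_continuity R d (fun n => disp (g n)) (fun n => Om (g n)) (fun n => P (g n))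
  (fun n => randomized_sum (N (g n)) (eps (g n)) (Y (g n)) (t / g n `^ alpha)) _
  disp' Om' P' (S (stable_rate * t)) _ _ f M) => //.
- by move=> n; exact: measurable_randomized_sum.
- by move=> a xi; exact: cvg_cos_transform_randomized_sum.
Qed.

End convergence.

(** * Exchange of integrals and integration by parts *)

Section parametrized_integrals.
Context {R : realType} {d1 d2 : measure_display}.
Context {T1 : measurableType d1} {T2 : measurableType d2}.
Variable m1 : {sigma_finite_measure set T1 -> \bar R}.
Variable m2 : {sigma_finite_measure set T2 -> \bar R}.

Lemma measurable_integral_param (g : T1 * T2 -> \bar R) : measurable_fun setT g ->
  measurable_fun setT (fun x => \int[m2]_y g (x, y))%E.
Proof.
move=> mg; have gE : (fun x => \int[m2]_y g (x, y))%E =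
  (fun x => (\int[m2]_y (g^\+)%E (x, y)) - (\int[m2]_y (g^\-)%E (x, y)))%E.
  apply/funext => x; rewrite [LHS]integralE.
  by congr (_ - _)%E; apply: eq_integral => y _; rewrite ?funeposE ?funenegE.
rewrite gE; apply: emeasurable_funB.
- apply: (measurable_fun_fubini_tonelli_F (g^\+)%E) => //.
  exact: measurable_funepos.
- apply: (measurable_fun_fubini_tonelli_F (g^\-)%E) => //.
  exact: measurable_funeneg.
Qed.

Lemma measurable_Rintegral_param (g : T1 -> T2 -> R) :
  measurable_fun setT (fun p : T1 * T2 => g p.1 p.2) ->
  measurable_fun setT (fun x => \int[m2]_y g x y).
Proof.
move=> mg; apply: (measurableT_comp (@fine_measurable R _ measurableT)).
apply: (measurable_integral_param (g := fun p => (g p.1 p.2)%:E)).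
exact/measurable_EFinP.
Qed.

(** All sections are assumed integrable, not almost all, so that the inner real
    integrals have no default value. *)
Lemma Rintegral_exchange (g : T1 -> T2 -> R) :
  measurable_fun setT (fun p : T1 * T2 => g p.1 p.2) ->
  (forall x, m2.-integrable setT (EFin \o g x)) ->
  (forall y, m1.-integrable setT (EFin \o g ^~ y)) ->
  (\int[m1]_x \int[m2]_y (`|g x y|)%:E < +oo)%E ->
  \int[m1]_x \int[m2]_y g x y = \int[m2]_y \int[m1]_x g x y.
Proof.
move=> mg i2 i1 goo.
have ig : (m1 \x m2)%E.-integrable setT (fun p => (g p.1 p.2)%:E).
  apply/integrable12ltyP; first exact/measurable_EFinP.
  by under eq_integral do under eq_integral do rewrite /= .
rewrite /Rintegral; congr fine.
transitivity (\int[m1]_x \int[m2]_y (g x y)%:E)%E.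
  by apply: eq_integral => x _; rewrite fineK//; exact: integrable_fin_num (i2 x).
rewrite (Fubini ig); apply: eq_integral => y _.
by rewrite fineK//; exact: integrable_fin_num (i1 y).
Qed.

Lemma Rintegral_exchange_prod (g : T1 -> T2 -> R) (A : T1 -> R) (B : T2 -> R) :
  measurable_fun setT (fun p : T1 * T2 => g p.1 p.2) ->
  m1.-integrable setT (EFin \o A) -> m2.-integrable setT (EFin \o B) ->
  (forall x y, `|g x y| <= A x * B y) ->
  (forall x, 0 <= A x) -> (forall y, 0 <= B y) ->
  \int[m1]_x \int[m2]_y g x y = \int[m2]_y \int[m1]_x g x y.
Proof.
move=> mg iA iB gAB A0 B0; apply: Rintegral_exchange => //.
- move=> x; apply: (@integrable_dominated _ _ _ _ _ (fun y => A x * B y)) => //.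
    exact: (measurable_comp _ _ mg (pair1_measurable x)).
  exact: integrable_realZl.
- move=> y; apply: (@integrable_dominated _ _ _ _ _ (fun x => B y * A x)) => //.
    exact: (measurable_comp _ _ mg (pair2_measurable y)).
    by move=> x; rewrite mulrC.
  exact: integrable_realZl.
- have mB := measurable_int _ iB.
  apply: (@le_lt_trans _ _ (\int[m1]_x ((\int[m2]_y (B y)%:E) * (A x)%:E))%E).
    apply: ge0_le_integral => //.
    + by move=> x _; apply: integral_ge0 => y _; rewrite lee_fin.
    + apply: (measurable_integral_param (g := fun p => (`|g p.1 p.2|)%:E)).
      by apply/measurable_EFinP; exact: measurableT_comp.
    + by apply: emeasurable_funM => //; exact: measurable_int iA.
    + move=> x _; rewrite muleC -ge0_integralZl_EFin//; first last.
      * by move=> y _; rewrite lee_fin.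
      apply: ge0_le_integral => //.
      * apply/measurable_EFinP; apply: measurableT_comp => //.
        exact: (measurable_comp _ _ mg (pair1_measurable x)).
      * exact: emeasurable_funM.
      * by move=> y _; rewrite -EFinM lee_fin.
  rewrite ge0_integralZl//.
  + rewrite lte_mul_pinfty//.
    * by apply: integral_ge0 => y _; rewrite lee_fin.
    * exact: integrable_fin_num iB.
    * have /integrableP[_] := iA; apply: le_lt_trans; apply: ge0_le_integral => //.
      - by move=> x _; rewrite lee_fin.
      - exact: measurable_int iA.
      - by apply: measurableT_comp => //; exact: measurable_int iA.
      - by move=> x _; rewrite lee_fin /= ler_norm.
  + exact: measurable_int iA.
  + by move=> x _; rewrite lee_fin.
  + by apply: integral_ge0 => y _; rewrite lee_fin.
Qed.

End parametrized_integrals.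

Lemma integrable_Rintegral_param {R : realType} {d1 d2 : measure_display}
    {T1 : measurableType d1} {T2 : measurableType d2}
    (m1 : {sigma_finite_measure set T1 -> \bar R})
    (m2 : {sigma_finite_measure set T2 -> \bar R}) (g : T1 -> T2 -> R) :
  measurable_fun setT (fun p : T1 * T2 => g p.1 p.2) ->
  (forall y, m1.-integrable setT (EFin \o g ^~ y)) ->
  (\int[m1]_x \int[m2]_y (`|g x y|)%:E < +oo)%E ->
  m2.-integrable setT (EFin \o (fun y => \int[m1]_x g x y)).
Proof.
move=> mg i1 goo.
have mag : measurable_fun setT (fun p : T1 * T2 => (`|g p.1 p.2|)%:E).
  by apply/measurable_EFinP; exact: measurableT_comp.
have msw : measurable_fun setT (fun p : T2 * T1 => g p.2 p.1).
  apply: (measurable_comp (F := setT) (g := fun p : T2 * T1 => (p.2, p.1)) _ _ mg) => //.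
  by apply: measurable_fun_pair; [exact: measurable_snd|exact: measurable_fst].
apply/integrableP; split.
  by apply/measurable_EFinP; exact: (measurable_Rintegral_param m1 (g := fun y x => g x y)).
rewrite (fubini_tonelli (m1 := m1) (m2 := m2) (fun p => (`|g p.1 p.2|)%:E)) in goo => //.
apply: le_lt_trans goo; apply: ge0_le_integral => //.
- apply: measurableT_comp => //; apply/measurable_EFinP.
  exact: (measurable_Rintegral_param m1 (g := fun y x => g x y)).
- by apply: (measurable_fun_fubini_tonelli_G (fun p : T1 * T2 => (`|g p.1 p.2|)%:E)).
- move=> y _ /=.
  have ig := i1 y; rewrite -[X in (_ <= X)%E]fineK.
    rewrite lee_fin; exact: le_normr_Rintegral.
  exact: integrable_fin_num (integrable_abse ig).
Qed.

Section cauchy_weight.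
Context {R : realType} {d : nat}.
Implicit Types z : 'rV[R]_d.

(** An integrable majorant for rapidly decreasing functions that changes by at most
    a constant factor under unit shifts. *)
Definition cauchy_weight z : R := \prod_(i < d) (oneDsqr (z 0 i))^-1.

Lemma cauchy_weight_gt0 z : 0 < cauchy_weight z.
Proof. by apply: prodr_gt0 => i _; rewrite invr_gt0 (lt_le_trans ltr01). Qed.

Lemma measurable_cauchy_weight : measurable_fun setT cauchy_weight.
Proof.
apply: measurable_prod => i _.
apply: (@measurableT_comp _ _ _ _ _ _ (fun x : R => (oneDsqr x)^-1)).
  by apply: continuous_measurable_fun; exact: continuous_oneDsqrV.
exact: measurable_entry.
Qed.

Lemma integral_oneDsqrV : (\int[lebesgue_measure]_x ((oneDsqr x)^-1)%:E = (pi : R)%:E)%E.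
Proof.
rewrite ge0_symfun_integralT//; first last.
- by move=> x; rewrite /= /oneDsqr sqrrN.
- exact: continuous_oneDsqrV.
have := @integral0y_oneDsqr R.
rewrite /= set_itvcy => E.
by rewrite E -EFinM; congr EFin; field.
Qed.

Lemma integrable_cauchy_weight : (leb d).-integrable setT (EFin \o cauchy_weight).
Proof.
apply/integrableP; split; first by apply/measurable_EFinP; exact: measurable_cauchy_weight.
under eq_integral do rewrite /= ger0_norm ?(ltW (cauchy_weight_gt0 _))//.
rewrite (@ge0_integral_leb_prod R d (fun x => (oneDsqr x)^-1) pi) ?ltry//.
- by apply: continuous_measurable_fun; exact: continuous_oneDsqrV.
- exact: integral_oneDsqrV.
Qed.

Lemma cauchy_weight_shift z (t : R) (j : 'I_d) : `|t| <= 1 ->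
  cauchy_weight (z + t *: delta_mx 0 j) <= 3 * cauchy_weight z.
Proof.
move=> t1; rewrite /cauchy_weight (bigD1 j)//= [X in 3 * X](bigD1 j)//= mulrA.
rewrite [X in _ * X <= _](eq_bigr (fun i => (oneDsqr (z 0 i))^-1)); last first.
  by move=> i ij; rewrite !mxE eqxx (negbTE ij)/= mulr0 addr0.
rewrite ler_wpM2r//; first by apply: prodr_ge0 => i _; rewrite invr_ge0.
have q0 (y : R) : 0 < oneDsqr y by rewrite (lt_le_trans ltr01).
rewrite !mxE !eqxx mulr1 -[X in X <= _]mul1r ler_pdivrMr// mulrAC ler_pdivlMr//.
rewrite mul1r /oneDsqr; set x := z 0 j.
have t2 : t ^+ 2 <= 1.
  by rewrite -[t ^+ 2]real_normK ?num_real// expr_le1.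
(* 3 (1 + (x + t)^2) - (1 + x^2) = (x + t)^2 + (x + 2 t)^2 + 2 (1 - t^2). *)
have := sqr_ge0 (x + t *+ 2); have := sqr_ge0 (x + t); nra.
Qed.

End cauchy_weight.

Section partial_derivatives.
Context {R : realType} {d : nat}.
Variable j : 'I_d.
Let e : 'rV[R]_d := delta_mx 0 j.

Lemma is_derive_along (h : 'rV[R]_d -> R) z (s : R) : derivable h (z + s *: e) e ->
  is_derive s 1 (fun r : R => h (z + r *: e)) ('D_e h (z + s *: e)).
Proof.
move=> dh.
have E : (fun r : R => r^-1 *: (((fun r : R => h (z + r *: e)) \o shift s) (r *: (1 : R)) - h (z + s *: e))) =
  (fun r : R => r^-1 *: ((h \o shift (z + s *: e)) (r *: e) - h (z + s *: e))).
  apply/funext => r /=; congr (_ *: (h _ - _)).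
  by rewrite [r *: 1]mulr1 scalerDl addrCA.
by apply: DeriveDef; rewrite /derivable /derive E.
Qed.

Variables (h : 'rV[R]_d -> R) (M : R).
Hypothesis dh : forall z, derivable h z e.
Arguments dh : clear implicits.
Hypothesis mh : measurable_fun setT h.
Hypothesis hM : forall z, `|h z| <= M * cauchy_weight z.
Hypothesis dhM : forall z, `|'D_e h z| <= M * cauchy_weight z.

Let M0 : 0 <= M.
Proof.
have := le_trans (normr_ge0 _) (hM 0).
by rewrite pmulr_lge0// cauchy_weight_gt0.
Qed.

Let quotient_le z (t : R) : 0 < t -> t <= 1 ->
  `|t^-1 * (h (z + t *: e) - h z)| <= (M * 3) * cauchy_weight z.
Proof.
move=> t0 t1; pose phi (r : R) := h (z + r *: e).
have dphi (r : R) : is_derive r 1 phi ('D_e h (z + r *: e)) by exact: is_derive_along.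
have [|c + E] := @MVT R phi (fun r => 'D_e h (z + r *: e)) 0 t t0.
  apply: continuous_subspaceT => r; apply: differentiable_continuous.
  by apply/derivable1_diffP; have dr := dphi (r : R); exact: ex_derive.
rewrite in_itv/= => /andP[c0 ct].
have -> : h (z + t *: e) - h z = phi t - phi 0 by rewrite /phi scale0r addr0.
rewrite E subr0 mulrCA mulVf ?gt_eqF// mulr1 (le_trans (dhM _))// -mulrA ler_wpM2l//.
apply: cauchy_weight_shift; rewrite ger0_norm ?ltW//.
exact: lt_le_trans t1.
Qed.

Let mshift (a : 'rV[R]_d) : measurable_fun setT (fun z : 'rV[R]_d => h (z + a)).
Proof. exact: measurableT_comp mh (measurable_rV_shift a). Qed.

Let ih : (leb d).-integrable setT (EFin \o h).
Proof.
apply: integrable_dominated mh hM _; apply: integrable_realZl.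
exact: integrable_cauchy_weight.
Qed.

(** The integral is translation invariant, so the difference quotients integrate
    to zero; they are dominated thanks to the decay of the derivative. *)
Lemma Rintegral_partial_eq0 : \int[leb d]_z 'D_e h z = 0.
Proof.
pose t n : R := n.+1%:R^-1.
have t0 n : 0 < t n by rewrite invr_gt0.
have t1 n : t n <= 1 by rewrite invf_le1// ler1n.
pose q n (z : 'rV[R]_d) := (t n)^-1 * (h (z + t n *: e) - h z).
have iw : (leb d).-integrable setT (EFin \o (fun z => (M * 3) * cauchy_weight z)).
  by apply: integrable_realZl; exact: integrable_cauchy_weight.
have ihn n : (leb d).-integrable setT (EFin \o (fun z : 'rV[R]_d => h (z + t n *: e))).
  apply: integrable_dominated iw => [|z]; first exact: mshift.
  rewrite (le_trans (hM _))// -mulrA ler_wpM2l// cauchy_weight_shift//.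
  by rewrite ger0_norm// ltW.
have mq n : measurable_fun setT (q n) by apply: measurable_funM => //; exact: measurable_funB.
have q0 n : (\int[leb d]_z (q n z)%:E = 0)%E.
  have iq : (leb d).-integrable setT (EFin \o q n).
    by apply: integrable_realZl; exact: integrable_realB.
  rewrite -[LHS]fineK; last exact: integrable_fin_num iq.
  rewrite -/(Rintegral _ _ _) RintegralZl//; last exact: integrable_realB.
  rewrite RintegralB// [X in X - _](_ : _ = \int[leb d]_z h z) ?subrr ?mulr0//.
  rewrite /Rintegral; congr fine.
  by apply: (@integral_leb_shift R d (t n *: e) (EFin \o h)); exact/measurable_EFinP.
have qD z : q n z @[n --> \oo] --> 'D_e h z.
  have := (cvgr_dnbhsP (fun r : R => r^-1 *: ((h \o shift z) (r *: e) - h z)) 0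
    ('D_e h z)).1 (dh (z : 'rV[R]_d)).
  have ht : (forall n, t n != 0) /\ t n @[n --> \oo] --> 0.
    by split=> [n|]; [rewrite gt_eqF|exact: cvg_harmonic].
  move=> /(_ t ht) H.
  rewrite (_ : q ^~ z = fun n => (t n)^-1 *: ((h \o shift z) (t n *: e) - h z))//.
  by apply/funext => n; rewrite /q /= [z + _]addrC.
have mD : measurable_fun setT (fun z => 'D_e h z).
  exact: (measurable_fun_cvg mq (fun z _ => qD z)).
have := @dominated_convergence _ _ R (leb d) setT measurableT (fun n => EFin \o q n)
  (EFin \o (fun z => 'D_e h z)) (EFin \o (fun z => (M * 3) * cauchy_weight z)).
move=> /(_ _ _ _ _ _)/wrap[|||||[_ _ H]].
- by move=> n; apply/measurable_EFinP; exact: mq.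
- by apply/measurable_EFinP; exact: mD.
- by apply: aeW => z _; apply: cvg_EFin; [exact: nearW|exact: qD].
- exact: iw.
- by apply: aeW => z n _; rewrite lee_fin quotient_le.
rewrite /Rintegral.
have <- // : (0 = \int[leb d]_z ('D_e h z)%:E)%E.
apply: cvg_unique H => //.
by rewrite (_ : (fun n => _) = fun=> 0%E); [exact: cvg_cst|apply/funext => n; exact: q0].
Qed.

End partial_derivatives.

(** * Fourier transforms of rapidly decreasing functions *)

Section schwartz_transforms.
Context {R : realType} {d : nat}.

Implicit Types (u : 'rV[R]_d -> R) (xi z x : 'rV[R]_d).

Lemma schwartz_real_partial u i :
  schwartz_real u -> schwartz_real ('D_(delta_mx 0 i : 'rV[R]_d) u).
Proof.
have E s : partials s ('D_(delta_mx 0 i : 'rV[R]_d) u) = partials (rcons s i) u.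
  by rewrite /partials foldr_rcons.
move=> [du cu bu]; split.
- by move=> s j x; rewrite E; exact: du.
- by move=> s; rewrite E; exact: cu.
- by move=> s k; rewrite E; exact: bu.
Qed.

Lemma schwartz_derivable u i z : schwartz_real u -> derivable u z (delta_mx 0 i : 'rV[R]_d).
Proof. by move=> [/(_ [::] i z)]. Qed.

Lemma schwartz_continuous u : schwartz_real u -> continuous u.
Proof. by move=> [_ /(_ [::])]. Qed.

Lemma schwartz_measurable u : schwartz_real u -> measurable_fun setT u.
Proof. by move=> su; apply: continuous_measurable_rV; exact: schwartz_continuous. Qed.

Lemma prod_oneDsqr_le xi : 1 + dot xi xi <= \prod_(i < d) oneDsqr (xi 0 i).
Proof.
rewrite /dot; elim: (index_enum _) => [|i s IH]; first by rewrite !big_nil addr0.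
rewrite !big_cons -expr2; apply: (@le_trans _ _ (oneDsqr (xi 0 i) * (1 + \sum_(j <- s) xi 0 j * xi 0 j))).
  rewrite /oneDsqr; have s0 : 0 <= \sum_(j <- s) xi 0 j * xi 0 j.
    by apply: sumr_ge0 => j _; rewrite -expr2 sqr_ge0.
  have := sqr_ge0 (xi 0 i); nra.
by rewrite ler_wpM2l// (le_trans ler01).
Qed.

Lemma cauchy_weightV xi : (cauchy_weight xi)^-1 = \prod_(i < d) oneDsqr (xi 0 i).
Proof. by rewrite /cauchy_weight prodfV invrK. Qed.

(** The weight is at least (1 + |z|^2)^(-d), and the powers of 1 + |z|^2 are
    combinations of even powers of |z|. *)
Lemma schwartz_decay u : schwartz_real u ->
  exists M : R, forall z, `|u z| <= M * cauchy_weight z.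
Proof.
move=> [_ _ /(_ [::]) bu].
have claim n : forall k, exists M : R, forall z, enorm z ^+ k * (1 + dot z z) ^+ n * `|u z| <= M.
  elim: n => [|n IH] k.
    by have [M HM] := bu k; exists M => z; rewrite expr0 mulr1; exact: HM.
  have [M1 H1] := IH k; have [M2 H2] := IH k.+2; exists (M1 + M2) => z.
  have := lerD (H1 z) (H2 z); rewrite !exprS; apply: le_trans.
  by rewrite -sqr_enorm le_eqVlt; apply/orP; left; apply/eqP; ring.
have [M HM] := claim d 0%N; exists M => z.
rewrite -ler_pdivrMr ?cauchy_weight_gt0// cauchy_weightV.
apply: le_trans (HM z); rewrite expr0 mul1r mulrC ler_wpM2r//.
rewrite -[X in _ <= _ ^+ X]card_ord -prodr_const; apply: ler_prod => i _.
by rewrite (le_trans ler01)//= /oneDsqr lerD2l sqr_coord_le_dot.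
Qed.

Definition cos_fourier u xi : R := \int[leb d]_z (cos (dot xi z) * u z).
Definition sin_fourier u xi : R := \int[leb d]_z (sin (dot xi z) * u z).

Lemma integrable_norm_schwartz u : schwartz_real u ->
  (leb d).-integrable setT (EFin \o (fun z => `|u z|)).
Proof.
move=> su; have [M HM] := schwartz_decay su.
apply: (@integrable_dominated _ _ _ _ _ (fun z => M * cauchy_weight z)).
- by apply: measurableT_comp => //; exact: schwartz_measurable.
- by move=> z; rewrite normr_id.
- by apply: integrable_realZl; exact: integrable_cauchy_weight.
Qed.

Lemma integrable_mul_schwartz u (g : 'rV[R]_d -> R) : schwartz_real u ->
  measurable_fun setT g -> (forall z, `|g z| <= 1) ->
  (leb d).-integrable setT (EFin \o (fun z => g z * u z)).
Proof.
move=> su mg g1; apply: integrable_dominated (integrable_norm_schwartz su).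
  by apply: measurable_funM => //; exact: schwartz_measurable.
by move=> z; rewrite normrM ler_piMl.
Qed.

Lemma is_derive_line (i : 'I_d) (h : 'rV[R]_d -> R) z (D : R) :
  is_derive (0 : R) 1 (fun r : R => h (z + r *: delta_mx 0 i)) D ->
  is_derive z (delta_mx 0 i : 'rV[R]_d) h D.
Proof.
set e : 'rV[R]_d := delta_mx 0 i => dD.
have E : (fun r : R => r^-1 *: (((fun r : R => h (z + r *: e)) \o shift 0) (r *: (1 : R)) - h (z + 0 *: e))) =
  (fun r : R => r^-1 *: ((h \o shift z) (r *: e) - h z)).
  apply/funext => r /=; rewrite scale0r !addr0; congr (_ *: (h _ - _)).
  by rewrite [r *: 1]mulr1 addrC.
apply: DeriveDef; first by have := @ex_derive _ _ _ _ _ _ _ dD; rewrite /derivable E.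
by have := @derive_val _ _ _ _ _ _ _ dD; rewrite /derive E.
Qed.

Section by_parts.
Variables (g g' : R -> R) (i : 'I_d).
Hypothesis dg : forall x : R, is_derive x 1 g (g' x).
Hypotheses (mg : measurable_fun setT g) (mg' : measurable_fun setT g').
Hypotheses (g1 : forall x : R, `|g x| <= 1) (g'1 : forall x : R, `|g' x| <= 1).
Let e : 'rV[R]_d := delta_mx 0 i.

Let is_derive_plane_wave xi z :
  is_derive z e (fun z => g (dot xi z)) (xi 0 i * g' (dot xi z)).
Proof.
apply: is_derive_line.
have E : (fun r : R => g (dot xi (z + r *: e))) = g \o (fun r => dot xi z + r * xi 0 i).
  apply/funext => r /=; rewrite dotDr dotZr; congr (g (_ + _ * _)).
  rewrite /dot (bigD1 i)//= big1 ?addr0; first by rewrite mxE !eqxx mulr1.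
  by move=> j ji; rewrite mxE eqxx/= (negbTE ji) mulr0.
rewrite E.
have d1 : is_derive (0 : R) 1 (fun r : R => dot xi z + r * xi 0 i) (xi 0 i).
  apply: is_derive_eq.
  by rewrite scaler0 !add0r mul1r [_%:A]mulr1.
have d2 : is_derive (dot xi z + 0 * xi 0 i) 1 g (g' (dot xi z)).
  by rewrite mul0r addr0.
by rewrite mulrC; exact: (is_derive1_comp (f := g) (g := fun r : R => dot xi z + r * xi 0 i)).
Qed.

(** The product of u and a plane wave decays along with its derivative, which
    therefore integrates to zero. *)
Lemma Rintegral_by_parts u xi : schwartz_real u ->
  xi 0 i * \int[leb d]_z (g' (dot xi z) * u z) =
  - \int[leb d]_z (g (dot xi z) * 'D_e u z).
Proof.
move=> su; have sDu := schwartz_real_partial i su.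
have [M HM] := schwartz_decay su; have [M' HM'] := schwartz_decay sDu.
have mgd : measurable_fun setT (fun z : 'rV[R]_d => g (dot xi z)).
  exact: measurableT_comp mg (measurable_dot xi).
have mgd' : measurable_fun setT (fun z : 'rV[R]_d => g' (dot xi z)).
  exact: measurableT_comp mg' (measurable_dot xi).
pose h := (fun z => g (dot xi z)) * u.
have DhE z : is_derive z e h (xi 0 i * (g' (dot xi z) * u z) + g (dot xi z) * 'D_e u z).
  have dw := is_derive_plane_wave xi z.
  have du : is_derive z e u ('D_e u z) by apply: DeriveDef => //; exact: schwartz_derivable.
  by apply: is_derive_eq; rewrite /GRing.scale /= addrC; congr (_ + _); ring.
have w0 z := ltW (@cauchy_weight_gt0 R d z).
have M0 : 0 <= M.
  by have := le_trans (normr_ge0 _) (HM 0); rewrite pmulr_lge0// cauchy_weight_gt0.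
have M'0 : 0 <= M'.
  by have := le_trans (normr_ge0 _) (HM' 0); rewrite pmulr_lge0// cauchy_weight_gt0.
have mu_ := schwartz_measurable su.
have ni0 : 0 <= `|xi 0 i| by [].
have := @Rintegral_partial_eq0 R d i h (M * (1 + `|xi 0 i|) + M').
move=> /(_ _ _ _ _)/wrap[||||H].
- by move=> z; have := DhE z => dz; exact: ex_derive.
- exact: measurable_funM.
- move=> z; rewrite /h /= normrM.
  apply: (@le_trans _ _ (M * cauchy_weight z)).
    by rewrite (le_trans _ (HM z))// ler_piMl.
  by rewrite ler_wpM2r// mulrDr mulr1 -addrA lerDl addr_ge0// mulr_ge0.
- move=> z; have dz := DhE z; rewrite derive_val.
  apply: (le_trans (ler_normD _ _)); rewrite !normrM mulrDl; apply: lerD.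
    apply: (@le_trans _ _ (`|xi 0 i| * (M * cauchy_weight z))).
      by rewrite ler_wpM2l// (le_trans _ (HM z))// ler_piMl.
    rewrite mulrA ler_wpM2r// mulrC mulrDr mulr1 lerDr//.
  by rewrite (le_trans _ (HM' z))// ler_piMl.
have i1 : (leb d).-integrable setT (EFin \o (fun z => g' (dot xi z) * u z)).
  exact: integrable_mul_schwartz.
have i2 : (leb d).-integrable setT (EFin \o (fun z => g (dot xi z) * 'D_e u z)).
  exact: integrable_mul_schwartz.
apply/eqP; rewrite -subr_eq0 opprK -RintegralZl// -RintegralD//; last exact: integrable_realZl.
apply/eqP; rewrite -[RHS]H; apply: eq_Rintegral => z _.
by have dz := DhE z; rewrite derive_val.
Qed.

End by_parts.

Lemma cos_fourier_partial u i xi : schwartz_real u ->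
  xi 0 i * cos_fourier u xi = - sin_fourier ('D_(delta_mx 0 i : 'rV[R]_d) u) xi.
Proof.
move=> su; apply: (Rintegral_by_parts (g := sin)) => //.
- exact: measurable_sin.
- exact: measurable_cos.
- exact: norm_sin_le1.
- exact: norm_cos_le1.
Qed.

Lemma sin_fourier_partial u i xi : schwartz_real u ->
  xi 0 i * sin_fourier u xi = cos_fourier ('D_(delta_mx 0 i : 'rV[R]_d) u) xi.
Proof.
move=> su.
have := @Rintegral_by_parts cos (fun y => - sin y) i _ _ _ _ _ u xi.
move=> /(_ _ _ _ _ _ su)/wrap[||||H].
- exact: measurable_cos.
- by apply: measurable_funN; exact: measurable_sin.
- exact: norm_cos_le1.
- by move=> x; rewrite normrN norm_sin_le1.
have := H; rewrite /sin_fourier /cos_fourier.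
under eq_Rintegral do rewrite mulNr -mulN1r.
rewrite RintegralZl//; last first.
  by apply: integrable_mul_schwartz => //; [exact: measurable_sin_dot|move=> z; exact: norm_sin_le1].
by rewrite mulN1r mulrN => /oppr_inj.
Qed.

(** Comparable to the modulus of the Fourier transform of u. *)
Definition fourier_amp u xi : R := `|cos_fourier u xi| + `|sin_fourier u xi|.

Lemma fourier_amp_bounded u : schwartz_real u -> exists C : R, forall xi, fourier_amp u xi <= C.
Proof.
move=> su; exists (\int[leb d]_z `|u z| + \int[leb d]_z `|u z|) => xi.
have bnd (g : 'rV[R]_d -> R) : measurable_fun setT g -> (forall z, `|g z| <= 1) ->
    `|\int[leb d]_z (g z * u z)| <= \int[leb d]_z `|u z|.
  move=> mg g1; have ig := integrable_mul_schwartz su mg g1.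
  apply: (le_trans (le_normr_Rintegral _ ig)) => //.
  apply: le_Rintegral => //.
  - apply: (@integrable_dominated _ _ _ _ _ (fun z => `|u z|)).
    + by apply: measurableT_comp => //; apply: measurable_funM => //; exact: schwartz_measurable.
    + by move=> z; rewrite normr_id normrM ler_piMl.
    + exact: integrable_norm_schwartz.
  - exact: integrable_norm_schwartz.
  - by move=> z _; rewrite normrM ler_piMl.
apply: lerD; apply: bnd.
- exact: measurable_cos_dot.
- by move=> z; exact: norm_cos_le1.
- exact: measurable_sin_dot.
- by move=> z; exact: norm_sin_le1.
Qed.

(** Multiplying the transform of u by 1 + xi_j^2 gives that of u minus its second
    derivative along j, and both functions are rapidly decreasing. *)
Lemma fourier_amp_decay u (l : seq 'I_d) : schwartz_real u ->
  exists C : R, forall xi, \prod_(j <- l) oneDsqr (xi 0 j) * fourier_amp u xi <= C.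
Proof.
elim: l u => [|j l IH] u su.
  by have [C HC] := fourier_amp_bounded su; exists C => xi; rewrite big_nil mul1r.
have s1 := schwartz_real_partial j su; have s2 := schwartz_real_partial j s1.
have [C1 H1] := IH _ su; have [C2 H2] := IH _ s2; exists (C1 + C2) => xi.
apply: le_trans (lerD (H1 xi) (H2 xi)).
rewrite big_cons -mulrDr mulrAC [leRHS]mulrC.
have P0 : 0 <= \prod_(k <- l) oneDsqr (xi 0 k).
  by apply: prodr_ge0 => k _; rewrite (le_trans ler01).
rewrite ler_wpM2r// /oneDsqr mulrDl mul1r lerD2l /fourier_amp.
have -> : cos_fourier ('D_(delta_mx 0 j : 'rV[R]_d) ('D_(delta_mx 0 j : 'rV[R]_d) u)) xi =
    - (xi 0 j ^+ 2 * cos_fourier u xi).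
  by rewrite -sin_fourier_partial// expr2 -mulrA cos_fourier_partial// mulrN opprK.
have -> : sin_fourier ('D_(delta_mx 0 j : 'rV[R]_d) ('D_(delta_mx 0 j : 'rV[R]_d) u)) xi =
    - (xi 0 j ^+ 2 * sin_fourier u xi).
  by apply: oppr_inj; rewrite -cos_fourier_partial// opprK expr2 -mulrA sin_fourier_partial.
have x2 : `|xi 0 j ^+ 2| = xi 0 j ^+ 2 by rewrite ger0_norm// sqr_ge0.
by rewrite !normrN !(normrM (xi 0 j ^+ 2)) x2 mulrDr.
Qed.

(** Every coordinate is used twice in the decay: one product of the factors
    1 + xi_j^2 dominates 1 + |xi|^2, the other gives integrability. *)
Lemma fourier_amp_le u : schwartz_real u ->
  exists C : R, forall xi, (1 + dot xi xi) * fourier_amp u xi <= C * cauchy_weight xi.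
Proof.
move=> su; have [C HC] := fourier_amp_decay (index_enum 'I_d ++ index_enum 'I_d) su.
exists C => xi; have := HC xi.
rewrite big_cat /= -!cauchy_weightV => H.
have w0 := cauchy_weight_gt0 xi.
have A0 : 0 <= fourier_amp u xi by rewrite addr_ge0.
apply: (@le_trans _ _ ((cauchy_weight xi)^-1 * fourier_amp u xi)).
  by rewrite ler_wpM2r// cauchy_weightV prod_oneDsqr_le.
rewrite mulrC -ler_pdivrMr//; apply: le_trans H.
by rewrite -[leLHS]mulrA [leLHS]mulrC.
Qed.

Lemma measurable_cos_fourier u : schwartz_real u -> measurable_fun setT (cos_fourier u).
Proof.
move=> su; apply: (@measurable_Rintegral_param R _ _ _ _ (leb d) (fun xi z => cos (dot xi z) * u z)).
apply: measurable_funM.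
  apply: (measurableT_comp measurable_cos); exact: measurable_dot2.
exact: measurableT_comp (schwartz_measurable su) measurable_snd.
Qed.

Lemma measurable_sin_fourier u : schwartz_real u -> measurable_fun setT (sin_fourier u).
Proof.
move=> su; apply: (@measurable_Rintegral_param R _ _ _ _ (leb d) (fun xi z => sin (dot xi z) * u z)).
apply: measurable_funM.
  apply: (measurableT_comp measurable_sin); exact: measurable_dot2.
exact: measurableT_comp (schwartz_measurable su) measurable_snd.
Qed.

Lemma measurable_fourier_amp u : schwartz_real u -> measurable_fun setT (fourier_amp u).
Proof.
move=> su; apply: measurable_funD; apply: measurableT_comp => //.
  exact: measurable_cos_fourier.
exact: measurable_sin_fourier.
Qed.

Lemma fourier_amp_ge0 u xi : 0 <= fourier_amp u xi.
Proof. by rewrite addr_ge0. Qed.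

Lemma integrable_moment_fourier_amp u : schwartz_real u ->
  (leb d).-integrable setT (EFin \o (fun xi => (1 + dot xi xi) * fourier_amp u xi)).
Proof.
move=> su; have [C HC] := fourier_amp_le su.
apply: (@integrable_dominated _ _ _ _ _ (fun xi => C * cauchy_weight xi)).
- apply: measurable_funM; last exact: measurable_fourier_amp.
  by apply: measurable_funD => //; exact: measurable_dot_self.
- by move=> xi; rewrite ger0_norm// mulr_ge0 ?fourier_amp_ge0// addr_ge0 ?dot_ge0.
- by apply: integrable_realZl; exact: integrable_cauchy_weight.
Qed.

Lemma enorm_powR_le (alpha : R) xi : 0 < alpha < 1 ->
  enorm xi `^ (2 * alpha) <= 1 + dot xi xi.
Proof.
move=> /andP[a0 a1]; rewrite enorm_powR (_ : 2 * alpha / 2 = alpha); last by field.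
have D0 := dot_ge0 xi.
apply: (@le_trans _ _ ((1 + dot xi xi) `^ alpha)).
  by apply: ge0_ler_powR; rewrite ?nnegrE ?(ltW a0) ?addr_ge0// lerDr.
rewrite -[leRHS]powRr1 ?addr_ge0//; apply: ler_powR; last exact: ltW.
by rewrite lerDl.
Qed.

(** The real part of exp(-i xi.x) times the Fourier transform of u. *)
Definition fourier_wave u x xi : R :=
  cos (dot xi x) * cos_fourier u xi + sin (dot xi x) * sin_fourier u xi.

Lemma fourier_wave_le u x xi : `|fourier_wave u x xi| <= fourier_amp u xi.
Proof.
apply: (le_trans (ler_normD _ _)); rewrite !normrM; apply: lerD; rewrite ler_piMl//.
  exact: norm_cos_le1.
exact: norm_sin_le1.
Qed.

Lemma measurable_fourier_wave u x : schwartz_real u -> measurable_fun setT (fourier_wave u x).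
Proof.
have mdx : measurable_fun setT (fun xi : 'rV[R]_d => dot xi x).
  rewrite (_ : (fun _ => _) = dot x); first exact: measurable_dot.
  by apply/funext => xi; rewrite dotC.
move=> su; apply: measurable_funD; apply: measurable_funM.
- exact: measurableT_comp measurable_cos mdx.
- exact: measurable_cos_fourier.
- exact: measurableT_comp measurable_sin mdx.
- exact: measurable_sin_fourier.
Qed.

Lemma integrable_mul_fourier_amp u (g : 'rV[R]_d -> R) : schwartz_real u ->
  measurable_fun setT g -> (forall xi, `|g xi| <= (1 + dot xi xi) * fourier_amp u xi) ->
  (leb d).-integrable setT (EFin \o g).
Proof. by move=> su mg gle; exact: integrable_dominated (integrable_moment_fourier_amp su). Qed.

Lemma integrable_fourier_wave u x : schwartz_real u ->
  (leb d).-integrable setT (EFin \o fourier_wave u x).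
Proof.
move=> su; apply: (integrable_mul_fourier_amp su); first exact: measurable_fourier_wave.
move=> xi; rewrite (le_trans (fourier_wave_le _ _ _))// ler_peMl ?fourier_amp_ge0//.
by rewrite lerDl dot_ge0.
Qed.

End schwartz_transforms.

(** * Fourier inversion *)

Section inversion.
Context {R : realType} {d : nat}.
Implicit Types (u : 'rV[R]_d -> R) (v xi z x : 'rV[R]_d).

Lemma norm_ge_dot (r : R) v : 0 < r -> r <= `|v| -> r ^+ 2 <= dot v v.
Proof.
move=> r0 rv; rewrite leNgt; apply/negP => vr.
have : `|v| <= Num.sqrt (dot v v).
  apply: rV_norm_le => [|i]; first exact: sqrtr_ge0.
  by rewrite -sqrtr_sqr ler_wsqrtr// sqr_coord_le_dot.
apply/negP; rewrite -ltNge; apply: lt_le_trans rv.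
by rewrite -(ger0_norm (ltW r0)) -sqrtr_sqr ltr_sqrt// exprn_gt0.
Qed.

(** A bounded function continuous at x has modulus e / 2 + K |v|^2 there, where the
    quadratic term takes over at the distance r given by continuity. *)
Lemma cvg_gauss_kernel u (M : R) x : continuous u -> (forall z, `|u z| <= M) ->
  \int[leb d]_v (u (v + x) * gauss_density n.+1%:R^-1 v) @[n --> \oo] --> u x.
Proof.
move=> cu uM; have mu := continuous_measurable_rV cu.
have M0 : 0 <= M := le_trans (normr_ge0 _) (uM 0).
apply/cvgrPdist_le => e e0.
have e2 : 0 < e / 2 by rewrite divr_gt0.
have /cvgrPdist_lt/(_ _ e2)/nbhs_ballP[r /= r0 hr] := cu x.
pose K := M *+ 2 / r ^+ 2.
have K0 : 0 <= K by rewrite divr_ge0 ?mulrn_wge0// sqr_ge0.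
have bnd v : `|u (v + x) - u x| <= e / 2 + K * dot v v.
  have [vr|rv] := ltP `|v| r.
    have KD : 0 <= K * dot v v by rewrite mulr_ge0// dot_ge0.
    apply: ler_wpDr => //; rewrite distrC; apply: ltW; apply: (hr (v + x)).
    by rewrite -ball_normE /= opprD addrCA subrr addr0 normrN.
  rewrite ler_wpDl ?(ltW e2)//; apply: (@le_trans _ _ (M *+ 2)).
    by rewrite (le_trans (ler_normB _ _))// mulr2n lerD.
  rewrite /K mulrAC ler_pdivlMr ?exprn_gt0// ler_wpM2l ?mulrn_wge0//.
  exact: norm_ge_dot.
near=> n.
have s0 : 0 < n.+1%:R^-1 :> R by [].
rewrite distrC (le_trans (gauss_kernel_error s0 mu uM bnd))//.
rewrite [leRHS](splitr e) lerD2l.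
have n0 : 0 < n.+1%:R :> R by [].
have n1 : (n.+1%:R^-1 : R) <= 1 by rewrite invf_le1// ler1n.
apply: (@le_trans _ _ (K * (n.+1%:R^-1 *+ d))).
  by rewrite ler_wpM2l// lerMn2r -[leRHS]mulr1 expr2 ler_pM2l// n1 orbT.
rewrite -[_ *+ d]mulr_natr mulrCA ler_pdivrMl// mulrC -ler_pdivrMr//.
apply: ltW; apply: lt_le_trans (_ : n%:R <= _); last by rewrite ler_nat.
by near: n; exact: nbhs_infty_gtr.
Unshelve. all: by end_near. Qed.

Lemma fourier_waveE u x xi : schwartz_real u ->
  fourier_wave u x xi = \int[leb d]_z (cos (dot xi (z - x)) * u z).
Proof.
move=> su; rewrite /fourier_wave /cos_fourier /sin_fourier.
have ic : (leb d).-integrable setT (EFin \o (fun z => cos (dot xi z) * u z)).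
  by apply: integrable_mul_schwartz => //; [exact: measurable_cos_dot|move=> z; exact: norm_cos_le1].
have is_ : (leb d).-integrable setT (EFin \o (fun z => sin (dot xi z) * u z)).
  by apply: integrable_mul_schwartz => //; [exact: measurable_sin_dot|move=> z; exact: norm_sin_le1].
rewrite -!RintegralZl// -RintegralD//; last 2 first.
- exact: integrable_realZl.
- exact: integrable_realZl.
by apply: eq_Rintegral => z _; rewrite dotDr dotNr cosB; ring.
Qed.

Lemma normal_peak_inv (e : R) : 0 < e -> normal_peak e * normal_peak e^-1 = (2 * pi)^-1.
Proof.
move=> e0; rewrite /normal_peak -invfM; congr (_^-1).
rewrite -sqrtrM; last by rewrite mulrn_wge0// mulr_ge0 ?pi_ge0// sqr_ge0.
have -> : e ^+ 2 * pi *+ 2 * (e^-1 ^+ 2 * pi *+ 2) = (2 * pi) ^+ 2.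
  by rewrite -mulr_natr -[X in _ * X = _]mulr_natr; field; rewrite gt_eqF.
by rewrite sqrtr_sqr ger0_norm// mulr_ge0// pi_ge0.
Qed.

(** Against a Gaussian weight the inversion integral is absolutely convergent as
    a double integral; the transform of the weight is a narrow Gaussian. *)
Lemma fourier_wave_gauss u x (e : R) : 0 < e -> schwartz_real u ->
  \int[leb d]_xi (expR (- (e ^+ 2 * dot xi xi / 2)) * fourier_wave u x xi) =
  (2 * pi) ^+ d * \int[leb d]_v (u (v + x) * gauss_density e v).
Proof.
move=> e0 su; have s0 : 0 < e^-1 by rewrite invr_gt0.
have e_neq0 : e != 0 by rewrite gt_eqF.
pose k := normal_peak e^-1 ^+ d; pose k' := normal_peak e ^+ d.
have k0 : k != 0 by rewrite expf_neq0// gt_eqF// normal_peak_gt0// gt_eqF.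
have k'0 : k' != 0 by rewrite expf_neq0// gt_eqF// normal_peak_gt0// gt_eqF.
have kk : (2 * pi) ^+ d = k'^-1 * k^-1.
  by rewrite -invfM -exprMn normal_peak_inv// exprVn invrK.
have mu := schwartz_measurable su.
have mgs : measurable_fun setT (@gauss_density R e^-1 d).
  exact: (@measurable_gauss_density R e^-1 d).
have igs : (leb d).-integrable setT (EFin \o @gauss_density R e^-1 d).
  exact: integrable_gauss_density.
have mc : measurable_fun setT (fun p : 'rV[R]_d * 'rV[R]_d => cos (dot p.1 (p.2 - x))).
  apply: (measurableT_comp measurable_cos).
  apply: (@measurableT_comp _ _ _ _ _ _ (fun p : 'rV[R]_d * 'rV[R]_d => dot p.1 p.2) _
    (fun p : 'rV[R]_d * 'rV[R]_d => (p.1, p.2 - x))); first exact: measurable_dot2.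
  apply: measurable_fun_pair; first exact: measurable_fst.
  exact: measurableT_comp (measurable_rV_shift (- x)) measurable_snd.
have [C HC] := fourier_amp_bounded su.
have iFg : (leb d).-integrable setT (EFin \o (fun xi => fourier_wave u x xi * gauss_density e^-1 xi)).
  apply: (@integrable_mul_gauss R d e^-1 _ C); first exact: measurable_fourier_wave.
  by move=> xi; exact: le_trans (fourier_wave_le _ _ _) (HC xi).
transitivity (k^-1 * \int[leb d]_xi \int[leb d]_z
    (gauss_density e^-1 xi * (cos (dot xi (z - x)) * u z))).
  transitivity (k^-1 * \int[leb d]_xi (fourier_wave u x xi * gauss_density e^-1 xi)).
    rewrite -RintegralZl//; apply: eq_Rintegral => xi _.
    rewrite gauss_densityE// mulrCA [RHS]mulrC mulrA mulVf// mul1r; congr (expR (- _) * _).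
    by rewrite -mulr_natr; field.
  congr (_ * _); apply: eq_Rintegral => xi _; rewrite RintegralZl//; last first.
    apply: integrable_mul_schwartz => //; last by move=> z; exact: norm_cos_le1.
    exact: (measurable_comp _ _ mc (pair1_measurable xi)).
  by rewrite -fourier_waveE// mulrC.
rewrite (@Rintegral_exchange_prod R _ _ _ _ (leb d) (leb d)
   (fun xi z => gauss_density e^-1 xi * (cos (dot xi (z - x)) * u z))
   (@gauss_density R e^-1 d) (fun z => `|u z|)); first last.
- by move=> z.
- by move=> xi; exact: gauss_density_ge0.
- move=> xi z; rewrite !normrM [`|gauss_density _ _|]ger0_norm ?gauss_density_ge0//.
  by rewrite ler_wpM2l ?gauss_density_ge0// ler_piMl// norm_cos_le1.
- exact: integrable_norm_schwartz.
- exact: igs.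
- apply: measurable_funM; first exact: measurableT_comp mgs measurable_fst.
  apply: measurable_funM => //.
  exact: measurableT_comp mu measurable_snd.
rewrite kk -mulrA mulrCA; congr (_ * _).
transitivity (\int[leb d]_z (k'^-1 * (u z * gauss_density e (z - x)))).
  apply: eq_Rintegral => z _.
  under eq_Rintegral do rewrite dotC mulrA mulrC [X in _ * X]mulrC.
  rewrite RintegralZl//; last first.
    apply: (@integrable_mul_gauss R d e^-1 _ 1); first exact: measurable_cos_dot.
    by move=> v; exact: norm_cos_le1.
  rewrite Rintegral_cos_gauss// gauss_densityE// -/k' mulrCA mulKf//.
  by congr (_ * expR (- _)); rewrite -mulr_natr; field.
have mge : measurable_fun setT (fun z : 'rV[R]_d => gauss_density e (z - x)).
  apply: (measurableT_comp (@measurable_gauss_density R e d)).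
  exact: measurable_rV_shift.
have iug : (leb d).-integrable setT (EFin \o (fun z => u z * gauss_density e (z - x))).
  apply: (@integrable_dominated _ _ _ _ _ (fun z => k' * `|u z|)).
  - exact: measurable_funM.
  - move=> z; rewrite normrM mulrC; apply: ler_wpM2r; first exact: normr_ge0.
    rewrite ger0_norm; last exact: gauss_density_ge0.
    rewrite (gauss_densityE e0) ler_piMr ?exprn_ge0 ?normal_peak_ge0//.
    by rewrite -[leRHS]expR0 ler_expR oppr_le0 divr_ge0 ?dot_ge0// mulrn_wge0// sqr_ge0.
  - by apply: integrable_realZl; exact: integrable_norm_schwartz.
rewrite RintegralZl; [|exact: measurableT|exact: iug]; congr (_ * _).
have mug : measurable_fun setT (fun z => (u z * gauss_density e (z - x))%:E).
  exact: measurable_int iug.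
rewrite /Rintegral -(integral_leb_shift x mug).
by congr fine; apply: eq_integral => v _; rewrite addrK.
Qed.

(** The Gaussian weight is removed by dominated convergence, the transform of u
    being integrable. *)
Theorem fourier_inversion u x : schwartz_real u ->
  \int[leb d]_xi fourier_wave u x xi = (2 * pi) ^+ d * u x.
Proof.
move=> su; have [_ _ /(_ [::] 0%N)[M HM]] := su.
have uM z : `|u z| <= M by have := HM z; rewrite expr0 mul1r.
have cu := schwartz_continuous su.
pose G n xi : R := expR (- (n.+1%:R^-1 ^+ 2 * dot xi xi / 2)) * fourier_wave u x xi.
have mF := measurable_fourier_wave x su.
have iF := integrable_fourier_wave x su.
have H1 : \int[leb d]_xi G n xi @[n --> \oo] --> (2 * pi) ^+ d * u x.
  rewrite (_ : (fun n => _) = (fun n => (2 * pi) ^+ d *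
      \int[leb d]_v (u (v + x) * gauss_density n.+1%:R^-1 v))); last first.
    by apply/funext => n; rewrite /G fourier_wave_gauss.
  by apply: cvgM; [exact: cvg_cst|exact: cvg_gauss_kernel uM].
have H2 : \int[leb d]_xi G n xi @[n --> \oo] --> \int[leb d]_xi fourier_wave u x xi.
  apply: fine_cvg; rewrite fineK; last exact: integrable_fin_num iF.
  have := @dominated_convergence _ _ R (leb d) setT measurableT (fun n => EFin \o G n)
    (EFin \o fourier_wave u x) (EFin \o (fun xi => `|fourier_wave u x xi|)).
  move=> /(_ _ _ _ _ _)/wrap[|||||[_ _ H]//].
  - move=> n; apply/measurable_EFinP; apply: measurable_funM => //.
    apply: (measurableT_comp (@measurable_expR R)); apply: measurable_funN.
    by apply: measurable_funM => //; apply: measurable_funM => //; exact: measurable_dot_self.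
  - exact/measurable_EFinP.
  - apply: aeW => xi _; apply: cvg_EFin; first exact: nearW.
    rewrite -[X in _ --> X]mul1r; apply: cvgM; last exact: cvg_cst.
    rewrite -[X in _ --> X]expR0; apply: continuous_cvg; first exact: continuous_expR.
    rewrite -[X in _ --> X]oppr0; apply: cvgN.
    rewrite -(mul0r (2^-1 : R)); apply: cvgM; last exact: cvg_cst.
    rewrite -(mul0r (dot xi xi)); apply: cvgM; last exact: cvg_cst.
    rewrite -[X in _ --> X](mul0r 0).
    rewrite (_ : (fun k => _) = (fun k : nat => k.+1%:R^-1 * k.+1%:R^-1)); last first.
      by apply/funext => k; rewrite expr2.
    by apply: cvgM; exact: cvg_harmonic.
  - by have := integrable_abse iF.
  - apply: aeW => xi n _; rewrite /= lee_fin normrM ler_piMl//.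
    rewrite ger0_norm ?expR_ge0// -[leRHS]expR0 ler_expR oppr_le0.
    by rewrite divr_ge0// mulr_ge0 ?sqr_ge0 ?dot_ge0.
exact: cvg_unique H2 H1.
Qed.

End inversion.

(** * The fractional Laplacian as a Fourier multiplier *)

Section fractional_laplacian.
Context {R : realType} {d : nat}.
Implicit Types (u : 'rV[R]_d -> R) (y xi z x : 'rV[R]_d).
Variables (alpha : R) (i : 'I_d).
Hypothesis alpha_01 : 0 < alpha < 1.

Lemma Rintegral_leb_odd (g : 'rV[R]_d -> R) : measurable_fun setT g ->
  (leb d).-integrable setT (EFin \o g) -> (forall v, g (- v) = - g v) ->
  \int[leb d]_v g v = 0.
Proof.
move=> mg ig gN.
have E : \int[leb d]_v g v = - \int[leb d]_v g v.
  rewrite -mulN1r -RintegralZl// /Rintegral -(@integral_lebN R d (EFin \o g)).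
    by congr fine; apply: eq_integral => v _; rewrite mulN1r /= gN.
  exact/measurable_EFinP.
by apply/eqP; rewrite -[_ == _](@mulrn_eq0 _ _ 2) mulr2n {1}E addNr.
Qed.

Let rho y : R := (enorm y `^ (2 * alpha + d%:R))^-1.

Let mrho : measurable_fun setT rho.
Proof. exact: measurable_inv_enorm_powR. Qed.

Let rho0 y : 0 <= rho y. Proof. by rewrite invr_ge0 powR_ge0. Qed.

Lemma fourier_wave_second_difference u x y xi :
  fourier_wave u (x + y) xi + fourier_wave u (x - y) xi - 2 * fourier_wave u x xi =
  - 2 * ((1 - cos (dot xi y)) * fourier_wave u x xi).
Proof. by rewrite /fourier_wave !dotDr dotNr cosB sinB cosD sinD; ring. Qed.

Let icos xi : (leb d).-integrable setT (EFin \o (fun y => (1 - cos (dot xi y)) * rho y)).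
Proof.
have m : measurable_fun setT (fun y => (1 - cos (dot xi y)) * rho y).
  by apply: measurable_funM => //; exact: measurable_onem_cos.
apply/integrableP; split; first exact/measurable_EFinP.
under eq_integral do rewrite /= ger0_norm ?mulr_ge0 ?onem_cos_ge0//.
have := cosine_exponentE alpha_01 i xi; rewrite /cosine_exponent => ->.
exact: ltry.
Qed.

Let Rintegral_cos xi : \int[leb d]_y ((1 - cos (dot xi y)) * rho y) =
  cos_integral alpha i * enorm xi `^ (2 * alpha).
Proof.
by have := cosine_exponentE alpha_01 i xi; rewrite /cosine_exponent /Rintegral => ->.
Qed.

Let menorm : measurable_fun setT (fun xi : 'rV[R]_d => enorm xi `^ (2 * alpha)).
Proof. exact: measurableT_comp (@measurable_powR R _) (@measurable_enorm R d). Qed.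

Lemma integrable_symbol_wave u x : schwartz_real u ->
  (leb d).-integrable setT (EFin \o (fun xi => enorm xi `^ (2 * alpha) * fourier_wave u x xi)).
Proof.
move=> su; apply: (integrable_mul_fourier_amp su).
  by apply: measurable_funM => //; exact: measurable_fourier_wave.
move=> xi; rewrite normrM ler_pM// ?fourier_wave_le//.
by rewrite ger0_norm ?powR_ge0// enorm_powR_le.
Qed.

(** Second differences of u are averages over xi of 1 - cos(xi.y) times the wave,
    the symbol is the average over y of 1 - cos(xi.y), and the two averages
    commute. *)
Theorem Rintegral_second_difference u x : schwartz_real u ->
  \int[leb d]_y ((u (x + y) + u (x - y) - 2 * u x) * rho y) =
  - 2 * ((2 * pi) ^- d * (cos_integral alpha i *
    \int[leb d]_xi (enorm xi `^ (2 * alpha) * fourier_wave u x xi))).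
Proof.
move=> su; have iF z := integrable_fourier_wave z su.
have mF := measurable_fourier_wave x su.
have pi_n0 : (2 * pi : R) ^+ d != 0 by rewrite expf_neq0// mulf_neq0// gt_eqF// pi_gt0.
have inv z : u z = (2 * pi) ^- d * \int[leb d]_xi fourier_wave u z xi.
  by rewrite fourier_inversion// mulKf.
pose g xi y := (1 - cos (dot xi y)) * rho y * fourier_wave u x xi.
have ig1 xi : (leb d).-integrable setT (EFin \o g xi).
  rewrite (_ : _ \o _ = EFin \o (fun y => fourier_wave u x xi * ((1 - cos (dot xi y)) * rho y))).
    exact: integrable_realZl.
  by apply/funext => y; rewrite /g /= mulrC.
have mcF y : measurable_fun setT (fun xi => (1 - cos (dot xi y)) * fourier_wave u x xi).
  apply: measurable_funM => //; rewrite (_ : (fun _ => _) = (fun xi => 1 - cos (dot y xi))).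
    exact: measurable_onem_cos.
  by apply/funext => xi; rewrite dotC.
have icF y : (leb d).-integrable setT (EFin \o (fun xi => (1 - cos (dot xi y)) * fourier_wave u x xi)).
  apply: (@integrable_dominated _ _ _ _ _ (fun xi => 2 * ((1 + dot xi xi) * fourier_amp u xi))) => //.
    move=> xi; rewrite normrM ger0_norm ?onem_cos_ge0//.
    apply: ler_pM; rewrite ?onem_cos_ge0//; first by have := cos_geN1 (dot xi y); lra.
    rewrite (le_trans (fourier_wave_le _ _ _))// ler_peMl ?fourier_amp_ge0//.
    by rewrite lerDl dot_ge0.
  by apply: integrable_realZl; exact: integrable_moment_fourier_amp.
have ig2 y : (leb d).-integrable setT (EFin \o g ^~ y).
  rewrite (_ : _ \o _ = EFin \o (fun xi => rho y * ((1 - cos (dot xi y)) * fourier_wave u x xi))).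
    exact: integrable_realZl.
  by apply/funext => xi; rewrite /g /= mulrAC mulrC.
have mg : measurable_fun setT (fun p : 'rV[R]_d * 'rV[R]_d => g p.1 p.2).
  apply: measurable_funM; last exact: measurableT_comp mF measurable_fst.
  apply: measurable_funM; last exact: measurableT_comp mrho measurable_snd.
  apply: measurable_funB => //; apply: (measurableT_comp measurable_cos).
  exact: measurable_dot2.
have goo : (\int[leb d]_xi \int[leb d]_y (`|g xi y|)%:E < +oo)%E.
  rewrite (_ : (\int[leb d]_xi _)%E = (\int[leb d]_xi
    (cos_integral alpha i * `|enorm xi `^ (2 * alpha) * fourier_wave u x xi|)%:E)%E).
    have := integrable_realZl (cos_integral alpha i) (integrable_abse (integrable_symbol_wave x su)).
    move=> /integrableP[_]; apply: le_lt_trans; apply: ge0_le_integral => //.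
    - by move=> xi _; rewrite lee_fin mulr_ge0// ltW// cos_integral_gt0.
    - apply/measurable_EFinP; apply: measurable_funM => //.
      by apply: measurableT_comp => //; apply: measurable_funM.
    - apply: measurableT_comp => //; apply/measurable_EFinP; apply: measurable_funM => //.
      by apply: measurableT_comp => //; apply: measurable_funM.
    - by move=> xi _; rewrite /= lee_fin ler_norm.
  apply: eq_integral => xi _.
  transitivity ((\int[leb d]_y (`|fourier_wave u x xi| * ((1 - cos (dot xi y)) * rho y))%:E)%E).
    apply: eq_integral => y _; rewrite /g normrM mulrC [`|(1 - _) * _|]ger0_norm//.
    by rewrite mulr_ge0 ?onem_cos_ge0.
  rewrite -[LHS]fineK; last exact: integrable_fin_num (integrable_realZl _ (icos xi)).
  rewrite -/(Rintegral _ _ _) RintegralZl// Rintegral_cos; congr EFin.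
  by rewrite normrM [`|enorm _ `^ _|]ger0_norm ?powR_ge0//; ring.
have L : \int[leb d]_xi \int[leb d]_y g xi y =
    cos_integral alpha i * \int[leb d]_xi (enorm xi `^ (2 * alpha) * fourier_wave u x xi).
  rewrite -RintegralZl; [|exact: measurableT|exact: integrable_symbol_wave].
  apply: eq_Rintegral => xi _.
  rewrite /g; under eq_Rintegral do rewrite mulrC.
  by rewrite RintegralZl// Rintegral_cos; ring.
rewrite -L (Rintegral_exchange mg ig1 ig2 goo).
have ic2 y : (leb d).-integrable setT (EFin \o (fun xi => - 2 * ((1 - cos (dot xi y)) * fourier_wave u x xi))).
  exact: integrable_realZl.
have D y : (u (x + y) + u (x - y) - 2 * u x) * rho y =
    (- 2 * (2 * pi) ^- d) * \int[leb d]_xi g xi y.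
  have -> : \int[leb d]_xi g xi y = rho y * \int[leb d]_xi ((1 - cos (dot xi y)) * fourier_wave u x xi).
    rewrite -RintegralZl//; apply: eq_Rintegral => xi _.
    by rewrite /g mulrAC mulrC.
  rewrite (inv (x + y)) (inv (x - y)) (inv x).
  have -> : \int[leb d]_xi ((1 - cos (dot xi y)) * fourier_wave u x xi) =
      - 2^-1 * (\int[leb d]_xi fourier_wave u (x + y) xi + \int[leb d]_xi fourier_wave u (x - y) xi
       - 2 * \int[leb d]_xi fourier_wave u x xi).
    rewrite -RintegralZl// -RintegralD// -RintegralB//; last 2 first.
    - exact: integrable_realD.
    - exact: integrable_realZl.
    under [in RHS]eq_Rintegral do rewrite fourier_wave_second_difference.
    by rewrite RintegralZl// mulrA mulrNN mulVf// mul1r.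
  by field.
under eq_Rintegral do rewrite D.
rewrite RintegralZl//; first by ring.
apply: (integrable_Rintegral_param (m1 := leb d)) goo => //.
Qed.

(** The imaginary part of exp(-i xi.x) times the Fourier transform of u. *)
Definition fourier_wave_im u x xi : R :=
  cos (dot xi x) * sin_fourier u xi - sin (dot xi x) * cos_fourier u xi.

(** The symbol is even in xi and the imaginary part is odd. *)
Lemma Rintegral_symbol_wave_im u x : schwartz_real u ->
  (leb d).-integrable setT (EFin \o (fun xi => enorm xi `^ (2 * alpha) * fourier_wave_im u x xi)) /\
  \int[leb d]_xi (enorm xi `^ (2 * alpha) * fourier_wave_im u x xi) = 0.
Proof.
move=> su.
have mdx : measurable_fun setT (fun xi : 'rV[R]_d => dot xi x).
  rewrite (_ : (fun _ => _) = dot x); first exact: measurable_dot.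
  by apply/funext => xi; rewrite dotC.
have m : measurable_fun setT (fun xi => enorm xi `^ (2 * alpha) * fourier_wave_im u x xi).
  apply: measurable_funM => //; apply: measurable_funB; apply: measurable_funM.
  - exact: measurableT_comp measurable_cos mdx.
  - exact: measurable_sin_fourier.
  - exact: measurableT_comp measurable_sin mdx.
  - exact: measurable_cos_fourier.
have ii : (leb d).-integrable setT (EFin \o (fun xi => enorm xi `^ (2 * alpha) * fourier_wave_im u x xi)).
  apply: (integrable_mul_fourier_amp su) => // xi.
  rewrite normrM ler_pM//; first by rewrite ger0_norm ?powR_ge0// enorm_powR_le.
  apply: (le_trans (ler_normB _ _)); rewrite !normrM [fourier_amp _ _]addrC.
  by apply: lerD; rewrite ler_piMl// ?norm_cos_le1// norm_sin_le1.
split=> //; apply: Rintegral_leb_odd => // xi.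
have cN : cos_fourier u (- xi) = cos_fourier u xi.
  by apply: eq_Rintegral => z _; rewrite dotNl cosN.
have sN : sin_fourier u (- xi) = - sin_fourier u xi.
  rewrite /sin_fourier -mulN1r -RintegralZl//.
    by apply: eq_Rintegral => z _; rewrite dotNl sinN; ring.
  by apply: integrable_mul_schwartz => //; [exact: measurable_sin_dot|move=> z; exact: norm_sin_le1].
have eN : enorm (- xi) = enorm xi by rewrite /enorm dotNl dotNr opprK.
by rewrite /fourier_wave_im cN sN eN dotNl cosN sinN; ring.
Qed.

End fractional_laplacian.

(** * The generator of the limit process *)

Section time_change.
Context {R : realType} {d0} {Om : measurableType d0} (P : probability Om R).
Context {d : nat}.
Variables (S : R -> {RV P >-> 'rV[R]_d}) (K : R).
Hypothesis K0 : 0 <= K.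

Lemma levy_process_time_change : levy_process S -> levy_process (fun t => S (K * t)).
Proof.
move=> [S0 indep stat sc]; split.
- by rewrite mulr0.
- move=> t [t0 nt]; apply: (indep (fun j => K * t j)); split.
    by rewrite mulr_ge0.
  by move=> a b ab; rewrite ler_wpM2l// nt.
- by move=> s h B s0 h0 mB; rewrite mulrDr; apply: stat; rewrite ?mulr_ge0.
- move=> t e t0 e0; have := sc (K * t) e (mulr_ge0 K0 t0) e0.
  apply: (cvg_comp (fun s => K * s)) => A /=; rewrite !nbhs_nearE.
  rewrite near_withinE => HA.
  have H : \forall s \near t, 0 <= K * s -> A (K * s) := @mulrl_continuous R K t _ HA.
  by near=> s => s0 /=; apply: (near H s) => //; exact: mulr_ge0.
Unshelve. all: by end_near. Qed.

Lemma fourier_symbol_time_change alpha : 0 < alpha -> isotropic_stable alpha S ->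
  fourier_symbol (fun t => S (K * t)) (fun xi => (K * enorm xi `^ (2 * alpha))%:C%C).
Proof.
move=> a0 [_ cf] xi; pose r := enorm xi `^ (2 * alpha).
have E t : 0 <= t -> char_fun P (S (K * t)) xi = (expR (- (K * r) * t))%:C%C.
  by move=> t0; rewrite cf ?mulr_ge0//; congr (expR _)%:C%C; rewrite /r; ring.
have E0 : char_fun P (S (K * 0)) xi = 1%:C%C.
  by rewrite E// mulr0 expR0.
rewrite E0; split.
- rewrite [complex.Re (_%:C%C)]/= -/r.
  have de : is_derive (0 : R) 1 (fun t : R => expR (- (K * r) * t)) (- (K * r)).
    apply: is_derive_eq.
    by rewrite mulr0 expR0 mul1r [_%:A]mulr1.
  have dl : (fun h : R => h^-1 *: (((fun t : R => expR (- (K * r) * t)) \o shift 0) (h *: 1) -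
      expR (- (K * r) * 0))) h @[h --> 0^'] --> - (K * r).
    have dv := @derive_val _ _ _ _ _ _ _ de; have dx := @ex_derive _ _ _ _ _ _ _ de.
    by rewrite -[X in _ --> X]dv; exact: dx.
  have dr := cvg_dnbhs_at_right dl.
  apply: cvg_trans dr; apply: near_eq_cvg; near=> t.
  rewrite E ?ltW//= mulr0 expR0 addr0 [t *: 1]mulr1 mulrC.
  by rewrite [RHS]mulrC.
- rewrite [complex.Im (_%:C%C)]/= oppr0; apply: cvg_near_cst; near=> t.
  by rewrite E ?ltW//= subrr mul0r.
Unshelve. all: by end_near.
Qed.

End time_change.

Section generator.
Context {R : realType} {d : nat}.
Variables (alpha K : R) (i : 'I_d).
Hypothesis alpha_01 : 0 < alpha < 1.

Let ReMr (z : R[i]) (r : R) : complex.Re (z * r%:C%C) = complex.Re z * r.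
Proof. by case: z => a b /=; rewrite mulr0 subr0. Qed.

Let ImMr (z : R[i]) (r : R) : complex.Im (z * r%:C%C) = complex.Im z * r.
Proof. by case: z => a b /=; rewrite mulr0 add0r. Qed.

Let Re2 (a b c : R[i]) : complex.Re (a + b - 2 * c) =
  complex.Re a + complex.Re b - 2 * complex.Re c.
Proof. by rewrite mulr_natl mulr2n; case: a b c => [? ?] [? ?] [? ?] /=; ring. Qed.

Let Im2 (a b c : R[i]) : complex.Im (a + b - 2 * c) =
  complex.Im a + complex.Im b - 2 * complex.Im c.
Proof. by rewrite mulr_natl mulr2n; case: a b c => [? ?] [? ?] [? ?] /=; ring. Qed.

Let MC (a b c : R) : a%:C%C * Complex b c = Complex (a * b) (a * c).
Proof. by apply/eqP; rewrite eq_complex /= !mul0r subr0 addr0 !eqxx. Qed.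

Let NC (b c : R) : - Complex b c = Complex (- b) (- c).
Proof. by []. Qed.

Let cancel (a b c t : R) : c != 0 -> a * - (c^-1 / 2 * (- 2 * (b * (c * t)))) = b * (a * t).
Proof. by move=> c0; field. Qed.

Lemma fourierE (f : 'rV[R]_d -> R[i]) xi : schwartz f ->
  let u z := complex.Re (f z) in let v z := complex.Im (f z) in
  fourier f xi = Complex (cos_fourier u xi - sin_fourier v xi)
                         (sin_fourier u xi + cos_fourier v xi).
Proof.
move=> [su sv] u v; rewrite /fourier /cintegral.
have ic g : schwartz_real g -> (leb d).-integrable setT (EFin \o (fun z => cos (dot xi z) * g z)).
  by move=> sg; apply: integrable_mul_schwartz => //; [exact: measurable_cos_dot|move=> z; exact: norm_cos_le1].
have is_ g : schwartz_real g -> (leb d).-integrable setT (EFin \o (fun z => sin (dot xi z) * g z)).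
  by move=> sg; apply: integrable_mul_schwartz => //; [exact: measurable_sin_dot|move=> z; exact: norm_sin_le1].
rewrite /cos_fourier /sin_fourier -RintegralB//; [|exact: ic|exact: is_].
rewrite -RintegralD//; [|exact: is_|exact: ic].
congr Complex; apply: eq_Rintegral => z _; rewrite /u /v /expi; case: (f z) => a b //=.
by rewrite addrC.
Qed.

(** The real and imaginary parts of f are treated separately: each contributes its
    real wave to its own component of the result, and to the other component an odd
    term that integrates to zero. *)
Lemma frac_laplacian_fourier (f : 'rV[R]_d -> R[i]) x : schwartz f ->
  - (K%:C%C * frac_laplacian alpha i f x) =
  - (((2 * pi) ^- d)%:C%C * cintegral (leb d) (fun xi =>
       expi (- dot xi x) * (K * enorm xi `^ (2 * alpha))%:C%C * fourier f xi)).
Proof.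
move=> sf; have [su sv] := sf; congr (- _).
set u := (fun z => complex.Re (f z)) in su; set v := (fun z => complex.Im (f z)) in sv.
have C0 : cos_integral alpha i != 0 by rewrite gt_eqF// cos_integral_gt0.
pose r (xi : 'rV[R]_d) : R := enorm xi `^ (2 * alpha).
have iu := integrable_symbol_wave alpha_01 x su.
have iv := integrable_symbol_wave alpha_01 x sv.
have [iu' u'0] := Rintegral_symbol_wave_im alpha_01 x su.
have [iv' v'0] := Rintegral_symbol_wave_im alpha_01 x sv.
have reE : \int[leb d]_xi complex.Re (expi (- dot xi x) *
    (K * enorm xi `^ (2 * alpha))%:C%C * fourier f xi) =
    K * \int[leb d]_xi (r xi * fourier_wave u x xi).
  transitivity (K * \int[leb d]_xi (r xi * fourier_wave u x xi - r xi * fourier_wave_im v x xi)).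
    rewrite -RintegralZl; [|exact: measurableT|exact: integrable_realB].
    apply: eq_Rintegral => xi _; rewrite fourierE//= cosN sinN mulr0 subr0 mulr0 add0r.
    by rewrite /fourier_wave /fourier_wave_im /r; ring.
  by rewrite (RintegralB measurableT iu iv') v'0 subr0.
have imE : \int[leb d]_xi complex.Im (expi (- dot xi x) *
    (K * enorm xi `^ (2 * alpha))%:C%C * fourier f xi) =
    K * \int[leb d]_xi (r xi * fourier_wave v x xi).
  transitivity (K * \int[leb d]_xi (r xi * fourier_wave v x xi + r xi * fourier_wave_im u x xi)).
    rewrite -RintegralZl; [|exact: measurableT|exact: integrable_realD].
    apply: eq_Rintegral => xi _; rewrite fourierE//= cosN sinN mulr0 subr0 mulr0 add0r.
    by rewrite /fourier_wave /fourier_wave_im /r; ring.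
  by rewrite (RintegralD measurableT iv iu') u'0 addr0.
have Du := Rintegral_second_difference i alpha_01 x su.
have Dv := Rintegral_second_difference i alpha_01 x sv.
rewrite /cintegral reE imE /frac_laplacian /cintegral.
under eq_Rintegral do rewrite ReMr Re2.
under [X in Complex _ X]eq_Rintegral do rewrite ImMr Im2.
rewrite Du Dv.
rewrite [X in - X]MC NC !MC; congr Complex; exact: cancel.
Qed.

End generator.

(** * The stable limit and its generator *)

Theorem theorem3 (R : realType) (d : nat) (d_gt0 : (0 < d)%N)
    (lambda alpha p q : R)
    (lambda_gt0 : 0 < lambda) (alpha_01 : 0 < alpha < 1)
    (p_ge0 : 0 <= p) (q_ge0 : 0 <= q) (pq1 : p + q = 1)
    (disp : R -> measure_display)
    (Om : forall gamma : R, measurableType (disp gamma))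
    (P : forall gamma : R, probability (Om gamma) R)
    (N : forall gamma : R, R -> {RV (P gamma) >-> nat})
    (eps : forall gamma : R, nat -> {RV (P gamma) >-> R})
    (Y : forall gamma : R, nat -> {RV (P gamma) >-> 'rV[R]_d})
    (model : forall gamma : R, 0 < gamma ->
      randomized_sum_model lambda alpha p q gamma
        (N gamma) (eps gamma) (Y gamma))
    (disp' : measure_display) (Om' : measurableType disp')
    (P' : probability Om' R) (S : R -> {RV P' >-> 'rV[R]_d})
    (S_stable : isotropic_stable alpha S) :
  let C : R := cos_integral alpha (Ordinal d_gt0) in
  let K : R := lambda *
    (Gamma (alpha + d%:R / 2) / (pi `^ (d%:R / 2) * Gamma alpha)) * C in
  (forall t : R, 0 < t ->
    cvg_in_distribution (0 : R)^'+ P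
      (fun gamma : R =>
        randomized_sum (N gamma) (eps gamma) (Y gamma) (t / gamma `^ alpha))
      P' (S (K * t)))
  /\
  has_generator (fun t : R => S (K * t))
    (fun f x => - (K%:C%C * frac_laplacian alpha (Ordinal d_gt0) f x)).

Proof.
have a0 : 0 < alpha by case/andP : alpha_01.
have K0 : 0 <= stable_rate lambda alpha (Ordinal d_gt0).
  exact: stable_rate_ge0.
split.
  by move=> t t0; exact: (cvg_randomized_sum lambda_gt0 alpha_01 pq1 model S_stable t0).
split; first by apply: (levy_process_time_change K0); case: S_stable.
exists (fun xi => (stable_rate lambda alpha (Ordinal d_gt0) * enorm xi `^ (2 * alpha))%:C%C).
  exact: fourier_symbol_time_change.
by move=> f sf x; apply: frac_laplacian_fourier.
Qed.
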